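(* Let $f,g : B = B(0,R) \to \mathbb{H}$ be regular functions with $f\not\equiv 0$, and consider the left regular quotient $f^{-*}*g : B \setminus \mathcal{Z}_{f^s} \to \mathbb{H}$. Each $p \in \mathcal{Z}_{f^s}$ is a pole of order $$ord_{f^{-*}*g}(p) \leq m_{f^s}(p)$$ for $f^{-*}*g$, where $m_{f^s}(p)$ denotes the classical multiplicity of $f^s$ at $p$. The same holds for the right regular quotient $g * f^{-*}$. In particular $f^{-*}*g$ and $g * f^{-*}$ are semiregular on $B$.
   Context: $\mathbb{H}$ is the skew field of real quaternions, $\mathbb{S} = \{q \in \mathbb{H} : q^2=-1\}$, $L_I = \mathbb{R} + I\mathbb{R}$ for $I\in\mathbb{S}$, $B(0,R)=\{q\in\mathbb{H}:|q|<R\}$. For a domain $\Omega\subseteq\mathbb{H}$ set $\Omega_I=\Omega\cap L_I$ and, for $f:\Omega\to\mathbb{H}$, $f_I=f|_{\Omega_I}$. A real differentiable $f:\Omega\to\mathbb{H}$ is regular if for every $I\in\mathbb{S}$ the function $\frac12\left(\frac{\partial}{\partial x}+I\frac{\partial}{\partial y}\right)f_I(x+Iy)$ vanishes identically on $\Omega_I$. Regular functions on $B(0,R)$ are exactly the sums of power series $\sum_{n\ge0}q^na_n$, $a_n\in\mathbb{H}$, converging in $B(0,R)$. Regular operations: for $f=\sum q^na_n$, $g=\sum q^nb_n$ regular on $B(0,R)$, $f*g(q)=\sum_n q^n\sum_{k=0}^na_kb_{n-k}$, $f^c(q)=\sum_n q^n\bar a_n$, $f^s=f*f^c=f^c*f$,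 $f^{*n}=f*\cdots*f$ ($n$ times). $\mathcal{Z}_{f^s}$ is the zero set of $f^s$ in $B(0,R)$. The left regular quotient is $f^{-*}*g(q)=\frac{1}{f^s(q)}\,f^c*g(q)$ and the right regular quotient is $g*f^{-*}(q)=\frac{1}{f^s(q)}\,g*f^c(q)$, both on $B\setminus\mathcal{Z}_{f^s}$. For a regular $h\not\equiv0$ on $B$ and $p\in B$, the classical multiplicity $m_h(p)$ is the largest $n\in\mathbb{N}$ such that $h(q)=(q-p)^{*n}*k(q)$ for some regular $k:B\to\mathbb{H}$. Poles: if a regular $f$ is defined on an annulus $\{z\in L_I: R_1<|z-p|<R_2\}$ in a complex line $L_I$ through $p$ (for an isolated singularity in $L_I$, $R_1=0$), write $f_I(z)=\sum_{n\in\mathbb{Z}}(z-p)^na_n$ there, $a_n\in\mathbb{H}$ (for real $p$ the $a_n$ do not depend on $I$). The point $p$ is a pole if there is $n\in\mathbb{N}$ (possibly $0$) with $a_{-m}=0$ for all $m>n$; the minimum such $n$ is its (classical) order $ord_f(p)$. Otherwise $p$ is an essential singularity. Semiregular: let $\mathcal{S}\subseteq\Omega$ be such that $\mathcal{S}\cap L_I$ is a discrete subset of $\Omega_I$ for all $I\in\mathbb{S}$; a regular function $f:\Omega\setminus\mathcal{S}\to\mathbb{H}$ is semiregular on $\Omega$ if $\mathcal{S}$ contains no essential singularities for $f$. *)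

(* Defs.v *)
From Stdlib Require Import Reals ZArith ClassicalEpsilon.
From Coquelicot Require Import Coquelicot.
Open Scope R_scope.

(** * Quaternions *)

(* (a, b, c, d) stands for a + b i + c j + d k.  As an iterated product, [quat]
   inherits Coquelicot's [NormedModule R_AbsRing] structure ([plus], [opp],
   [minus], [zero], [scal], [norm]); the product norm of Coquelicot is
   sqrt (norm x ^ 2 + norm y ^ 2), so [norm q] is the Euclidean modulus |q|. *)
Definition quat : Type := (R * R * R * R)%type.

Definition RtoH (x : R) : quat := (x, 0, 0, 0).
Definition qone : quat := RtoH 1.

Definition qmul (p q : quat) : quat :=
  let '(a1, b1, c1, d1) := p in
  let '(a2, b2, c2, d2) := q in
  (a1 * a2 - b1 * b2 - c1 * c2 - d1 * d2,
   a1 * b2 + b1 * a2 + c1 * d2 - d1 * c2,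
   a1 * c2 - b1 * d2 + c1 * a2 + d1 * b2,
   a1 * d2 + b1 * c2 - c1 * b2 + d1 * a2).

Definition qconj (q : quat) : quat :=
  let '(a, b, c, d) := q in (a, - b, - c, - d).

Definition qinv (q : quat) : quat := scal (/ (norm q ^ 2)) (qconj q).

Fixpoint qpow (q : quat) (n : nat) : quat :=
  match n with
  | O => qone
  | S m => qmul q (qpow q m)
  end.

Definition qpowZ (q : quat) (n : Z) : quat :=
  match n with
  | Z0 => qone
  | Zpos k => qpow q (Pos.to_nat k)
  | Zneg k => qpow (qinv q) (Pos.to_nat k)
  end.

(** * Slices and regular functions *)

Definition imag_unit (I : quat) : Prop := qmul I I = opp qone.

Definition slice_pt (I : quat) (x y : R) : quat :=
  plus (RtoH x) (qmul I (RtoH y)).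

Definition in_slice (I q : quat) : Prop := exists x y : R, q = slice_pt I x y.

Definition Hball (rho : R) (q : quat) : Prop := norm q < rho.

(* Functions on Omega are represented by total functions; every notion below
   only looks at the values on Omega. *)
Definition regular_on (Omega : quat -> Prop) (f : quat -> quat) : Prop :=
  open Omega /\
  (forall q : quat, Omega q -> ex_filterdiff (K := R_AbsRing) f (locally q)) /\
  (forall I : quat, imag_unit I ->
   forall x y : R, Omega (slice_pt I x y) ->
   exists fx fy : quat,
     is_derive (K := R_AbsRing) (fun t : R => f (slice_pt I t y)) x fx /\
     is_derive (K := R_AbsRing) (fun t : R => f (slice_pt I x t)) y fy /\
     scal (1 / 2) (plus fx (qmul I fy)) = (zero : quat)).

(** * Regular operations on B(0, rho) *)

Definition is_expansion (rho : R) (f : quat -> quat) (a : nat -> quat) : Prop :=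
  forall q : quat, Hball rho q ->
    is_series (K := R_AbsRing) (fun n : nat => qmul (qpow q n) (a n)) (f q).

(* The coefficients a_n in f(q) = sum q^n a_n on B(0, rho). *)
Definition qcoef (rho : R) (f : quat -> quat) : nat -> quat :=
  epsilon (inhabits (fun _ : nat => (zero : quat))) (is_expansion rho f).

Definition qSeries (u : nat -> quat) : quat :=
  (Series (fun n => fst (fst (fst (u n)))),
   Series (fun n => snd (fst (fst (u n)))),
   Series (fun n => snd (fst (u n))),
   Series (fun n => snd (u n))).

Definition qPSeries (a : nat -> quat) (q : quat) : quat :=
  qSeries (fun n : nat => qmul (qpow q n) (a n)).

Definition reg_mul (rho : R) (f g : quat -> quat) : quat -> quat :=
  qPSeries (fun n : nat =>
    sum_n (fun k : nat => qmul (qcoef rho f k) (qcoef rho g (n - k)%nat)) n).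

Definition reg_conj (rho : R) (f : quat -> quat) : quat -> quat :=
  qPSeries (fun n : nat => qconj (qcoef rho f n)).

Definition reg_symm (rho : R) (f : quat -> quat) : quat -> quat :=
  reg_mul rho f (reg_conj rho f).

Fixpoint reg_pow (rho : R) (f : quat -> quat) (n : nat) : quat -> quat :=
  match n with
  | O => fun _ : quat => qone
  | S m => reg_mul rho f (reg_pow rho f m)
  end.

Definition zeros (rho : R) (h : quat -> quat) (q : quat) : Prop :=
  Hball rho q /\ h q = zero.

(* [left_quot rho f g] is f^{-*} * g and [right_quot rho g f] is g * f^{-*};
   both are meaningful on B(0, rho) minus the zeros of [reg_symm rho f]. *)
Definition left_quot (rho : R) (f g : quat -> quat) (q : quat) : quat :=
  qmul (qinv (reg_symm rho f q)) (reg_mul rho (reg_conj rho f) g q).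

Definition right_quot (rho : R) (g f : quat -> quat) (q : quat) : quat :=
  qmul (qinv (reg_symm rho f q)) (reg_mul rho g (reg_conj rho f) q).

Definition quot_dom (rho : R) (f : quat -> quat) (q : quat) : Prop :=
  Hball rho q /\ ~ zeros rho (reg_symm rho f) q.

(** * Classical multiplicity *)

Definition divisible_at (rho : R) (h : quat -> quat) (p : quat) (n : nat) : Prop :=
  exists k : quat -> quat,
    regular_on (Hball rho) k /\
    forall q : quat, Hball rho q ->
      h q = reg_mul rho (reg_pow rho (fun x : quat => minus x p) n) k q.

Definition is_multiplicity (rho : R) (h : quat -> quat) (p : quat) (n : nat) : Prop :=
  divisible_at rho h p n /\
  forall m : nat, divisible_at rho h p m -> (m <= n)%nat.

(** * Poles and semiregular functions *)

Definition is_bi_series (u : Z -> quat) (l : quat) : Prop :=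
  exists l1 l2 : quat,
    is_series (K := R_AbsRing) (fun n : nat => u (Z.of_nat n)) l1 /\
    is_series (K := R_AbsRing) (fun n : nat => u (- Z.of_nat (S n))%Z) l2 /\
    l = plus l1 l2.

(* [D] is the domain of [f]; it has to contain a punctured disc of the slice
   L_I around [p], on which the Laurent expansion holds. *)
Definition is_laurent (D : quat -> Prop) (f : quat -> quat) (I p : quat)
    (a : Z -> quat) : Prop :=
  exists r : R, 0 < r /\
    forall z : quat, in_slice I z -> 0 < norm (minus z p) < r ->
      D z /\
      is_bi_series (fun n : Z => qmul (qpowZ (minus z p) n) (a n)) (f z).

(* A non-real [p] lies in a single slice L_I = L_{-I}; a real [p] lies in all
   of them, and the condition is imposed in each. *)
Definition pole_bound (D : quat -> Prop) (f : quat -> quat) (p : quat) (n : nat) : Prop :=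
  forall I : quat, imag_unit I -> in_slice I p ->
    exists a : Z -> quat, is_laurent D f I p a /\
      forall m : nat, (n < m)%nat -> a (- Z.of_nat m)%Z = zero.

Definition is_pole (D : quat -> Prop) (f : quat -> quat) (p : quat) : Prop :=
  exists n : nat, pole_bound D f p n.

Definition is_pole_order (D : quat -> Prop) (f : quat -> quat) (p : quat) (n : nat) : Prop :=
  pole_bound D f p n /\
  forall m : nat, pole_bound D f p m -> (n <= m)%nat.

Definition essential_singularity (D : quat -> Prop) (f : quat -> quat) (p : quat) : Prop :=
  ~ is_pole D f p.

(* "Discrete subset of Omega_I": no accumulation point in Omega_I. *)
Definition slicewise_discrete (Omega S : quat -> Prop) : Prop :=
  forall I : quat, imag_unit I ->
  forall p : quat, Omega p -> in_slice I p ->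
  exists eps : R, 0 < eps /\
    forall z : quat, in_slice I z -> S z -> z <> p -> eps <= norm (minus z p).

Definition semiregular_on (Omega S : quat -> Prop) (f : quat -> quat) : Prop :=
  (forall q : quat, S q -> Omega q) /\
  slicewise_discrete Omega S /\
  regular_on (fun q : quat => Omega q /\ ~ S q) f /\
  forall p : quat, S p ->
    ~ essential_singularity (fun q : quat => Omega q /\ ~ S q) f p.

(* Main.v *)
Require Import Defs.
From Stdlib Require Import Reals ZArith Lra Lia Classical ClassicalEpsilon FunctionalExtensionality.
From Coquelicot Require Import Coquelicot.
Open Scope R_scope.

(** In terms of power series the theorem is about a central denominator.  If [a] are the
    coefficients of [f], those of [f^s] are [c n = sum_k a k * conj (a (n - k))]; each is
    self-conjugate, hence real, and they do not all vanish (for the first non-zero [a k],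
    [c (2 k) = |a k|^2]).  Both quotients therefore have the form [s^(-1) h], with [h]
    regular and [s = f^s] a power series with real coefficients, which takes values in the
    slice of [I] on that slice.  The left and the right quotient differ only in [h], and are
    treated together.

    Multiplicity.  Multiplying by [q - p] is an operation on coefficient sequences
    ([lin_mul]), so that divisibility by the [n]-th regular power of [q - p] means that [c]
    is obtained from a sequence of the same growth by [n] such operations
    ([divisible_at_coef]).  A zero at [p] splits off one factor ([factor_zero]).  Since
    [s] is not identically zero, the identity principle on a slice through [p] bounds the
    number of factors ([divisible_bounded]).  Hence there are a multiplicity [m] and a
    regular [k] with [s = (q - p)^m * k] and [k p <> 0] ([multiplicity_exists]).

    Pole.  On a slice through [p] regular multiplication by the powers of [q - p] is the
    pointwise one, so that there the quotient is [(z - p)^(-m) (k^(-1) h)].  The function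
    [k^(-1) h] satisfies the Cauchy-Riemann equations near [p], so it is the sum of a power
    series in [z - p]; dividing by [(z - p)^m] shifts this series into a Laurent series whose
    coefficients vanish below degree [-m] ([quotient_laurent]).  The order of the pole is the
    least bound of this kind, and it is at most [m].

    Analytic input.  Functions that satisfy the Cauchy-Riemann equations on a disc of a slice
    have to be power series; the same statement yields the coefficients of [f] and [g].
    Differentiability is assumed, but no continuity of the derivative, so this rests on
    Goursat's lemma ([goursat], [goursat_except_point]).  Pulling the Cauchy kernel back by
    the exponential map turns circles into sides of rectangles, and Goursat's lemma then
    gives Cauchy's formula ([cauchy_kernel_integral]); expanding the kernel as a geometric
    series gives the power series ([circle_expansion], [slice_expansion]).  Along the real
    axis a quaternionic power series is a real one with vector coefficients, which shows that
    the coefficients are unique and so do not depend on the radius or on the slice. *)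

Local Notation "p ** q" := (qmul p q) (at level 40, left associativity).

(** * Completeness of products *)

Section ProdComplete.
Context {K : AbsRing} {U V : CompleteNormedModule K}.

Definition prod_lim (F : (U * V -> Prop) -> Prop) : U * V :=
  (lim (filtermap fst F), lim (filtermap snd F)).

Lemma prod_lim_cauchy (F : (U * V -> Prop) -> Prop) :
  ProperFilter F -> cauchy F -> forall eps : posreal, F (ball (prod_lim F) eps).
Proof.
intros FF HF eps.
assert (H1 : cauchy (filtermap (fst : U * V -> U) F)).
{ intros e; destruct (HF e) as [x Hx]; exists (fst x).
  unfold filtermap; generalize Hx; apply filter_imp; now intros y [Hy _]. }
assert (H2 : cauchy (filtermap (snd : U * V -> V) F)).
{ intros e; destruct (HF e) as [x Hx]; exists (snd x).
  unfold filtermap; generalize Hx; apply filter_imp; now intros y [_ Hy]. }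
pose proof (complete_cauchy _ (filtermap_proper_filter _ _ fst F FF) H1 eps) as A1.
pose proof (complete_cauchy _ (filtermap_proper_filter _ _ snd F FF) H2 eps) as A2.
unfold filtermap at 1 in A1; unfold filtermap at 1 in A2.
generalize (filter_and _ _ A1 A2); apply filter_imp.
intros y [Hy1 Hy2]; split; assumption.
Qed.

Lemma prod_lim_close (F1 F2 : (U * V -> Prop) -> Prop) :
  filter_le F1 F2 -> filter_le F2 F1 -> close (prod_lim F1) (prod_lim F2).
Proof.
intros H1 H2 eps; split.
- refine (close_lim (filtermap (fst : U * V -> U) F1) (filtermap fst F2) _ _ eps);
    intros P HP; [apply H1 | apply H2]; exact HP.
- refine (close_lim (filtermap (snd : U * V -> V) F1) (filtermap snd F2) _ _ eps);
    intros P HP; [apply H1 | apply H2]; exact HP.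
Qed.

Definition prod_CompleteSpace_mixin :=
  CompleteSpace.Mixin (prod_UniformSpace U V) prod_lim prod_lim_cauchy prod_lim_close.

Canonical prod_CompleteNormedModule :=
  CompleteNormedModule.Pack K (U * V)
    (CompleteNormedModule.Class K (U * V) (NormedModule.class K (prod_NormedModule K U V))
       prod_CompleteSpace_mixin) (U * V).
End ProdComplete.


(** * Arithmetic of quaternions *)

#[local] Arguments qmul : simpl never.
#[local] Arguments qone : simpl never.
#[local] Arguments RtoH : simpl never.

Ltac qcomp :=
  intros;
  repeat match goal with H : ?P |- _ => match type of P with Prop => clear H end end;
  repeat match goal with q : ?T |- _ => unify T quat; destruct q as [[[? ?] ?] ?] end;
  cbv -[Rplus Rmult Ropp Rminus Rinv Rdiv IZR pow sqrt Rabs].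

Ltac qring :=
  qcomp; repeat apply (f_equal2 pair);
  match goal with |- @eq _ ?x ?y => change (@eq R x y) end; ring.

Lemma qmul_assoc p q r : p ** (q ** r) = p ** q ** r.
Proof. qring. Qed.

Lemma qmul_plus_l p q r : (plus p q) ** r = plus (p ** r) (q ** r).
Proof. qring. Qed.

Lemma qmul_plus_r p q r : p ** (plus q r) = plus (p ** q) (p ** r).
Proof. qring. Qed.

Lemma qmul_minus_l p q r : (minus p q) ** r = minus (p ** r) (q ** r).
Proof. qring. Qed.

Lemma qmul_minus_r p q r : p ** (minus q r) = minus (p ** q) (p ** r).
Proof. qring. Qed.

Lemma qmul_scal_l (k : R) p q : (scal k p) ** q = (scal k (p ** q) : quat).
Proof. qring. Qed.

Lemma qmul_scal_r (k : R) p q : p ** (scal k q) = (scal k (p ** q) : quat).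
Proof. qring. Qed.

Lemma qmul_opp_l p q : (opp p) ** q = opp (p ** q).
Proof. qring. Qed.

Lemma qmul_opp_r p q : p ** (opp q) = opp (p ** q).
Proof. qring. Qed.

Lemma qmul_one_l q : qone ** q = q.
Proof. qring. Qed.

Lemma qmul_one_r q : q ** qone = q.
Proof. qring. Qed.

Lemma qmul_zero_l q : (zero : quat) ** q = zero.
Proof. qring. Qed.

Lemma qmul_zero_r q : q ** (zero : quat) = zero.
Proof. qring. Qed.

Lemma RtoH_scal (x : R) : RtoH x = scal x qone.
Proof. qring. Qed.

Lemma RtoH_qmul (x : R) q : RtoH x ** q = scal x q.
Proof. qring. Qed.

Lemma qmul_RtoH (x : R) q : q ** RtoH x = scal x q.
Proof. qring. Qed.

Lemma norm_quatE a b c d :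
  norm ((a, b, c, d) : quat) = sqrt (a ^ 2 + b ^ 2 + c ^ 2 + d ^ 2).
Proof.
unfold norm; simpl; unfold prod_norm, norm; simpl; unfold prod_norm, norm; simpl.
unfold prod_norm, norm, abs; simpl.
assert (S : forall x, Rabs x * (Rabs x * 1) = x * (x * 1)).
{ intros x; rewrite !Rmult_1_r, <- Rabs_mult; apply Rabs_pos_eq; nra. }
rewrite !S, !Rmult_1_r, !sqrt_sqrt; [reflexivity | nra ..|].
rewrite sqrt_sqrt; nra.
Qed.

Lemma norm_qmul p q : norm (p ** q) = norm p * norm q.
Proof.
destruct p as [[[a b] c] d], q as [[[a' b'] c'] d'].
unfold qmul; rewrite !norm_quatE, <- sqrt_mult by nra.
f_equal; ring.
Qed.

Lemma norm_RtoH (x : R) : norm (RtoH x) = Rabs x.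
Proof.
unfold RtoH; rewrite norm_quatE.
rewrite <- sqrt_Rsqr_abs; f_equal; unfold Rsqr; ring.
Qed.

Lemma norm_qone : norm qone = 1.
Proof. unfold qone; rewrite norm_RtoH; apply Rabs_R1. Qed.

Lemma norm_qconj q : norm (qconj q) = norm q.
Proof. destruct q as [[[a b] c] d]; simpl; rewrite !norm_quatE; f_equal; ring. Qed.

Lemma norm_qpow q n : norm (qpow q n) = norm q ^ n.
Proof.
induction n as [|n IH]; simpl; [apply norm_qone | now rewrite norm_qmul, IH].
Qed.

Lemma norm_qscal (k : R) (q : quat) : norm (scal k q) = Rabs k * norm q.
Proof. rewrite <- RtoH_qmul, norm_qmul, norm_RtoH; reflexivity. Qed.

Lemma qminus_zero_r (q : quat) : minus q zero = q.
Proof. qring. Qed.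

Lemma qplus_minus_cancel (p q : quat) : plus (minus p q) q = p.
Proof. qring. Qed.

Lemma qminus_plus_cancel (p q : quat) : minus (plus p q) q = p.
Proof. qring. Qed.

Lemma qminus_diag (q : quat) : minus q q = (zero : quat).
Proof. qring. Qed.

Lemma qnorm_zero : norm (zero : quat) = 0.
Proof. exact (@norm_zero R_AbsRing _). Qed.

Lemma qnorm_eq_zero (q : quat) : norm q = 0 -> q = zero.
Proof. exact (@norm_eq_zero R_AbsRing _ q). Qed.

Lemma qnorm_gt_0 (q : quat) : q <> zero -> 0 < norm q.
Proof.
intros H; destruct (Rle_lt_or_eq_dec _ _ (norm_ge_0 q)) as [L|L]; auto.
now elim H; apply qnorm_eq_zero.
Qed.

Lemma qnorm_minus_sym (p q : quat) : norm (minus p q) = norm (minus q p).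
Proof. rewrite <- norm_opp; f_equal; qring. Qed.

Lemma qnorm_triangle (p q : quat) : norm (plus p q) <= norm p + norm q.
Proof. exact (@norm_triangle R_AbsRing _ p q). Qed.

Lemma qnorm_ge_0 (q : quat) : 0 <= norm q.
Proof. exact (@norm_ge_0 R_AbsRing _ q). Qed.

Lemma qnorm_opp (q : quat) : norm (opp q) = norm q.
Proof. exact (@norm_opp R_AbsRing _ q). Qed.

Lemma qnorm_minus (p q : quat) : norm (minus p q) <= norm p + norm q.
Proof. unfold minus; rewrite <- (qnorm_opp q); apply qnorm_triangle. Qed.

Lemma qnorm_le_minus (p q : quat) : norm p <= norm (minus p q) + norm q.
Proof.
replace p with (plus (minus p q) q) at 1 by qring; apply qnorm_triangle.
Qed.

Lemma qnorm_minus_le (p u v : quat) (a b : R) :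
  norm u <= a -> norm v <= b -> p = minus u v -> norm p <= a + b.
Proof.
intros Hu Hv ->; eapply Rle_trans; [apply qnorm_minus | now apply Rplus_le_compat].
Qed.

Lemma qconj_qmul p q : qconj (p ** q) = qconj q ** qconj p.
Proof. qring. Qed.

Lemma qmul_qconj q : q ** qconj q = RtoH (norm q ^ 2).
Proof.
destruct q as [[[a b] c] d]; rewrite norm_quatE, pow2_sqrt by nra.
cbv [qmul qconj RtoH]; repeat apply (f_equal2 pair); ring.
Qed.

Lemma qconj_qmul_self q : qconj q ** q = RtoH (norm q ^ 2).
Proof.
destruct q as [[[a b] c] d]; rewrite norm_quatE, pow2_sqrt by nra.
cbv [qmul qconj RtoH]; repeat apply (f_equal2 pair); ring.
Qed.

Lemma qinv_r q : q <> zero -> q ** qinv q = qone.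
Proof.
intros H; unfold qinv; rewrite qmul_scal_r, qmul_qconj, RtoH_scal.
rewrite scal_assoc; unfold mult; simpl.
pose proof (qnorm_gt_0 q H).
replace (/ _ * _) with 1 by (field; lra).
apply (scal_one (qone : quat)).
Qed.

Lemma qinv_l q : q <> zero -> qinv q ** q = qone.
Proof.
intros H; unfold qinv; rewrite qmul_scal_l, qconj_qmul_self, RtoH_scal.
rewrite scal_assoc; unfold mult; simpl.
pose proof (qnorm_gt_0 q H).
replace (/ _ * _) with 1 by (field; lra).
apply (scal_one (qone : quat)).
Qed.

Lemma norm_qinv q : q <> zero -> norm (qinv q) = / norm q.
Proof.
intros H; pose proof (qnorm_gt_0 q H).
assert (norm (qinv q) * norm q = 1) by (rewrite <- norm_qmul, qinv_l, norm_qone; auto).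
apply Rmult_eq_reg_r with (norm q); [rewrite Rinv_l|]; lra.
Qed.

Lemma qmul_eq_zero p q : p ** q = zero -> p = zero \/ q = zero.
Proof.
intros H; assert (E : norm p * norm q = 0) by (rewrite <- norm_qmul, H; apply qnorm_zero).
apply Rmult_integral in E; destruct E; [left|right]; now apply qnorm_eq_zero.
Qed.

Lemma qone_neq_zero : qone <> zero.
Proof. intros H; generalize norm_qone; rewrite H, qnorm_zero; lra. Qed.

Definition qcomm (p q : quat) : Prop := p ** q = q ** p.

Lemma qcomm_sym p q : qcomm p q -> qcomm q p.
Proof. unfold qcomm; auto. Qed.

Lemma qcomm_refl p : qcomm p p.
Proof. reflexivity. Qed.

Lemma qcomm_RtoH p x : qcomm p (RtoH x).
Proof. unfold qcomm; qring. Qed.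

Lemma qcomm_one p : qcomm p qone.
Proof. apply qcomm_RtoH. Qed.

Lemma qcomm_zero p : qcomm p zero.
Proof. unfold qcomm; now rewrite qmul_zero_l, qmul_zero_r. Qed.

Lemma qcomm_plus p q r : qcomm p q -> qcomm p r -> qcomm p (plus q r).
Proof. unfold qcomm; intros H1 H2; now rewrite qmul_plus_l, qmul_plus_r, H1, H2. Qed.

Lemma qcomm_minus p q r : qcomm p q -> qcomm p r -> qcomm p (minus q r).
Proof. unfold qcomm; intros H1 H2; now rewrite qmul_minus_l, qmul_minus_r, H1, H2. Qed.

Lemma qcomm_mul p q r : qcomm p q -> qcomm p r -> qcomm p (q ** r).
Proof.
unfold qcomm; intros H1 H2.
now rewrite qmul_assoc, H1, <- qmul_assoc, H2, qmul_assoc.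
Qed.

Lemma qcomm_scal p (k : R) q : qcomm p q -> qcomm p (scal k q).
Proof. unfold qcomm; intros H; now rewrite qmul_scal_l, qmul_scal_r, H. Qed.

Lemma qcomm_pow p q n : qcomm p q -> qcomm p (qpow q n).
Proof.
intros H; induction n as [|n IH]; simpl; [apply qcomm_one | now apply qcomm_mul].
Qed.

Lemma qcomm_inv p q : q <> zero -> qcomm p q -> qcomm p (qinv q).
Proof.
unfold qcomm; intros Hq H.
transitivity (qinv q ** (q ** p) ** qinv q).
- now rewrite (qmul_assoc (qinv q)), (qinv_l q Hq), qmul_one_l.
- now rewrite <- H, <- !qmul_assoc, (qinv_r q Hq), qmul_one_r.
Qed.

Lemma qpow_S_r q n : qpow q (S n) = qpow q n ** q.
Proof. simpl; apply qcomm_pow, qcomm_refl. Qed.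

Lemma qpow_RtoH x n : qpow (RtoH x) n = RtoH (x ^ n).
Proof.
induction n as [|n IH]; simpl; [reflexivity|].
rewrite IH; qring.
Qed.

Lemma qpow_neq_zero q n : q <> zero -> qpow q n <> zero.
Proof.
intros H E.
assert (X : norm (qpow q n) = 0) by (rewrite E; apply qnorm_zero).
rewrite norm_qpow in X.
generalize (pow_lt _ n (qnorm_gt_0 _ H)); lra.
Qed.

(** * Slices *)

Lemma slice_ptE I x y : slice_pt I x y = plus (scal x qone) (scal y I).
Proof. unfold slice_pt; now rewrite RtoH_scal, qmul_RtoH. Qed.

(** The imaginary components of [I^2] are [2 a b], [2 a c] and [2 a d]; with a non-zero real
    part [a] they would force [I] to be real. *)
Lemma imag_unit_coord I : imag_unit I ->
  exists b c d : R, I = (0, b, c, d) /\ b ^ 2 + c ^ 2 + d ^ 2 = 1.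
Proof.
destruct I as [[[a b] c] d]; unfold imag_unit.
cbv -[Rplus Rmult Ropp Rminus Rinv Rdiv IZR pow sqrt Rabs]; intros H.
injection H as H1 H2 H3 H4.
assert (Ha : a = 0).
{ assert (a * b = 0 /\ a * c = 0 /\ a * d = 0) as (Hb & Hc & Hd) by (repeat split; lra).
  destruct (Req_dec a 0) as [|Ha]; auto.
  apply Rmult_integral in Hb, Hc, Hd.
  destruct Hb, Hc, Hd; try tauto; subst; nra. }
subst a; exists b, c, d; split; [reflexivity | nra].
Qed.

Lemma slice_pt_coord b c d x y :
  slice_pt (0, b, c, d) x y = (x, b * y, c * y, d * y).
Proof. unfold slice_pt; qring. Qed.

Lemma norm_slice_pt I x y : imag_unit I -> norm (slice_pt I x y) = sqrt (x ^ 2 + y ^ 2).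
Proof.
intros HI; destruct (imag_unit_coord I HI) as (b & c & d & -> & E).
rewrite slice_pt_coord, norm_quatE.
f_equal; nra.
Qed.

Lemma norm_imag_unit I : imag_unit I -> norm I = 1.
Proof.
intros HI; destruct (imag_unit_coord I HI) as (b & c & d & -> & E).
rewrite norm_quatE, <- sqrt_1; f_equal; nra.
Qed.

Lemma qcomm_slice_pt I x y : qcomm I (slice_pt I x y).
Proof. rewrite slice_ptE; apply qcomm_plus; apply qcomm_scal; [apply qcomm_one | apply qcomm_refl]. Qed.

(** The slice of [I] is its centralizer: membership, a geometric condition, becomes a
    commutation that is stable under all operations. *)
Lemma in_slice_comm I q : imag_unit I -> in_slice I q <-> qcomm I q.
Proof.
intros HI; split; [intros (x & y & ->); apply qcomm_slice_pt|].
destruct (imag_unit_coord I HI) as (b & c & d & -> & E); destruct q as [[[a' b'] c'] d'].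
unfold qcomm, qmul; intros H; injection H as H1 H2 H3 H4.
exists a', (b * b' + c * c' + d * d').
rewrite slice_pt_coord.
assert (X1 : c * d' = d * c') by lra.
assert (X2 : b * d' = d * b') by lra.
assert (X3 : b * c' = c * b') by lra.
repeat apply (f_equal2 pair); [reflexivity | ..].
- transitivity (b' * (b ^ 2 + c ^ 2 + d ^ 2)); [rewrite E; ring|].
  transitivity (b ^ 2 * b' + c * (c * b') + d * (d * b')); [ring|].
  rewrite <- X2, <- X3; ring.
- transitivity (c' * (b ^ 2 + c ^ 2 + d ^ 2)); [rewrite E; ring|].
  transitivity (b * (b * c') + c ^ 2 * c' + d * (d * c')); [ring|].
  rewrite <- X1, X3; ring.
- transitivity (d' * (b ^ 2 + c ^ 2 + d ^ 2)); [rewrite E; ring|].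
  transitivity (b * (b * d') + c * (c * d') + d ^ 2 * d'); [ring|].
  rewrite X1, X2; ring.
Qed.

Lemma in_slice_qcomm I p q : imag_unit I -> in_slice I p -> in_slice I q -> qcomm p q.
Proof.
intros HI (x & y & ->) Hq; rewrite in_slice_comm in Hq; auto.
apply qcomm_sym; rewrite slice_ptE; apply qcomm_plus; apply qcomm_scal.
- apply qcomm_one.
- now apply qcomm_sym.
Qed.

Lemma slice_pt_minus I x y x' y' :
  minus (slice_pt I x y) (slice_pt I x' y') = slice_pt I (x - x') (y - y').
Proof. unfold slice_pt; qring. Qed.

Local Notation HN :=
  (prod_NormedModule R_AbsRing (prod_NormedModule R_AbsRing
    (prod_NormedModule R_AbsRing R_NormedModule R_NormedModule) R_NormedModule) R_NormedModule).
Local Notation HC :=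
  (@prod_CompleteNormedModule R_AbsRing (@prod_CompleteNormedModule R_AbsRing
    (@prod_CompleteNormedModule R_AbsRing R_CompleteNormedModule R_CompleteNormedModule)
    R_CompleteNormedModule) R_CompleteNormedModule).
Local Notation HG :=
  (prod_AbelianGroup (prod_AbelianGroup
    (prod_AbelianGroup R_AbelianGroup R_AbelianGroup) R_AbelianGroup) R_AbelianGroup).
Local Notation HM :=
  (prod_AbelianMonoid (prod_AbelianMonoid
    (prod_AbelianMonoid R_AbelianMonoid R_AbelianMonoid) R_AbelianMonoid) R_AbelianMonoid).

Ltac qfold :=
  repeat match goal with
  | H : context [NormedModule.AbelianGroup R_AbsRing HN] |- _ =>
      change (NormedModule.AbelianGroup R_AbsRing HN) with HG in H
  | |- context [NormedModule.AbelianGroup R_AbsRing HN] =>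
      change (NormedModule.AbelianGroup R_AbsRing HN) with HG
  | H : context [NormedModule.AbelianMonoid R_AbsRing HN] |- _ =>
      change (NormedModule.AbelianMonoid R_AbsRing HN) with HM in H
  | |- context [NormedModule.AbelianMonoid R_AbsRing HN] =>
      change (NormedModule.AbelianMonoid R_AbsRing HN) with HM
  | H : context [AbelianGroup.AbelianMonoid HG] |- _ =>
      change (AbelianGroup.AbelianMonoid HG) with HM in H
  | |- context [AbelianGroup.AbelianMonoid HG] =>
      change (AbelianGroup.AbelianMonoid HG) with HM
  | H : context [NormedModule.sort R_AbsRing HN] |- _ =>
      change (NormedModule.sort R_AbsRing HN) with quat in H
  | |- context [NormedModule.sort R_AbsRing HN] =>
      change (NormedModule.sort R_AbsRing HN) with quat
  end.

(** * Differentiability *)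

(** All differentiability proofs from first principles below have a remainder of second
    order. *)
Lemma filterdiff_quadratic {U V : NormedModule R_AbsRing} (G : U -> V) (x : U)
    (D : U -> V) (C delta : R) :
  is_linear D -> 0 < delta ->
  (forall y : U, norm (minus y x) < delta ->
     norm (minus (minus (G y) (G x)) (D (minus y x))) <= C * norm (minus y x) ^ 2) ->
  filterdiff G (locally x) D.
Proof.
intros LD Hd HG; split; [exact LD|].
intros z Hz; apply is_filter_lim_locally_unique in Hz; subst z.
intros eps; apply locally_le_locally_norm.
pose proof (cond_pos eps) as He.
pose (K := Rabs C + 1); assert (HK : 0 < K) by (unfold K; generalize (Rabs_pos C); lra).
assert (Hm : 0 < Rmin delta (eps / K)).
{ apply Rmin_glb_lt; auto; now apply Rdiv_lt_0_compat. }
exists (mkposreal _ Hm); intros y Hy; unfold ball_norm in Hy; simpl in Hy.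
pose proof (norm_ge_0 (minus y x)) as Hn.
assert (H1 : norm (minus y x) < delta) by (eapply Rlt_le_trans; [exact Hy | apply Rmin_l]).
assert (H2 : norm (minus y x) < eps / K) by (eapply Rlt_le_trans; [exact Hy | apply Rmin_r]).
eapply Rle_trans; [apply HG, H1|].
assert (H3 : K * norm (minus y x) <= eps).
{ apply Rlt_le, Rmult_lt_reg_l with (/ K); [now apply Rinv_0_lt_compat|].
  rewrite <- Rmult_assoc, Rinv_l, Rmult_1_l by lra.
  unfold Rdiv in H2; lra. }
assert (C <= K) by (unfold K; generalize (Rle_abs C); lra).
nra.
Qed.

Lemma is_linear_qmul_l (a : quat) : is_linear (K := R_AbsRing) (fun h : quat => a ** h).
Proof.
split.
- intros; apply qmul_plus_r.
- intros; apply qmul_scal_r.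
- exists (norm a + 1); split; [generalize (norm_ge_0 a); lra|].
  intros h; rewrite norm_qmul; generalize (norm_ge_0 a) (norm_ge_0 h); nra.
Qed.

Lemma is_linear_qmul_r (a : quat) : is_linear (K := R_AbsRing) (fun h : quat => h ** a).
Proof.
split.
- intros; apply qmul_plus_l.
- intros; apply qmul_scal_l.
- exists (norm a + 1); split; [generalize (norm_ge_0 a); lra|].
  intros h; rewrite norm_qmul; generalize (norm_ge_0 a) (norm_ge_0 h); nra.
Qed.

Lemma is_linear_plus_fct {U V : NormedModule R_AbsRing} (f g : U -> V) :
  is_linear f -> is_linear g -> is_linear (fun x => plus (f x) (g x)).
Proof.
intros Hf Hg.
apply (is_linear_comp (fun x => (f x, g x)) (fun t : V * V => plus (fst t) (snd t))).
- now apply is_linear_prod.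
- apply is_linear_plus.
Qed.

Lemma filterdiff_qmul_pair (p q : quat) :
  filterdiff (K := R_AbsRing) (fun t : quat * quat => fst t ** snd t) (locally (p, q))
    (fun t : quat * quat => plus (fst t ** q) (p ** snd t)).
Proof.
apply (filterdiff_quadratic (U := prod_NormedModule R_AbsRing HN HN) (V := HN) _ _ _ 1 1); [| lra |].
- apply (is_linear_plus_fct (fun t : quat * quat => fst t ** q) (fun t => p ** snd t)).
  + apply (is_linear_comp fst (fun h => h ** q)); [apply is_linear_fst | apply is_linear_qmul_r].
  + apply (is_linear_comp snd (fun h => p ** h)); [apply is_linear_snd | apply is_linear_qmul_l].
- intros [p' q'] _; cbn [fst snd].
  replace (minus _ _) with (minus p' p ** minus q' q).
  + rewrite norm_qmul.
    pose proof (norm_le_prod_norm_1 (minus (p', q') (p, q))) as H1.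
    pose proof (norm_le_prod_norm_2 (minus (p', q') (p, q))) as H2.
    change (norm (minus p' p) <= norm (minus (p', q') (p, q))) in H1.
    change (norm (minus q' q) <= norm (minus (p', q') (p, q))) in H2.
    rewrite Rmult_1_l; simpl; rewrite Rmult_1_r.
    apply Rmult_le_compat; first [exact H1 | exact H2 | apply norm_ge_0].
  + change (fst (minus (p', q') (p, q))) with (minus p' p).
    change (snd (minus (p', q') (p, q))) with (minus q' q).
    qring.
Qed.

Lemma filterdiff_qmul {U : NormedModule R_AbsRing} (F G : U -> quat) (x : U)
    (DF DG : U -> quat) :
  filterdiff F (locally x) DF -> filterdiff G (locally x) DG ->
  filterdiff (fun y => F y ** G y) (locally x)
    (fun h => plus (DF h ** G x) (F x ** DG h)).
Proof.
intros HF HG.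
apply (filterdiff_comp'_2 F G qmul x DF DG (fun a b => plus (a ** G x) (F x ** b))); auto.
apply filterdiff_qmul_pair.
Qed.

(** The remainder is [q^(-1) h q^(-1) h y^(-1)] with [h = y - q]. *)
Lemma filterdiff_qinv (q : quat) : q <> zero ->
  filterdiff (K := R_AbsRing) qinv (locally q) (fun h => opp (qinv q ** h ** qinv q)).
Proof.
intros Hq; pose proof (qnorm_gt_0 q Hq) as Hn.
apply (filterdiff_quadratic (U := HN) (V := HN) _ _ _ (2 * (/ norm q) ^ 3) (norm q / 2)); [| lra |].
- apply (is_linear_comp (fun h => qinv q ** h ** qinv q) opp); [|apply is_linear_opp].
  apply (is_linear_comp (fun h => qinv q ** h) (fun h => h ** qinv q)).
  + apply is_linear_qmul_l.
  + apply is_linear_qmul_r.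
- intros y Hy; qfold.
  assert (Hy2 : norm q / 2 < norm y).
  { pose proof (qnorm_le_minus q y) as T; rewrite qnorm_minus_sym in T.
    lra. }
  assert (Hy0 : y <> zero) by (intros ->; rewrite qnorm_zero in Hy2; lra).
  set (h := minus y q).
  replace (minus _ _) with (qinv q ** h ** qinv q ** h ** qinv y).
  + rewrite !norm_qmul, !norm_qinv by auto.
    replace (/ norm q * _ * _ * _ * _) with ((/ norm q) ^ 2 * norm h ^ 2 * / norm y) by ring.
    replace (2 * (/ norm q) ^ 3 * norm h ^ 2)
      with ((/ norm q) ^ 2 * norm h ^ 2 * / (norm q / 2)) by (field; lra).
    apply Rmult_le_compat_l; [|apply Rinv_le_contravar; lra].
    apply Rmult_le_pos; apply pow2_ge_0.
  + assert (E : qinv q ** h ** qinv y = minus (qinv q) (qinv y)).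
    { unfold h; rewrite qmul_minus_r, qmul_minus_l, qinv_l, qmul_one_l by auto.
      rewrite <- qmul_assoc, qinv_r, qmul_one_r; auto. }
    rewrite <- !qmul_assoc, (qmul_assoc (qinv q) h (qinv y)), E.
    rewrite !qmul_minus_r.
    rewrite (qmul_assoc (qinv q) h (qinv y)), E.
    rewrite (qmul_assoc (qinv q) h (qinv q)).
    generalize (qinv q ** h ** qinv q) (qinv q) (qinv y); clear; qring.
Qed.

(** [hol I e1 e2 G x] is the Cauchy-Riemann equation at [x] in the real plane spanned by
    [e1] and [e2], which plays the role of the complex line with [e2 = I e1].  With
    [e1 = 1] and [e2 = I] in the quaternions this is regularity along the slice of [I];
    with the canonical basis of the real plane it is holomorphy of a quaternion-valued
    function of a complex variable, the complex structure on the values being left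
    multiplication by [I]. *)
Definition hol {U : NormedModule R_AbsRing} (I : quat) (e1 e2 : U) (G : U -> quat) (x : U)
  : Prop :=
  exists D : U -> quat, filterdiff G (locally x) D /\ D e2 = I ** D e1.

Lemma imag_unit_slice_pt I a b : imag_unit I ->
  I ** slice_pt I a b = plus (scal a I) (scal (- b) qone).
Proof. intros HI; rewrite slice_ptE, qmul_plus_r, !qmul_scal_r, HI; qring. Qed.

Lemma cauchy_riemann_comb (a b : R) (p q : quat) :
  plus (scal a p) (scal (- b) q) = plus (scal a p) (scal b (opp q)).
Proof. qring. Qed.

Section Hol.
Context {U : NormedModule R_AbsRing}.
Variables (I : quat) (e1 e2 : U).

Lemma hol_continuous G x : hol I e1 e2 G x -> continuous G x.
Proof. intros (D & HD & _); apply (filterdiff_continuous (V := HN)); now exists D. Qed.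

Lemma hol_ext_loc G H x :
  locally x (fun y => G y = H y) -> hol I e1 e2 G x -> hol I e1 e2 H x.
Proof.
intros E (D & HD & HI); exists D; split; auto.
now apply (filterdiff_ext_locally (V := HN)) with G.
Qed.

Lemma hol_const c x : hol I e1 e2 (fun _ => c) x.
Proof.
exists (fun _ => zero); split; [apply (filterdiff_const (V := HN)) | now rewrite qmul_zero_r].
Qed.

Lemma hol_minus G H x :
  hol I e1 e2 G x -> hol I e1 e2 H x -> hol I e1 e2 (fun y => minus (G y) (H y)) x.
Proof.
intros (D & HD & HI) (D' & HD' & HI').
exists (fun h => minus (D h) (D' h)); split; [now apply (filterdiff_minus_fct (V := HN))|].
now rewrite HI, HI', qmul_minus_r.
Qed.

(** The left factor has to commute with [I] because [I] acts on the left. *)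
Lemma hol_mul G H x :
  qcomm I (G x) -> hol I e1 e2 G x -> hol I e1 e2 H x ->
  hol I e1 e2 (fun y => G y ** H y) x.
Proof.
intros C (D & HD & HI) (D' & HD' & HI').
exists (fun h => plus (D h ** H x) (G x ** D' h)); split; [now apply filterdiff_qmul|].
rewrite HI, HI', qmul_plus_r, (qmul_assoc (G x)), <- C, !qmul_assoc; reflexivity.
Qed.

Lemma hol_inv G x :
  G x <> zero -> qcomm I (G x) -> hol I e1 e2 G x -> hol I e1 e2 (fun y => qinv (G y)) x.
Proof.
intros N C (D & HD & HI).
exists (fun h => opp (qinv (G x) ** D h ** qinv (G x))); split.
- apply (filterdiff_comp' G qinv x D (fun h => opp (qinv (G x) ** h ** qinv (G x)))); auto.
  now apply filterdiff_qinv.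
- rewrite HI, qmul_assoc, <- (qcomm_inv _ _ N C), qmul_opp_r, !qmul_assoc; reflexivity.
Qed.

(** The derivative of [E] along [e1] is some [a + b I]; real linearity and the
    Cauchy-Riemann equation of [F] turn its image into [(a + b I) D 1]. *)
Lemma hol_comp (E : U -> quat) (F : quat -> quat) x (DE : U -> quat) :
  imag_unit I -> filterdiff E (locally x) DE -> DE e2 = I ** DE e1 -> qcomm I (DE e1) ->
  hol I qone I F (E x) -> hol I e1 e2 (fun y => F (E y)) x.
Proof.
intros HI HE HE2 C (D & HD & HD2).
exists (fun h => D (DE h)); split; [now apply (filterdiff_comp' (V := HN) (W := HN))|].
rewrite HE2; apply in_slice_comm in C; auto; destruct C as (a & b & ->).
destruct HD as [LD _].
rewrite imag_unit_slice_pt, slice_ptE, !(linear_plus _ LD), !(linear_scal _ LD), HD2 by auto.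
rewrite qmul_plus_r, !qmul_scal_r, qmul_assoc, HI, qmul_opp_l, qmul_one_l.
apply cauchy_riemann_comb.
Qed.
End Hol.

(** * Goursat's lemma on rectangles *)

Lemma nested_intervals (a b : nat -> R) :
  (forall n, a n <= a (S n)) -> (forall n, b (S n) <= b n) -> (forall n, a n <= b n) ->
  exists x, forall n, a n <= x <= b n.
Proof.
intros Ha Hb Hab.
assert (Ma : forall n k, a n <= a (n + k)%nat).
{ intros n k; induction k as [|k IH]; [rewrite Nat.add_0_r; lra|].
  rewrite Nat.add_succ_r; generalize (Ha (n + k)%nat); lra. }
assert (Mb : forall n k, b (n + k)%nat <= b n).
{ intros n k; induction k as [|k IH]; [rewrite Nat.add_0_r; lra|].
  rewrite Nat.add_succ_r; generalize (Hb (n + k)%nat); lra. }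
assert (Mab : forall n m, a n <= b m).
{ intros n m; generalize (Ma n m) (Mb m n) (Hab (n + m)%nat).
  rewrite (Nat.add_comm m n); lra. }
destruct (completeness (fun z => exists n, z = a n)) as [x [Hx1 Hx2]].
- exists (b 0%nat); intros z [n ->]; apply Mab.
- now exists (a 0%nat), 0%nat.
- exists x; intros n; split; [apply Hx1; now exists n|].
  apply Hx2; intros z [m ->]; apply Mab.
Qed.

Record rect := Rect { rx0 : R; rx1 : R; ry0 : R; ry1 : R }.

(** Goursat's subdivision argument: if [P] failed on the rectangle, it would fail on one of
    its quarters, and so on; the nested quarters shrink to a point, near which [P] holds. *)
Lemma rect_bisection (P : rect -> Prop) (A B C D : R) :
  A <= B -> C <= D ->
  (forall a b c d, A <= a -> a <= b -> b <= B -> C <= c -> c <= d -> d <= D ->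
     P (Rect a ((a + b) / 2) c ((c + d) / 2)) -> P (Rect ((a + b) / 2) b c ((c + d) / 2)) ->
     P (Rect a ((a + b) / 2) ((c + d) / 2) d) -> P (Rect ((a + b) / 2) b ((c + d) / 2) d) ->
     P (Rect a b c d)) ->
  (forall x y, A <= x <= B -> C <= y <= D -> exists delta, 0 < delta /\
     forall a b c d, A <= a -> b <= B -> C <= c -> d <= D -> a <= x <= b -> c <= y <= d ->
       b - a < delta -> d - c < delta -> P (Rect a b c d)) ->
  P (Rect A B C D).
Proof.
intros HAB HCD Hquarter Hloc; apply NNPP; intros HN.
pose (inner r := A <= rx0 r /\ rx0 r <= rx1 r /\ rx1 r <= B /\
                 C <= ry0 r /\ ry0 r <= ry1 r /\ ry1 r <= D).
pose (good r r' := ~ P r' /\ inner r' /\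
   rx0 r <= rx0 r' /\ rx1 r' <= rx1 r /\ ry0 r <= ry0 r' /\ ry1 r' <= ry1 r /\
   rx1 r' - rx0 r' = (rx1 r - rx0 r) / 2 /\ ry1 r' - ry0 r' = (ry1 r - ry0 r) / 2).
assert (Hstep : forall r, ~ P r -> inner r -> exists r', good r r').
{ intros [a b c d] HP (H1 & H2 & H3 & H4 & H5 & H6); simpl in *.
  apply NNPP; intros Hno; apply HP, Hquarter; auto; apply NNPP; intros HQ; apply Hno;
    (eexists; split; [exact HQ | unfold inner; simpl; repeat split; lra]). }
pose (next r := epsilon (inhabits r) (good r)).
pose (s := fix s n := match n with O => Rect A B C D | S k => next (s k) end).
assert (Hinv : forall n, ~ P (s n) /\ inner (s n)).
{ induction n as [|n [IH1 IH2]]; simpl.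
  - split; [exact HN | unfold inner; simpl; lra].
  - destruct (epsilon_spec (inhabits (s n)) (good (s n)) (Hstep _ IH1 IH2)) as (? & ? & _).
    now split. }
assert (Hgood : forall n, good (s n) (s (S n))).
{ intros n; destruct (Hinv n); apply (epsilon_spec (inhabits (s n)) (good (s n))); auto. }
destruct (nested_intervals (fun n => rx0 (s n)) (fun n => rx1 (s n))) as [x Hx];
  try (intros n; destruct (Hgood n), (Hinv n) as (_ & Hi); unfold inner in Hi; tauto).
destruct (nested_intervals (fun n => ry0 (s n)) (fun n => ry1 (s n))) as [y Hy];
  try (intros n; destruct (Hgood n), (Hinv n) as (_ & Hi); unfold inner in Hi; tauto).
assert (Hwx : forall n, rx1 (s n) - rx0 (s n) = (B - A) * (/ 2) ^ n).
{ induction n as [|n IH]; [simpl; lra|].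
  destruct (Hgood n) as (_ & _ & _ & _ & _ & _ & -> & _); rewrite IH; simpl; lra. }
assert (Hwy : forall n, ry1 (s n) - ry0 (s n) = (D - C) * (/ 2) ^ n).
{ induction n as [|n IH]; [simpl; lra|].
  destruct (Hgood n) as (_ & _ & _ & _ & _ & _ & _ & ->); rewrite IH; simpl; lra. }
destruct (Hloc x y) as (delta & Hd & HP); [apply (Hx 0%nat) | apply (Hy 0%nat) |].
destruct (pow_lt_1_zero (/ 2)) with (y := delta / ((B - A) + (D - C) + 1)) as [N HNN].
- rewrite Rabs_pos_eq; lra.
- apply Rdiv_lt_0_compat; lra.
- specialize (HNN N (le_n N)).
  rewrite Rabs_pos_eq in HNN by (apply pow_le; lra).
  assert (Hp : 0 < (/ 2) ^ N) by (apply pow_lt; lra).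
  assert (HM : ((B - A) + (D - C) + 1) * (/ 2) ^ N < delta).
  { apply Rmult_lt_reg_l with (/ ((B - A) + (D - C) + 1)); [apply Rinv_0_lt_compat; lra|].
    rewrite <- Rmult_assoc, Rinv_l, Rmult_1_l by lra; unfold Rdiv in HNN; lra. }
  destruct (Hinv N) as [HNP (I1 & I2 & I3 & I4 & I5 & I6)]; apply HNP.
  generalize (Hx N) (Hy N) (Hwx N) (Hwy N); clear HNP.
  destruct (s N) as [a b c d]; simpl in *; intros.
  apply HP; auto; try nra.
Qed.

Lemma RInt_near_const (f : R -> quat) (a b M : R) (v : quat) :
  a <= b -> ex_RInt f a b -> (forall x, a <= x <= b -> norm (minus (f x) v) <= M) ->
  norm (minus (RInt f a b) (scal (b - a) v)) <= (b - a) * M.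
Proof.
intros Hab [l Hl] HM.
rewrite (is_RInt_unique f a b l Hl).
apply (norm_RInt_le (V := HN) (fun x => minus (f x) v) (fun _ => M) a b); auto.
- apply (is_RInt_minus (V := HN)); [exact Hl | apply (is_RInt_const (V := HN))].
- apply (is_RInt_const (V := R_NormedModule)).
Qed.

(** The integral of [G dz] along the boundary.  Opposite sides are paired in a single
    integral, so that the parts of [G] that do not depend on one of the coordinates drop out
    before integration. *)
Definition rect_integral (I : quat) (G : R * R -> quat) (r : rect) : quat :=
  plus (RInt (fun x => minus (G (x, ry0 r)) (G (x, ry1 r))) (rx0 r) (rx1 r))
       (I ** RInt (fun y => minus (G (rx1 r, y)) (G (rx0 r, y))) (ry0 r) (ry1 r)).

Definition continuous_on_rect (G : R * R -> quat) (r : rect) : Prop :=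
  forall x y, rx0 r <= x <= rx1 r -> ry0 r <= y <= ry1 r -> continuous G (x, y).

Lemma ex_RInt_horizontal G a b c d y1 y2 :
  a <= b -> c <= y1 <= d -> c <= y2 <= d -> continuous_on_rect G (Rect a b c d) ->
  ex_RInt (fun x => minus (G (x, y1)) (G (x, y2))) a b.
Proof.
intros Hab H1 H2 HG; apply (ex_RInt_continuous (V := HC)); intros x Hx.
rewrite Rmin_left, Rmax_right in Hx by auto.
apply (continuous_minus (V := HN));
  (apply (continuous_comp_2 (fun x => x) (fun _ => _) (fun x y => G (x, y)));
   [apply continuous_id | apply continuous_const |]);
  (eapply continuous_ext; [|apply HG; simpl; lra]); now intros [].
Qed.

Lemma ex_RInt_vertical G a b c d x1 x2 :
  c <= d -> a <= x1 <= b -> a <= x2 <= b -> continuous_on_rect G (Rect a b c d) ->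
  ex_RInt (fun y => minus (G (x1, y)) (G (x2, y))) c d.
Proof.
intros Hab H1 H2 HG; apply (ex_RInt_continuous (V := HC)); intros x Hx.
rewrite Rmin_left, Rmax_right in Hx by auto.
apply (continuous_minus (V := HN));
  (apply (continuous_comp_2 (fun _ => _) (fun x => x) (fun x y => G (x, y)));
   [apply continuous_const | apply continuous_id |]);
  (eapply continuous_ext; [|apply HG; simpl; lra]); now intros [].
Qed.


Lemma continuous_on_subrect G a b c d a' b' c' d' :
  a <= a' -> b' <= b -> c <= c' -> d' <= d ->
  continuous_on_rect G (Rect a b c d) -> continuous_on_rect G (Rect a' b' c' d').
Proof. intros ? ? ? ? HG x y Hx Hy; apply HG; simpl in *; lra. Qed.

Lemma rect_integral_split_x I G a m b c d :
  a <= m -> m <= b -> c <= d -> continuous_on_rect G (Rect a b c d) ->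
  rect_integral I G (Rect a b c d) =
  plus (rect_integral I G (Rect a m c d)) (rect_integral I G (Rect m b c d)).
Proof.
intros H1 H2 H3 HG; unfold rect_integral; simpl.
rewrite <- (RInt_Chasles (V := HC) _ a m b).
2,3: apply (ex_RInt_horizontal G) with c d; try lra;
     revert HG; apply continuous_on_subrect; lra.
rewrite (RInt_ext (V := HC) (fun y => minus (G (b, y)) (G (a, y)))
  (fun y => plus (minus (G (m, y)) (G (a, y))) (minus (G (b, y)) (G (m, y))))).
2: intros y _; generalize (G (a, y)) (G (m, y)) (G (b, y)); clear; qring.
rewrite (RInt_plus (V := HC)).
2,3: apply (ex_RInt_vertical G) with a b; auto; lra.
simpl; rewrite qmul_plus_r.
match goal with |- plus (plus ?a ?b) (plus (_ ** ?c) (_ ** ?d)) = _ =>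
  generalize a b (I ** c) (I ** d) end; clear; qring.
Qed.

Lemma rect_integral_split_y I G a b c m d :
  c <= m -> m <= d -> a <= b -> continuous_on_rect G (Rect a b c d) ->
  rect_integral I G (Rect a b c d) =
  plus (rect_integral I G (Rect a b c m)) (rect_integral I G (Rect a b m d)).
Proof.
intros H1 H2 H3 HG; unfold rect_integral; simpl.
rewrite <- (RInt_Chasles (V := HC) _ c m d).
2,3: apply (ex_RInt_vertical G) with a b; try lra;
     revert HG; apply continuous_on_subrect; lra.
rewrite (RInt_ext (V := HC) (fun x => minus (G (x, c)) (G (x, d)))
  (fun x => plus (minus (G (x, c)) (G (x, m))) (minus (G (x, m)) (G (x, d))))).
2: intros y _; generalize (G (y, c)) (G (y, m)) (G (y, d)); clear; qring.
rewrite (RInt_plus (V := HC)).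
2,3: apply (ex_RInt_horizontal G) with c d; auto; lra.
simpl; rewrite qmul_plus_r.
match goal with |- plus (plus ?a ?b) (plus (_ ** ?c) (_ ** ?d)) = _ =>
  generalize a b (I ** c) (I ** d) end; clear; qring.
Qed.

Local Notation RR := (prod_NormedModule R_AbsRing R_NormedModule R_NormedModule).
Local Notation e1 := ((1, 0) : R * R).
Local Notation e2 := ((0, 1) : R * R).

(** Complex linearity of the differential, in terms of increments. *)
Lemma hol_plane_approx I G x0 y0 : hol (U := RR) I e1 e2 G (x0, y0) ->
  exists v : quat, forall eps, 0 < eps -> exists delta, 0 < delta /\
    forall x y, Rabs (x - x0) < delta -> Rabs (y - y0) < delta ->
      norm (minus (minus (G (x, y)) (G (x0, y0)))
                  (plus (scal (x - x0) v) (scal (y - y0) (I ** v))))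
      <= eps * (Rabs (x - x0) + Rabs (y - y0)).
Proof.
intros (D & [LD HD] & HI); exists (D e1); intros eps Heps.
destruct (HD (x0, y0) (fun P H => H) (mkposreal _ Heps)) as [delta Hd].
exists delta; split; [apply cond_pos|]; intros x y Hx Hy.
specialize (Hd (x, y) (conj Hx Hy)); simpl in Hd.
match type of Hd with context [D ?m] => set (h := m) in Hd end.
assert (Eh : h = plus (scal (x - x0) e1) (scal (y - y0) e2)).
{ unfold h; cbv -[Rplus Rmult Ropp Rminus Rinv Rdiv IZR]; apply (f_equal2 pair); ring. }
rewrite Eh in Hd at 1; rewrite (linear_plus _ LD), !(linear_scal _ LD), HI in Hd.
eapply Rle_trans; [exact Hd|]; apply Rmult_le_compat_l; [lra|].
rewrite Eh; eapply Rle_trans; [apply (norm_triangle (V := RR))|].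
apply Rplus_le_compat; (eapply Rle_trans; [apply (norm_scal (V := RR))|]).
- replace (norm e1) with 1; [unfold abs; simpl; lra|].
  unfold norm; simpl; unfold prod_norm, norm; simpl; unfold abs; simpl.
  transitivity (sqrt 1); [symmetry; apply sqrt_1|]; rewrite Rabs_R0, Rabs_R1; f_equal; ring.
- replace (norm e2) with 1; [unfold abs; simpl; lra|].
  unfold norm; simpl; unfold prod_norm, norm; simpl; unfold abs; simpl.
  transitivity (sqrt 1); [symmetry; apply sqrt_1|]; rewrite Rabs_R0, Rabs_R1; f_equal; ring.
Qed.

(** The first order part of [G] at [(x0, y0)] has opposite sides differing by constants,
    whose contributions cancel because the vertical sides carry the factor [I]; what remains
    is of order [eps] times the square of the half-perimeter. *)
Lemma rect_integral_local I G A B C D x0 y0 :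
  imag_unit I -> continuous_on_rect G (Rect A B C D) ->
  hol (U := RR) I e1 e2 G (x0, y0) ->
  forall eps, 0 < eps -> exists delta, 0 < delta /\
    forall a b c d, A <= a -> b <= B -> C <= c -> d <= D -> a <= x0 <= b -> c <= y0 <= d ->
      b - a < delta -> d - c < delta ->
      norm (rect_integral I G (Rect a b c d)) <= eps * ((b - a) + (d - c)) ^ 2.
Proof.
intros HI HG Hh eps Heps; destruct (hol_plane_approx _ _ _ _ Hh) as [v Hv].
destruct (Hv (eps / 2)) as (delta & Hd & Happ); [lra|].
exists delta; split; auto; intros a b c d Ha Hb Hc Hd' Hx Hy Hba Hdc.
assert (HG' : continuous_on_rect G (Rect a b c d)).
{ revert HG; apply continuous_on_subrect; auto. }
set (s := (b - a) + (d - c)).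
assert (Hs : forall x y, a <= x <= b -> c <= y <= d ->
  norm (minus (minus (G (x, y)) (G (x0, y0))) (plus (scal (x - x0) v) (scal (y - y0) (I ** v))))
    <= eps / 2 * s).
{ intros x y Hx' Hy'.
  assert (Rabs (x - x0) <= b - a) by (apply Rabs_le; lra).
  assert (Rabs (y - y0) <= d - c) by (apply Rabs_le; lra).
  eapply Rle_trans; [apply Happ; lra|]; apply Rmult_le_compat_l; unfold s; lra. }
set (IH := RInt (fun x => minus (G (x, c)) (G (x, d))) a b).
set (IV := RInt (fun y => minus (G (b, y)) (G (a, y))) c d).
assert (EH : norm (minus IH (scal (b - a) (scal (c - d) (I ** v)))) <= (b - a) * (eps * s)).
{ apply RInt_near_const; [lra | apply (ex_RInt_horizontal G) with c d; auto; lra |].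
  intros x Hx'; replace (eps * s) with (eps / 2 * s + eps / 2 * s) by field.
  eapply qnorm_minus_le; [apply (Hs x c) | apply (Hs x d) |]; try lra.
  generalize (G (x, c)) (G (x, d)) (G (x0, y0)) (I ** v); clear; qring. }
assert (EV : norm (minus IV (scal (d - c) (scal (b - a) v))) <= (d - c) * (eps * s)).
{ apply RInt_near_const; [lra | apply (ex_RInt_vertical G) with a b; auto; lra |].
  intros y Hy'; replace (eps * s) with (eps / 2 * s + eps / 2 * s) by field.
  eapply qnorm_minus_le; [apply (Hs b y) | apply (Hs a y) |]; try lra.
  generalize (G (b, y)) (G (a, y)) (G (x0, y0)) (I ** v); clear; qring. }
change (rect_integral I G (Rect a b c d)) with (plus (IH : quat) (I ** IV)).
replace (plus (IH : quat) (I ** IV))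
  with (plus (minus (IH : quat) (scal (b - a) (scal (c - d) (I ** v))))
             (I ** minus (IV : quat) (scal (d - c) (scal (b - a) v)))).
2: { rewrite qmul_minus_r, !qmul_scal_r; generalize (I ** v) (I ** IV) (IH : quat); clear; qring. }
eapply Rle_trans; [apply qnorm_triangle|]; rewrite norm_qmul, (norm_imag_unit I HI), Rmult_1_l.
eapply Rle_trans; [apply (Rplus_le_compat _ _ _ _ EH EV)|].
unfold s; right; ring.
Qed.

(** Local smallness with respect to the square of the half-perimeter is preserved by
    subdivision, so it holds globally with every [eps]. *)
Lemma goursat I G A B C D :
  imag_unit I -> A <= B -> C <= D -> continuous_on_rect G (Rect A B C D) ->
  (forall x y, A <= x <= B -> C <= y <= D -> hol (U := RR) I e1 e2 G (x, y)) ->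
  rect_integral I G (Rect A B C D) = zero.
Proof.
intros HI HAB HCD HG Hh; apply qnorm_eq_zero, Rle_antisym; [|apply qnorm_ge_0].
set (s := ((B - A) + (D - C)) ^ 2).
assert (Hs : 0 <= s) by apply pow2_ge_0.
apply le_epsilon; intros eps Heps; rewrite Rplus_0_l.
(* subdividing into quarters preserves a bound by the square of the half-perimeter *)
assert (K : norm (rect_integral I G (Rect A B C D)) <= eps / (s + 1) * s).
{ apply (rect_bisection (fun r => norm (rect_integral I G r) <=
    eps / (s + 1) * ((rx1 r - rx0 r) + (ry1 r - ry0 r)) ^ 2) A B C D); auto.
  - intros a b c d Ha Hab Hb Hc Hcd Hd; simpl rx0; simpl rx1; simpl ry0; simpl ry1.
    intros H1 H2 H3 H4.
    assert (HG' : continuous_on_rect G (Rect a b c d)).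
    { revert HG; apply continuous_on_subrect; auto. }
    rewrite (rect_integral_split_x I G a ((a + b) / 2) b c d) by (auto; lra).
    rewrite (rect_integral_split_y I G a _ c ((c + d) / 2) d); try lra.
    2: revert HG'; apply continuous_on_subrect; lra.
    rewrite (rect_integral_split_y I G _ b c ((c + d) / 2) d); try lra.
    2: revert HG'; apply continuous_on_subrect; lra.
    eapply Rle_trans; [apply qnorm_triangle|].
    eapply Rle_trans; [apply Rplus_le_compat; apply qnorm_triangle|].
    eapply Rle_trans; [exact (Rplus_le_compat _ _ _ _ (Rplus_le_compat _ _ _ _ H1 H3)
      (Rplus_le_compat _ _ _ _ H2 H4))|].
    right; field; lra.
  - intros x y Hx Hy.
    destruct (rect_integral_local I G A B C D x y HI HG (Hh x y Hx Hy) (eps / (s + 1)))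
      as (delta & Hd & K); [apply Rdiv_lt_0_compat; lra|].
    exists delta; split; auto. }
eapply Rle_trans; [exact K|].
apply Rmult_le_reg_l with (s + 1); [lra|].
replace ((s + 1) * (eps / (s + 1) * s)) with (eps * s) by (field; lra); nra.
Qed.

(** A single interior point at which [G] is only continuous is harmless: it can be
    isolated in an arbitrarily small square, whose contribution is small. *)
Lemma goursat_except_point I G A B C D x0 y0 :
  imag_unit I -> A < x0 < B -> C < y0 < D -> continuous_on_rect G (Rect A B C D) ->
  (forall x y, A <= x <= B -> C <= y <= D -> (x, y) <> (x0, y0) ->
     hol (U := RR) I e1 e2 G (x, y)) ->
  rect_integral I G (Rect A B C D) = zero.
Proof.
intros HI Hx0 Hy0 HG Hh; apply qnorm_eq_zero, Rle_antisym; [|apply qnorm_ge_0].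
apply le_epsilon; intros eps Heps; rewrite Rplus_0_l.
assert (Hc0 : continuous G (x0, y0)) by (apply HG; simpl; lra).
destruct (Hc0 (fun p => norm (minus p (G (x0, y0))) < 1)) as [delta Hdelta].
{ apply (locally_le_locally_norm (V := HN)); exists (mkposreal 1 Rlt_0_1); intros p Hp; exact Hp. }
set (M := norm (G (x0, y0)) + 1).
assert (HM1 : 1 <= M) by (unfold M; generalize (qnorm_ge_0 (G (x0, y0))); lra).
assert (HM : forall x y, Rabs (x - x0) < delta -> Rabs (y - y0) < delta -> norm (G (x, y)) <= M).
{ intros x y Hx Hy; specialize (Hdelta (x, y) (conj Hx Hy)).
  eapply Rle_trans; [apply (qnorm_le_minus _ (G (x0, y0)))|].
  change (norm (minus (G (x, y)) (G (x0, y0))) < 1) in Hdelta.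
  unfold M; lra. }
pose proof (cond_pos delta) as Hd.
set (m := Rmin (Rmin (x0 - A) (B - x0)) (Rmin (y0 - C) (D - y0))).
assert (Hm : 0 < m /\ m <= x0 - A /\ m <= B - x0 /\ m <= y0 - C /\ m <= D - y0).
{ unfold m, Rmin; repeat destruct Rle_dec; lra. }
(* half the side of the square; the last bound makes its contribution at most [eps] *)
set (eta := Rmin (m / 2) (Rmin (delta / 2) (eps / (8 * M)))).
assert (He : 0 < eta /\ eta < m /\ eta < delta /\ 8 * M * eta <= eps).
{ assert (0 < eps / (8 * M)) by (apply Rdiv_lt_0_compat; lra).
  assert (E : 8 * M * (eps / (8 * M)) = eps) by (field; lra).
  assert (eta <= eps / (8 * M)) by (unfold eta, Rmin; repeat destruct Rle_dec; lra).
  repeat split; [unfold eta, Rmin; repeat destruct Rle_dec; lra .. |].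
  rewrite <- E; apply Rmult_le_compat_l; lra. }
assert (Hsub : forall a b c d, A <= a -> b <= B -> C <= c -> d <= D ->
  continuous_on_rect G (Rect a b c d)).
{ intros; revert HG; apply continuous_on_subrect; auto. }
assert (Hz : forall a b c d, A <= a -> a <= b -> b <= B -> C <= c -> c <= d -> d <= D ->
  (b < x0 \/ x0 < a \/ d < y0 \/ y0 < c) -> rect_integral I G (Rect a b c d) = zero).
{ intros a b c d; intros; apply goursat; auto.
  intros x y Hx Hy; apply Hh; try lra; intros E; injection E; lra. }
assert (EQ : rect_integral I G (Rect A B C D) =
  rect_integral I G (Rect (x0 - eta) (x0 + eta) (y0 - eta) (y0 + eta))).
{ rewrite (rect_integral_split_x I G A (x0 - eta) B C D); try lra; [|apply Hsub; lra].
  rewrite (rect_integral_split_x I G (x0 - eta) (x0 + eta) B C D); try lra; [|apply Hsub; lra].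
  rewrite (rect_integral_split_y I G (x0 - eta) (x0 + eta) C (y0 - eta) D); try lra; [|apply Hsub; lra].
  rewrite (rect_integral_split_y I G (x0 - eta) (x0 + eta) (y0 - eta) (y0 + eta) D); try lra;
    [|apply Hsub; lra].
  rewrite (Hz A), (Hz (x0 + eta)), (Hz _ _ C), (Hz _ _ (y0 + eta)) by lra.
  generalize (rect_integral I G (Rect (x0 - eta) (x0 + eta) (y0 - eta) (y0 + eta))); clear; qring. }
rewrite EQ; unfold rect_integral; simpl.
eapply Rle_trans; [apply qnorm_triangle|]; rewrite norm_qmul, (norm_imag_unit I HI), Rmult_1_l.
assert (K : forall (f : R -> quat) a b, b - a = 2 * eta -> ex_RInt f a b ->
  (forall x, a <= x <= b -> norm (f x) <= 2 * M) -> norm (RInt f a b) <= 4 * M * eta).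
{ intros f a b Eab Hex Hf.
  pose proof (RInt_near_const f a b (2 * M) zero) as T.
  assert (Z : forall q : quat, minus q (scal (b - a) zero) = q).
  { intros q; rewrite (scal_zero_r (V := HN)); apply (minus_zero_r q). }
  rewrite Z in T; replace (4 * M * eta) with ((b - a) * (2 * M)) by (rewrite Eab; ring).
  apply T; [lra | exact Hex |]; intros x Hx.
  rewrite qminus_zero_r; exact (Hf x Hx). }
apply Rle_trans with (4 * M * eta + 4 * M * eta); [|lra].
apply Rplus_le_compat; apply K; try lra.
- apply (ex_RInt_horizontal G) with (y0 - eta) (y0 + eta); try lra; apply Hsub; lra.
- intros x Hx; eapply Rle_trans; [apply qnorm_minus|].
  replace (2 * M) with (M + M) by ring.
  apply Rplus_le_compat; apply HM; apply Rabs_def1; lra.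
- apply (ex_RInt_vertical G) with (x0 - eta) (x0 + eta); try lra; apply Hsub; lra.
- intros x Hx; eapply Rle_trans; [apply qnorm_minus|].
  replace (2 * M) with (M + M) by ring.
  apply Rplus_le_compat; apply HM; apply Rabs_def1; lra.
Qed.


(** * Polar coordinates in a slice *)

(** The circle of radius [s] in the slice of [I]. *)
Definition circ (I : quat) (s v : R) : quat := slice_pt I (s * cos v) (s * sin v).

Lemma circ_mult I s t u v : imag_unit I -> circ I s u ** circ I t v = circ I (s * t) (u + v).
Proof.
intros HI; unfold circ; rewrite cos_plus, sin_plus.
rewrite !slice_ptE, qmul_plus_l, !qmul_plus_r, !qmul_scal_l, !qmul_scal_r, HI.
rewrite !qmul_one_l, !qmul_one_r; qring.
Qed.

Lemma circ_one I : circ I 1 0 = qone.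
Proof. unfold circ; rewrite cos_0, sin_0, slice_ptE; qring. Qed.

Lemma norm_circ I s v : imag_unit I -> 0 <= s -> norm (circ I s v) = s.
Proof.
intros HI Hs; unfold circ; rewrite norm_slice_pt by auto.
rewrite <- (sqrt_Rsqr s Hs) at 3; f_equal; generalize (sin2_cos2 v); unfold Rsqr.
intros E; transitivity (s * s * (sin v * sin v + cos v * cos v)); [ring | rewrite E; ring].
Qed.

Lemma circ_neq_zero I s v : imag_unit I -> 0 < s -> circ I s v <> zero.
Proof.
intros HI Hs E; generalize (norm_circ I s v HI (Rlt_le _ _ Hs)); rewrite E, qnorm_zero; lra.
Qed.

Lemma in_slice_circ I s v : in_slice I (circ I s v).
Proof. now exists (s * cos v), (s * sin v). Qed.

Lemma circ_shift_pi I s v : circ I s (v + PI) = opp (circ I s v).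
Proof. unfold circ; rewrite neg_cos, neg_sin, !slice_ptE; qring. Qed.

Lemma circ_period I s v : circ I s (v + 2 * PI) = circ I s v.
Proof.
unfold circ; replace (v + 2 * PI) with (v + 2 * INR 1 * PI) by (simpl; ring).
now rewrite cos_period, sin_period.
Qed.

Lemma circ_inv I s v : imag_unit I -> 0 < s -> qinv (circ I s v) = circ I (/ s) (- v).
Proof.
intros HI Hs; pose proof (circ_neq_zero I s v HI Hs) as Hn.
rewrite <- (qmul_one_r (qinv _)), <- (circ_one I).
replace (circ I 1 0) with (circ I s v ** circ I (/ s) (- v)).
- now rewrite qmul_assoc, (qinv_l _ Hn), qmul_one_l.
- rewrite circ_mult by auto; f_equal; field; lra.
Qed.

Lemma circ_pow I s v n : imag_unit I -> qpow (circ I s v) n = circ I (s ^ n) (INR n * v).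
Proof.
intros HI; induction n as [|n IH].
- simpl; rewrite Rmult_0_l; symmetry; apply circ_one.
- rewrite S_INR; simpl qpow; rewrite IH, circ_mult by auto; f_equal; simpl; ring.
Qed.

Lemma polar_form I z : imag_unit I -> in_slice I z -> z <> zero ->
  exists theta, z = circ I (norm z) theta.
Proof.
intros HI (x & y & ->) Hz; pose proof (qnorm_gt_0 _ Hz) as Hn.
rewrite norm_slice_pt in Hn |- * by auto; set (s := sqrt (x ^ 2 + y ^ 2)) in *.
assert (Hs : s * s = x ^ 2 + y ^ 2) by (apply sqrt_sqrt; nra).
assert (Hx : -1 <= x / s <= 1).
{ assert (- s <= x <= s) by (split; nra).
  split; apply Rmult_le_reg_r with s; auto; unfold Rdiv; rewrite Rmult_assoc, Rinv_l; lra. }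
assert (Hsin : s * sqrt (1 - (x / s)²) = Rabs y).
{ rewrite <- (sqrt_Rsqr s) at 1 by lra; rewrite <- sqrt_mult_alt by apply Rle_0_sqr.
  rewrite <- sqrt_Rsqr_abs; f_equal; unfold Rsqr.
  transitivity (s * s - x * x); [field; lra | rewrite Hs; ring]. }
assert (Hcos : s * (x / s) = x) by (field; lra).
destruct (Rle_or_lt 0 y) as [Hy|Hy].
- exists (acos (x / s)); unfold circ; rewrite cos_acos, sin_acos, Hsin, Hcos by auto.
  now rewrite Rabs_pos_eq.
- exists (- acos (x / s)); unfold circ; rewrite cos_neg, sin_neg, cos_acos, sin_acos by auto.
  rewrite Ropp_mult_distr_r_reverse, Hsin, Hcos, Rabs_left by auto.
  f_equal; ring.
Qed.

Lemma slice_pt_inj I x y x' y' : imag_unit I ->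
  slice_pt I x y = slice_pt I x' y' -> x = x' /\ y = y'.
Proof.
intros HI E; destruct (imag_unit_coord I HI) as (b & c & d & -> & N).
rewrite !slice_pt_coord in E; injection E as H1 H2 H3 H4; split; auto.
transitivity (y * (b ^ 2 + c ^ 2 + d ^ 2)); [rewrite N; ring|].
transitivity (y' * (b ^ 2 + c ^ 2 + d ^ 2)); [|rewrite N; ring].
transitivity (b * (b * y) + c * (c * y) + d * (d * y)); [ring|].
rewrite H2, H3, H4; ring.
Qed.

(** At both ends of the closed window the cosine of [v - theta] is [-1], not [1]. *)
Lemma circ_inj I s t theta v : imag_unit I -> 0 < s -> 0 < t ->
  theta - PI <= v <= theta + PI -> circ I s theta = circ I t v -> s = t /\ v = theta.
Proof.
intros HI Hs Ht Hv E.
assert (Est : s = t).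
{ rewrite <- (norm_circ I s theta), <- (norm_circ I t v) by (auto; lra); now rewrite E. }
split; auto; subst t; apply slice_pt_inj in E; auto; destruct E as [E1 E2].
apply Rmult_eq_reg_l in E1; [|lra]; apply Rmult_eq_reg_l in E2; [|lra].
assert (C : cos (v - theta) = 1).
{ rewrite cos_minus, <- E1, <- E2; generalize (sin2_cos2 theta); unfold Rsqr; lra. }
destruct (Rle_or_lt theta v).
- enough (v - theta = 0) by lra.
  apply cos_inj; try (generalize PI_RGT_0; lra); now rewrite C, cos_0.
- enough (theta - v = 0) by lra.
  apply cos_inj; try (generalize PI_RGT_0; lra).
  rewrite cos_0, <- C, <- cos_neg; f_equal; ring.
Qed.

(** The exponential map [u + I v |-> e^u (cos v + I sin v)] onto the punctured slice. *)
Definition slice_exp (I : quat) (w : R * R) : quat := circ I (exp (fst w)) (snd w).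

Lemma filterdiff_exp_trig (g g' : R -> R) (w : R * R) :
  is_derive g (snd w) (g' (snd w)) ->
  filterdiff (U := RR) (V := R_NormedModule) (fun t => exp (fst t) * g (snd t)) (locally w)
    (fun h => fst h * exp (fst w) * g (snd w) + exp (fst w) * (snd h * g' (snd w))).
Proof.
intros Hg.
apply (filterdiff_mult_fct (K := R_AbsRing) (U := RR) (fun t => exp (fst t)) (fun t => g (snd t)) w
  (fun h => fst h * exp (fst w)) (fun h => snd h * g' (snd w))).
- intros; apply Rmult_comm.
- apply (filterdiff_comp' (U := RR) (V := R_NormedModule) (W := R_NormedModule)
    (fun t => fst t) exp w (fun h => fst h) (fun y => y * exp (fst w))).
  + apply filterdiff_linear, (is_linear_fst (U := R_NormedModule) (V := R_NormedModule)).
  + apply is_derive_exp.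
- apply (filterdiff_comp' (U := RR) (V := R_NormedModule) (W := R_NormedModule)
    (fun t => snd t) g w (fun h => snd h) (fun y => y * g' (snd w))).
  + apply filterdiff_linear, (is_linear_snd (U := R_NormedModule) (V := R_NormedModule)).
  + exact Hg.
Qed.

Lemma filterdiff_slice_exp I w : imag_unit I ->
  filterdiff (U := RR) (V := HN) (slice_exp I) (locally w)
    (fun h => slice_pt I (fst h) (snd h) ** slice_exp I w).
Proof.
intros HI.
assert (H1 := filterdiff_exp_trig cos (fun v => - sin v) w (is_derive_cos _)).
assert (H2 := filterdiff_exp_trig sin cos w (is_derive_sin _)).
apply (filterdiff_scal_l_fct (U := RR) (V := HN) qone) in H1.
apply (filterdiff_scal_l_fct (U := RR) (V := HN) I) in H2.
generalize (filterdiff_plus_fct (U := RR) (V := HN) _ _ _ _ H1 H2); clear H1 H2; intros H.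
eapply (filterdiff_ext (U := RR) (V := HN)); [|eapply (filterdiff_ext_lin (U := RR) (V := HN)); [exact H|]].
- intros y; unfold slice_exp, circ; now rewrite slice_ptE.
- intros [h k]; unfold slice_exp, circ; simpl fst; simpl snd.
  rewrite !slice_ptE, qmul_plus_l, !qmul_plus_r, !qmul_scal_l, !qmul_scal_r, HI.
  rewrite !qmul_one_l, !qmul_one_r.
  generalize (exp (fst w)) (cos (snd w)) (sin (snd w)); clear; qring.
Qed.

Lemma slice_exp_comp_hol I F w : imag_unit I ->
  hol (U := HN) I qone I F (slice_exp I w) -> hol (U := RR) I e1 e2 (fun t => F (slice_exp I t)) w.
Proof.
intros HI HF.
apply (hol_comp (U := RR) I e1 e2 (slice_exp I) F w (fun h => slice_pt I (fst h) (snd h) ** slice_exp I w)); auto.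
- now apply filterdiff_slice_exp.
- simpl; rewrite qmul_assoc; f_equal; rewrite !slice_ptE, qmul_plus_r, !qmul_scal_r, HI; qring.
- simpl; apply qcomm_mul; [apply qcomm_slice_pt | apply qcomm_slice_pt].
Qed.

Lemma hol_id I x : hol (U := HN) I qone I (fun q => q) x.
Proof.
exists (fun q => q); split; [apply (filterdiff_id (V := HN)) | now rewrite qmul_one_r].
Qed.

Lemma slice_exp_hol I w : imag_unit I -> hol (U := RR) I e1 e2 (slice_exp I) w.
Proof. intros HI; apply (slice_exp_comp_hol I (fun q => q)); auto; apply hol_id. Qed.


(** * Cauchy's integral formula *)

Lemma qnorm_continuous_bound {U : UniformSpace} (G : U -> quat) (x : U) (eps : R) :
  0 < eps -> continuous G x -> locally x (fun y => norm (minus (G y) (G x)) < eps).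
Proof.
intros He HG; apply (HG (fun q => norm (minus q (G x)) < eps)).
apply (locally_le_locally_norm (V := HN)); exists (mkposreal _ He); intros q Hq; exact Hq.
Qed.

Lemma continuous_qnorm {U : UniformSpace} (G : U -> quat) (x : U) :
  (forall eps, 0 < eps -> locally x (fun y => norm (minus (G y) (G x)) <= eps)) ->
  continuous G x.
Proof.
intros HG P HP; apply (locally_norm_le_locally (V := HN)) in HP; destruct HP as [eps HP].
pose proof (cond_pos eps) as He.
generalize (HG (eps / 2) ltac:(lra)); unfold filtermap; apply filter_imp.
intros y Hy; apply HP; unfold ball_norm; qfold; lra.
Qed.

Lemma continuous_qmul {U : UniformSpace} (F G : U -> quat) (x : U) :
  continuous F x -> continuous G x -> continuous (fun y => F y ** G y) x.
Proof.
intros HF HG; apply (continuous_comp_2 F G qmul); auto.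
apply (filterdiff_continuous (U := prod_NormedModule R_AbsRing HN HN) (V := HN)).
eexists; apply filterdiff_qmul_pair.
Qed.

(** Along the slice an increment [x - z] is a complex multiple of [1], so the differential
    acts on it as multiplication by [d]. *)
Lemma hol_slice_approx I F z : imag_unit I -> in_slice I z -> hol (U := HN) I qone I F z ->
  exists d : quat, forall eps, 0 < eps -> exists delta, 0 < delta /\
    forall x, in_slice I x -> norm (minus x z) < delta ->
      norm (minus (minus (F x) (F z)) (minus x z ** d)) <= eps * norm (minus x z).
Proof.
intros HI Hz (D & [LD HD] & HDI); exists (D qone); intros eps Heps.
destruct (locally_norm_le_locally (V := HN) _ _ (HD z (fun P H => H) (mkposreal _ Heps)))
  as [delta Hd].
exists delta; split; [apply cond_pos|]; intros x Hx Hn.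
specialize (Hd x Hn); simpl pos in Hd; qfold.
replace (minus x z ** D qone) with (D (minus x z)); auto.
destruct Hx as (a & b & ->), Hz as (a' & b' & ->).
rewrite slice_pt_minus, slice_ptE, (linear_plus _ LD), !(linear_scal _ LD), HDI.
rewrite qmul_plus_l, !qmul_scal_l, qmul_one_l; reflexivity.
Qed.

(** The value [d] is meant to be the derivative at [z]: it makes the function continuous
    along the slice, so that [z] is only an exceptional point for Goursat's lemma. *)
Definition diff_quot (F : quat -> quat) (z d x : quat) : quat :=
  if excluded_middle_informative (x = z) then d
  else qinv (minus x z) ** minus (F x) (F z).

Lemma diff_quot_neq F z d x : x <> z ->
  diff_quot F z d x = qinv (minus x z) ** minus (F x) (F z).
Proof. unfold diff_quot; destruct excluded_middle_informative; tauto. Qed.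

Lemma qminus_eq_zero (p q : quat) : minus p q = zero -> p = q.
Proof.
intros H; replace p with (plus (minus p q) q) by qring; rewrite H; qring.
Qed.

Lemma in_slice_zero I : in_slice I zero.
Proof.
exists 0, 0; rewrite slice_ptE.
now rewrite !(scal_zero_l (V := HN)), plus_zero_l.
Qed.

Section CauchyKernel.
Variables (I : quat) (F : quat -> quat) (r : R).
Hypothesis HI : imag_unit I.
Hypothesis HF : forall q, in_slice I q -> norm q < r -> hol (U := HN) I qone I F q.

Lemma diff_quot_near z : in_slice I z -> norm z < r -> exists d : quat,
  forall eps, 0 < eps -> exists delta, 0 < delta /\
    forall x, in_slice I x -> norm (minus x z) < delta ->
      norm (minus (diff_quot F z d x) d) <= eps.
Proof.
intros Hz Hzr; destruct (hol_slice_approx I F z HI Hz (HF z Hz Hzr)) as [d Hd].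
exists d; intros eps He; destruct (Hd eps He) as (delta & Hdelta & H).
exists delta; split; auto; intros x Hx Hn.
unfold diff_quot; destruct excluded_middle_informative as [E|E].
- replace (minus d d) with (zero : quat) by (clear; qring); rewrite qnorm_zero; lra.
- assert (N : minus x z <> zero) by (intros Z; apply E, qminus_eq_zero, Z).
  pose proof (qnorm_gt_0 _ N) as P.
  replace (minus _ d) with (qinv (minus x z) ** minus (minus (F x) (F z)) (minus x z ** d)).
  + rewrite norm_qmul, (norm_qinv _ N).
    apply Rmult_le_reg_l with (norm (minus x z)); auto.
    rewrite <- Rmult_assoc, Rinv_r, Rmult_1_l by lra.
    rewrite Rmult_comm; now apply H.
  + rewrite !qmul_minus_r, qmul_assoc, (qinv_l _ N), qmul_one_l; reflexivity.
Qed.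

(** In the exponential coordinate the point [0] is at infinity: boundedness there is all that
    is required of the kernel. *)
Lemma diff_quot_bounded_zero z d : in_slice I z -> 0 < r -> norm z < r ->
  (forall eps, 0 < eps -> exists delta, 0 < delta /\
    forall x, in_slice I x -> norm (minus x z) < delta ->
      norm (minus (diff_quot F z d x) d) <= eps) ->
  exists B delta, 0 < B /\ 0 < delta /\
    forall x, in_slice I x -> norm x < delta -> norm (diff_quot F z d x) <= B.
Proof.
intros Hz Hr Hzr Hd.
destruct (classic (z = zero)) as [->|Nz].
- destruct (Hd 1 Rlt_0_1) as (delta & Hdelta & H).
  exists (1 + norm d), delta; repeat split; auto; [generalize (qnorm_ge_0 d); lra|].
  intros x Hx Hn; eapply Rle_trans; [apply (qnorm_le_minus _ d)|].
  apply Rplus_le_compat_r, H; auto; rewrite qminus_zero_r; auto.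
- assert (H0 : in_slice I zero) by apply in_slice_zero.
  pose proof (qnorm_gt_0 _ Nz) as Pz.
  assert (C0 := hol_continuous I qone I F zero (HF zero H0 ltac:(rewrite qnorm_zero; lra))).
  destruct (locally_norm_le_locally (V := HN) _ _ (qnorm_continuous_bound F zero 1 Rlt_0_1 C0))
    as [delta H].
  pose proof (cond_pos delta) as Hdelta.
  set (B := (norm (F zero) + 1 + norm (F z)) * / (norm z / 2)).
  pose proof (qnorm_ge_0 (F zero)); pose proof (qnorm_ge_0 (F z)).
  assert (HB : 0 < / (norm z / 2)) by (apply Rinv_0_lt_compat; lra).
  exists B, (Rmin delta (norm z / 2)); repeat split.
  + apply Rmult_lt_0_compat; lra.
  + apply Rmin_glb_lt; lra.
  + intros x Hx Hn.
    assert (Hn1 : norm x < delta) by (eapply Rlt_le_trans; [exact Hn | apply Rmin_l]).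
    assert (Hn2 : norm x < norm z / 2) by (eapply Rlt_le_trans; [exact Hn | apply Rmin_r]).
    assert (Hd' : norm z / 2 <= norm (minus x z)).
    { pose proof (qnorm_le_minus z x) as T; rewrite qnorm_minus_sym in T; lra. }
    assert (E : x <> z) by (intros ->; lra).
    assert (N : minus x z <> zero) by (intros Z; apply E, qminus_eq_zero, Z).
    rewrite (diff_quot_neq _ _ _ _ E), norm_qmul, (norm_qinv _ N), Rmult_comm.
    assert (HFx : norm (F x) <= norm (F zero) + 1).
    { pose proof (qnorm_le_minus (F x) (F zero)) as T.
      assert (norm (minus (F x) (F zero)) < 1); [|lra].
      apply H; unfold ball_norm; qfold; rewrite qminus_zero_r; auto. }
    apply Rmult_le_compat; try apply qnorm_ge_0.
    * apply Rlt_le, Rinv_0_lt_compat; lra.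
    * eapply Rle_trans; [apply qnorm_minus|]; lra.
    * apply Rinv_le_contravar; lra.
Qed.


Lemma continuous_slice_exp w : continuous (slice_exp I) w.
Proof. apply (hol_continuous (U := RR) I e1 e2), slice_exp_hol, HI. Qed.

Lemma norm_slice_exp w : norm (slice_exp I w) = exp (fst w).
Proof. apply norm_circ; [exact HI | left; apply exp_pos]. Qed.

Lemma in_slice_exp w : in_slice I (slice_exp I w).
Proof. apply in_slice_circ. Qed.

(** The kernel is [w (F w - F z) / (w - z)] with [w] the exponential: the factor [w] is the
    Jacobian, since [dw = w dt]. *)
Lemma kernel_hol z d w : in_slice I z -> exp (fst w) < r -> slice_exp I w <> z ->
  hol (U := RR) I e1 e2 (fun t => slice_exp I t ** diff_quot F z d (slice_exp I t)) w.
Proof.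
intros Hz Hw Hn.
assert (N : minus (slice_exp I w) z <> zero) by (intros Z; apply Hn, qminus_eq_zero, Z).
assert (Cz : qcomm I z) by now apply in_slice_comm.
assert (Cw : qcomm I (slice_exp I w)) by (apply in_slice_comm, in_slice_exp; exact HI).
assert (Hexp := slice_exp_hol I w HI).
apply hol_mul; auto.
apply hol_ext_loc with
  (fun t => qinv (minus (slice_exp I t) z) ** minus (F (slice_exp I t)) (F z)).
- generalize (qnorm_continuous_bound _ w _ (qnorm_gt_0 _ N) (continuous_slice_exp w)).
  apply filter_imp; intros t Ht; symmetry; apply diff_quot_neq; intros E.
  rewrite E, qnorm_minus_sym in Ht; lra.
- assert (Hdiff : hol (U := RR) I e1 e2 (fun t => minus (slice_exp I t) z) w).
  { apply hol_minus; [exact Hexp | apply hol_const]. }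
  apply hol_mul.
  + apply qcomm_inv; auto; now apply qcomm_minus.
  + apply (hol_inv (U := RR) I e1 e2 (fun t => minus (slice_exp I t) z)); auto.
    now apply qcomm_minus.
  + apply hol_minus; [|apply hol_const].
    apply slice_exp_comp_hol; auto; apply HF; [apply in_slice_exp | now rewrite norm_slice_exp].
Qed.

Lemma kernel_continuous z d w : in_slice I z -> exp (fst w) < r ->
  (forall eps, 0 < eps -> exists delta, 0 < delta /\
    forall x, in_slice I x -> norm (minus x z) < delta ->
      norm (minus (diff_quot F z d x) d) <= eps) ->
  continuous (fun t => slice_exp I t ** diff_quot F z d (slice_exp I t)) w.
Proof.
intros Hz Hw Hd; destruct (classic (slice_exp I w = z)) as [E|E].
- apply continuous_qmul; [apply continuous_slice_exp|].
  apply continuous_qnorm; intros eps He; destruct (Hd eps He) as (delta & Hdelta & H).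
  generalize (qnorm_continuous_bound _ w _ Hdelta (continuous_slice_exp w)).
  apply filter_imp; intros t Ht; rewrite E in Ht |- *.
  replace (diff_quot F z d z) with d.
  + apply H; auto; apply in_slice_exp.
  + unfold diff_quot; destruct excluded_middle_informative; tauto.
- apply (hol_continuous (U := RR) I e1 e2); now apply kernel_hol.
Qed.

(** The strip [theta - PI <= v <= theta + PI] is centred at an argument [theta] of [z], so
    that it contains exactly one logarithm of [z], in its interior. *)
Lemma slice_exp_preimage rho z : in_slice I z -> norm z < rho ->
  exists x0 theta : R, exp x0 < rho /\ forall u v, theta - PI <= v <= theta + PI ->
    (u, v) <> (x0, theta) -> slice_exp I (u, v) <> z.
Proof.
intros Hz Hrho; destruct (classic (z = zero)) as [->|N].
- (* there is no logarithm to avoid, and any point of the strip will do *)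
  exists (ln (rho / 2)), 0; rewrite qnorm_zero in Hrho; rewrite exp_ln by lra.
  split; [lra|]; intros u v _ _; apply circ_neq_zero; [exact HI | apply exp_pos].
- pose proof (qnorm_gt_0 _ N) as P.
  destruct (polar_form I z HI Hz N) as [theta E].
  exists (ln (norm z)), theta; rewrite exp_ln by auto; split; auto.
  intros u v Hv Hne E'; apply Hne.
  rewrite E in E'; symmetry in E'; apply circ_inj in E'; auto; [|apply exp_pos].
  simpl in E'; destruct E' as [E1 ->]; rewrite E1, ln_exp; reflexivity.
Qed.

(** Pulled back by the exponential map, the kernel of Cauchy's formula is holomorphic on a
    strip up to one point, and [2 PI]-periodic.  The integrals over two circles around [0]
    therefore agree, and they tend to [0] with the radius. *)
Lemma cauchy_kernel_integral rho z : 0 < rho -> rho < r -> in_slice I z -> norm z < rho ->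
  exists theta : R,
    RInt (fun v => circ I rho v ** (qinv (minus (circ I rho v) z) **
                   minus (F (circ I rho v)) (F z))) (theta - PI) (theta + PI) = zero.
Proof.
intros Hrho Hr Hz Hzr.
destruct (diff_quot_near z Hz ltac:(lra)) as [d Hd].
destruct (diff_quot_bounded_zero z d Hz ltac:(lra) ltac:(lra) Hd) as (B & delta & HB & Hdelta & Hbound).
destruct (slice_exp_preimage rho z Hz Hzr) as (x0 & theta & Hx0 & Hpre).
set (M := fun t => slice_exp I t ** diff_quot F z d (slice_exp I t)).
assert (Elog : exp (ln rho) = rho) by now apply exp_ln.
assert (Hlog : forall u, u <= ln rho -> exp u < r).
{ intros u [Hu| ->]; [apply exp_increasing in Hu|]; lra. }
assert (Hcont : forall u v, u <= ln rho -> continuous M (u, v)).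
{ intros u v Hu; apply kernel_continuous; auto; now apply Hlog. }
pose proof PI_RGT_0 as HPI.
assert (Hex : forall u, u <= ln rho -> ex_RInt (fun v => M (u, v)) (theta - PI) (theta + PI)).
{ intros u Hu; apply (ex_RInt_continuous (V := HC)); intros v _.
  apply (continuous_comp_2 (fun _ => u) (fun v => v) (fun u v => M (u, v)));
   [apply continuous_const | apply continuous_id |].
  eapply continuous_ext; [|now apply (Hcont u v)]; now intros []. }
exists theta; rewrite (RInt_ext (V := HC) _ (fun v => M (ln rho, v))).
2: { intros v _; unfold M, slice_exp; simpl; rewrite Elog, diff_quot_neq; auto.
     intros E; generalize (norm_circ I rho v HI (Rlt_le _ _ Hrho)); rewrite E; lra. }
assert (Hx0' : x0 < ln rho).
{ apply exp_lt_inv; now rewrite Elog. }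
assert (Heq : forall u, u < x0 -> RInt (fun v => M (ln rho, v)) (theta - PI) (theta + PI) =
                     RInt (fun v => M (u, v)) (theta - PI) (theta + PI)).
{ intros u Hu; apply qminus_eq_zero.
  assert (G := goursat_except_point I M u (ln rho) (theta - PI) (theta + PI) x0 theta HI).
  rewrite <- (RInt_minus (V := HC) (fun v => M (ln rho, v)) (fun v => M (u, v))).
  2,3: apply Hex; lra.
  assert (G' : rect_integral I M (Rect u (ln rho) (theta - PI) (theta + PI)) = zero).
  { apply G; try lra.
    - intros x y Hx Hy; apply Hcont; simpl in Hx; lra.
    - intros x y Hx Hy Hne; apply kernel_hol; auto; apply Hlog; simpl; lra. }
  unfold rect_integral in G'; simpl in G'.
  rewrite (RInt_ext (V := HC) _ (fun _ => zero)), (RInt_const (V := HC)) in G'.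
  2: { intros x _; replace (theta + PI) with (theta - PI + 2 * PI) by ring.
       unfold M, slice_exp; simpl; rewrite circ_period.
       apply (minus_eq_zero (G := HN)). }
  rewrite (scal_zero_r (V := HN)) in G'.
  match type of G' with plus _ (_ ** ?J) = _ => change (J = zero); set (J0 := J) in * end.
  assert (G2 : I ** (J0 : quat) = zero).
  { rewrite <- G'; symmetry; apply (plus_zero_l (G := HN)). }
  apply qmul_eq_zero in G2; destruct G2 as [G2|G2]; auto.
  exfalso; generalize (norm_imag_unit I HI); rewrite G2, qnorm_zero; lra. }
apply qnorm_eq_zero, Rle_antisym; [|apply qnorm_ge_0].
apply le_epsilon; intros eps He; rewrite Rplus_0_l.
(* the radius of a circle inside [|z|] on which the kernel is small *)
set (t := Rmin (delta / 2) (Rmin (exp x0 / 2) (eps / (2 * PI * B)))).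
pose proof (exp_pos x0) as Hex0.
assert (HPB : 0 < 2 * PI * B) by (apply Rmult_lt_0_compat; lra).
assert (Ht : 0 < t /\ t < delta /\ t < exp x0 /\ 2 * PI * B * t <= eps).
{ assert (0 < eps / (2 * PI * B)) by (apply Rdiv_lt_0_compat; lra).
  assert (E : 2 * PI * B * (eps / (2 * PI * B)) = eps) by (field; lra).
  assert (t <= eps / (2 * PI * B)) by (unfold t, Rmin; repeat destruct Rle_dec; lra).
  repeat split; [unfold t, Rmin; repeat destruct Rle_dec; lra .. |].
  rewrite <- E; apply Rmult_le_compat_l; lra. }
destruct Ht as (Ht0 & Ht1 & Ht2 & Ht3).
assert (Hlt : ln t < x0) by (apply exp_lt_inv; rewrite exp_ln; auto).
rewrite (Heq (ln t) Hlt).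
eapply Rle_trans; [|exact Ht3].
replace (2 * PI * B * t) with ((theta + PI - (theta - PI)) * (t * B)) by ring.
destruct (Hex (ln t)) as [l Hl]; [lra|].
rewrite (is_RInt_unique (V := HC) _ _ _ l Hl).
apply (norm_RInt_le_const (V := HN) (fun v => M (ln t, v)) (theta - PI) (theta + PI)); auto; [lra|].
intros v _; unfold M; rewrite norm_qmul, norm_slice_exp; simpl fst; rewrite exp_ln by auto.
apply Rmult_le_compat_l; [lra|]; apply Hbound; [apply in_slice_exp|].
rewrite norm_slice_exp; simpl fst; rewrite exp_ln; auto.
Qed.
End CauchyKernel.

(** * Power series expansion on a disc *)

Lemma is_RInt_linear {U V : NormedModule R_AbsRing} (L : U -> V) (f : R -> U) a b l :
  is_linear L -> is_RInt f a b l -> is_RInt (fun x => L (f x)) a b (L l).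
Proof.
intros HL Hf; unfold is_RInt in *.
assert (E : forall ptd, Riemann_sum (fun x => L (f x)) ptd = L (Riemann_sum f ptd)).
{ intros ptd; apply (SF_cons_ind (fun s => Riemann_sum (fun x => L (f x)) s = L (Riemann_sum f s))).
  - intros x; symmetry; exact (linear_zero L HL).
  - intros h s IH; rewrite !Riemann_sum_cons, IH, (linear_plus _ HL), (linear_scal _ HL).
    reflexivity. }
apply filterlim_ext with (fun ptd => L (scal (sign (b - a)) (Riemann_sum f ptd))).
- intros ptd; rewrite E; apply (linear_scal L HL).
- eapply filterlim_comp; [exact Hf | apply (linear_cont L l HL)].
Qed.

Lemma RInt_qmul_l (p : quat) (f : R -> quat) a b :
  ex_RInt f a b -> RInt (fun t => p ** f t) a b = p ** RInt f a b.
Proof.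
intros [l Hl]; rewrite (is_RInt_unique (V := HC) f a b l Hl).
apply (is_RInt_unique (V := HC)).
apply (is_RInt_linear (U := HN) (V := HN) (fun q => p ** q)); [apply is_linear_qmul_l | exact Hl].
Qed.

Lemma RInt_qmul_r (p : quat) (f : R -> quat) a b :
  ex_RInt f a b -> RInt (fun t => f t ** p) a b = RInt f a b ** p.
Proof.
intros [l Hl]; rewrite (is_RInt_unique (V := HC) f a b l Hl).
apply (is_RInt_unique (V := HC)).
apply (is_RInt_linear (U := HN) (V := HN) (fun q => q ** p)); [apply is_linear_qmul_r | exact Hl].
Qed.

Lemma RInt_translate (f : R -> quat) (tau a b : R) : (forall v, continuous f v) ->
  RInt (fun v => f (v + tau)) a b = RInt f (a + tau) (b + tau).
Proof.
intros Hf; pose proof (RInt_comp_lin (V := HC) f 1 tau a b) as T.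
rewrite !Rmult_1_l in T; rewrite <- T.
- apply (RInt_ext (V := HC)); intros v _; rewrite Rmult_1_l; symmetry; apply (scal_one (V := HN)).
- apply (ex_RInt_continuous (V := HC)); intros; apply Hf.
Qed.

Lemma RInt_period (f : R -> quat) (T a b : R) : (forall v, continuous f v) ->
  (forall v, f (v + T) = f v) -> RInt f a (a + T) = RInt f b (b + T).
Proof.
intros Hf Hp.
assert (Hex : forall x y, ex_RInt f x y) by (intros; apply (ex_RInt_continuous (V := HC)); intros; apply Hf).
rewrite <- (RInt_Chasles (V := HC) f a b (a + T)) by apply Hex.
rewrite <- (RInt_Chasles (V := HC) f b (b + T) (a + T)) by apply Hex.
rewrite <- (RInt_translate f T b a) by auto.
rewrite (RInt_ext (V := HC) (fun v => f (v + T)) f) by (intros; apply Hp).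
rewrite <- (opp_RInt_swap (V := HC) f b a) by apply Hex.
match goal with |- plus (opp ?x) (plus ?y ?z) = _ => generalize (x : quat) (y : quat) end.
clear; qring.
Qed.

Lemma is_series_geom_bound (u : nat -> quat) (l : quat) (C q : R) : 0 <= q < 1 ->
  (forall n, norm (minus (sum_n u n) l) <= C * q ^ n) -> is_series (V := HN) u l.
Proof.
intros Hq H P HP; apply (locally_norm_le_locally (V := HN)) in HP; destruct HP as [eps HP].
assert (L : is_lim_seq (fun n => C * q ^ n) 0).
{ replace (Finite 0) with (Rbar_mult C 0) by (simpl; f_equal; ring).
  apply is_lim_seq_scal_l, is_lim_seq_geom; rewrite Rabs_pos_eq; lra. }
apply is_lim_seq_spec in L; destruct (L eps) as [N HN']; exists N; intros n Hn.
apply HP; unfold ball_norm; qfold; eapply Rle_lt_trans; [apply H|].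
specialize (HN' n Hn); rewrite Rminus_0_r in HN'; eapply Rle_lt_trans; [apply Rle_abs | exact HN'].
Qed.

Section CircleExpansion.
Variables (I : quat) (F : quat -> quat) (r rho : R).
Hypothesis HI : imag_unit I.
Hypothesis HF : forall q, in_slice I q -> norm q < r -> hol (U := HN) I qone I F q.
Hypothesis Hrho : 0 < rho < r.

Definition circle_inv_pow (n : nat) (v : R) : quat := qpow (qinv (circ I rho v)) n.

Lemma circle_inv_powE n v : circle_inv_pow n v = circ I ((/ rho) ^ n) (- (INR n * v)).
Proof.
unfold circle_inv_pow; rewrite circ_inv, circ_pow by (auto; lra).
f_equal; ring.
Qed.

Lemma norm_circle_inv_pow n v : norm (circle_inv_pow n v) = (/ rho) ^ n.
Proof.
rewrite circle_inv_powE; apply norm_circ; auto.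
apply pow_le, Rlt_le, Rinv_0_lt_compat; lra.
Qed.

Lemma continuous_circ s v : continuous (circ I s) v.
Proof.
unfold circ; eapply continuous_ext; [intros t; symmetry; apply slice_ptE|].
apply (continuous_plus (V := HN)); apply (continuous_scal_l (V := HN)).
- apply (continuous_mult (K := R_AbsRing)); [apply continuous_const|].
  apply continuity_pt_filterlim, continuity_cos.
- apply (continuous_mult (K := R_AbsRing)); [apply continuous_const|].
  apply continuity_pt_filterlim, continuity_sin.
Qed.

Lemma continuous_circle_inv_pow n v : continuous (circle_inv_pow n) v.
Proof.
eapply continuous_ext; [intros t; symmetry; apply circle_inv_powE|].
apply (continuous_comp (fun v => - (INR n * v)) (circ I ((/ rho) ^ n))).
- apply (continuous_opp (V := R_NormedModule)), (continuous_mult (K := R_AbsRing));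
    [apply continuous_const | apply continuous_id].
- apply continuous_circ.
Qed.

Lemma RInt_circle_inv_pow n a :
  RInt (circle_inv_pow (S n)) a (a + 2 * PI) = zero.
Proof.
set (f := circle_inv_pow (S n)); set (tau := PI / INR (S n)).
assert (Hn : 0 < INR (S n)) by (apply lt_0_INR; lia).
assert (Hper : forall v, f (v + 2 * PI) = f v).
{ intros v; unfold f, circle_inv_pow; now rewrite circ_period. }
(* translating by half a period of the integrand changes its sign *)
assert (Hhalf : forall v, f (v + tau) = opp (f v)).
{ intros v; unfold f; rewrite !circle_inv_powE.
  rewrite <- (circ_shift_pi I _ (- (INR (S n) * v))).
  rewrite <- (circ_period I _ (- (INR (S n) * (v + tau)))); f_equal.
  unfold tau; field; lra. }
assert (Hc : forall v, continuous f v) by apply continuous_circle_inv_pow.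
assert (E : RInt f a (a + 2 * PI) = opp (RInt f a (a + 2 * PI))).
{ rewrite (RInt_period f (2 * PI) a (a + tau)) at 1 by auto.
  replace (a + tau + 2 * PI) with (a + 2 * PI + tau) by ring.
  rewrite <- RInt_translate, (RInt_ext (V := HC) _ (fun v => opp (f v))) by auto.
  apply (RInt_opp (V := HC)), (ex_RInt_continuous (V := HC)); auto. }
revert E; generalize (RInt f a (a + 2 * PI) : quat); intros q E.
apply qnorm_eq_zero.
assert (E2 : scal 2 q = (zero : quat)).
{ transitivity (plus q q); [clear; qring|]; rewrite E at 2; apply (plus_opp_r (G := HN)). }
assert (N : norm (scal 2 q : quat) = 0) by (rewrite E2; apply qnorm_zero).
rewrite norm_qscal, Rabs_pos_eq in N by lra; lra.
Qed.

(** Cauchy's coefficients [1 / (2 PI) * int w^(-n) F w] on the circle of radius [rho], for a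
    window of integration that does not depend on the point of evaluation. *)
Definition circle_coef (n : nat) : quat :=
  scal (/ (2 * PI)) (RInt (fun v => circle_inv_pow n v ** F (circ I rho v)) (- PI) (- PI + 2 * PI)).

Lemma continuous_F_circ v : continuous (fun v => F (circ I rho v)) v.
Proof.
apply (continuous_comp (circ I rho) F); [apply continuous_circ|].
apply (hol_continuous (U := HN) I qone I), HF; [apply in_slice_circ | rewrite norm_circ; auto; lra].
Qed.

(** In this section [J n] is the integral of [w^(-n) (w / (w - z)) (F w - F z)] over the
    circle, and [B n] that of [w^(-n) (F w - F z)].  Cauchy's formula is [J 0 = 0], the terms
    of the power series come from [B n], and [z^n J n] is the remainder. *)
Section Point.
Variables (z : quat) (theta : R).
Hypothesis Hz : in_slice I z.
Hypothesis Hzr : norm z < rho.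

Let c v := circ I rho v.
Let g v := minus (F (c v)) (F z).
Let h v := c v ** (qinv (minus (c v) z) ** g v).
Let J n := RInt (fun v => circle_inv_pow n v ** h v) (theta - PI) (theta + PI).
Let B n := RInt (fun v => circle_inv_pow n v ** g v) (theta - PI) (theta + PI).

Lemma circ_minus_neq v : minus (c v) z <> zero.
Proof.
intros E; apply qminus_eq_zero in E; generalize (norm_circ I rho v HI).
unfold c in E; rewrite E; lra.
Qed.

Lemma continuous_g v : continuous g v.
Proof. apply (continuous_minus (V := HN)); [apply continuous_F_circ | apply continuous_const]. Qed.

Lemma continuous_h v : continuous h v.
Proof.
apply continuous_qmul; [apply continuous_circ|].
apply continuous_qmul; [|apply continuous_g].
apply (continuous_comp (fun v => minus (c v) z) qinv).
- apply (continuous_minus (V := HN)); [apply continuous_circ | apply continuous_const].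
- apply (filterdiff_continuous (U := HN) (V := HN)); eexists; apply filterdiff_qinv, circ_minus_neq.
Qed.

Lemma ex_RInt_circle n (f : R -> quat) a b : (forall v, continuous f v) ->
  ex_RInt (fun v => circle_inv_pow n v ** f v) a b.
Proof.
intros Hf; apply (ex_RInt_continuous (V := HC)); intros v _.
apply continuous_qmul; [apply continuous_circle_inv_pow | apply Hf].
Qed.

(** [w / (w - z) = 1 + z / w * (w / (w - z))]: one step of the geometric series. *)
Lemma geometric_step n : (J n : quat) = plus (B n : quat) (z ** J (S n)).
Proof.
unfold J, B; rewrite <- RInt_qmul_l by (apply ex_RInt_circle, continuous_h).
rewrite <- (RInt_plus (V := HC)).
- apply (RInt_ext (V := HC)); intros v _.
  assert (Nc : c v <> zero) by (apply circ_neq_zero; auto; lra).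
  assert (Cz : qcomm z (qpow (qinv (c v)) n)).
  { apply qcomm_pow, qcomm_inv; auto; apply (in_slice_qcomm I); auto; apply in_slice_circ. }
  transitivity (circle_inv_pow n v ** plus (g v) (z ** (qinv (minus (c v) z) ** g v))).
  + f_equal; unfold h.
    rewrite <- (qplus_minus_cancel (c v) z) at 1.
    rewrite qmul_plus_l, (qmul_assoc (minus _ _)), (qinv_r _ (circ_minus_neq v)), qmul_one_l.
    reflexivity.
  + unfold circle_inv_pow, h; fold (c v); rewrite qmul_plus_r, qpow_S_r.
    rewrite !qmul_assoc, <- Cz, <- !qmul_assoc, (qmul_assoc (qinv (c v)) (c v)).
    rewrite (qinv_l _ Nc), qmul_one_l; reflexivity.
- apply ex_RInt_circle, continuous_g.
- apply (ex_RInt_continuous (V := HC)); intros v _.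
  apply continuous_qmul; [apply continuous_const|].
  apply continuous_qmul; [apply continuous_circle_inv_pow | apply continuous_h].
Qed.

Lemma geometric_sum n : (J 0 : quat) = zero ->
  sum_n (fun k => qpow z k ** B k) n = opp (qpow z (S n) ** J (S n)).
Proof.
intros H0; induction n as [|n IH].
- rewrite sum_O; simpl qpow; rewrite qmul_one_r, qmul_one_l.
  rewrite geometric_step in H0; revert H0; generalize (B 0 : quat) (z ** J 1); intros p q E.
  replace p with (plus (plus p q) (opp q)) by (clear; qring); rewrite E; clear; qring.
- rewrite sum_Sn, IH, geometric_step, qmul_plus_r.
  rewrite qmul_assoc, <- qpow_S_r.
  match goal with |- plus (opp (plus ?x ?y)) _ = _ => generalize x y end; clear; qring.
Qed.

(** Subtracting [F z] affects only the coefficient of degree [0], because the other powers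
    have mean zero.  Periodicity moves the window from [theta] to [0]. *)
Lemma circle_coefE n : (B n : quat) =
  minus (scal (2 * PI) (circle_coef n)) (match n with O => scal (2 * PI) (F z) | _ => zero end).
Proof.
pose proof PI_RGT_0 as HPI.
unfold B, g; rewrite (RInt_ext (V := HC) _
  (fun v => minus (circle_inv_pow n v ** F (c v)) (circle_inv_pow n v ** F z)))
  by (intros; apply qmul_minus_r).
rewrite (RInt_minus (V := HC)).
2: apply ex_RInt_circle, continuous_F_circ.
2: apply ex_RInt_circle; intros; apply continuous_const.
f_equal.
- unfold circle_coef; rewrite (scal_assoc (V := HN)); unfold mult; simpl mult.
  rewrite Rinv_r, (scal_one (V := HN)) by lra.
  replace (theta + PI) with (theta - PI + 2 * PI) by ring.
  apply RInt_period; intros v.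
  + apply continuous_qmul; [apply continuous_circle_inv_pow | apply continuous_F_circ].
  + unfold circle_inv_pow, c; now rewrite circ_period.
- rewrite RInt_qmul_r.
  2: apply (ex_RInt_continuous (V := HC)); intros; apply continuous_circle_inv_pow.
  replace (theta + PI) with (theta - PI + 2 * PI) by ring.
  destruct n as [|n].
  + rewrite (RInt_ext (V := HC) _ (fun _ => qone)) by reflexivity.
    rewrite (RInt_const (V := HC)).
    replace (theta - PI + 2 * PI - (theta - PI)) with (2 * PI) by ring.
    transitivity (scal (2 * PI) (qone ** F z)); [apply qmul_scal_l | now rewrite qmul_one_l].
  + rewrite RInt_circle_inv_pow; apply qmul_zero_l.
Qed.

(** With [|z| < rho] this makes the remainder [z^n J n] decay geometrically. *)
Lemma norm_J : exists L, forall n, norm (J n : quat) <= (/ rho) ^ n * L.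
Proof.
pose proof PI_RGT_0 as HPI.
assert (Hex : ex_RInt (fun v => norm (h v)) (theta - PI) (theta + PI)).
{ apply (ex_RInt_continuous (V := R_CompleteNormedModule)); intros v _.
  apply (continuous_comp h norm); [apply continuous_h | apply (filterlim_norm (V := HN))]. }
destruct Hex as [L HL]; exists L; intros n.
assert (Hexn := ex_RInt_circle n h (theta - PI) (theta + PI) continuous_h).
apply (norm_RInt_le (V := HN) (fun v => circle_inv_pow n v ** h v)
  (fun v => (/ rho) ^ n * norm (h v)) (theta - PI) (theta + PI)); [lra | | |].
- intros v _; rewrite norm_qmul, norm_circle_inv_pow; apply Rle_refl.
- apply (RInt_correct (V := HC)), Hexn.
- apply (is_RInt_scal (V := R_NormedModule) _ _ _ _ _ HL).
Qed.

Lemma is_series_circle_coef : (J 0 : quat) = zero ->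
  is_series (V := HN) (fun n => qpow z n ** circle_coef n) (F z).
Proof.
intros H0; destruct norm_J as [L HL]; pose proof PI_RGT_0 as HPI.
assert (Hs : forall n, scal (2 * PI) (minus (sum_n (fun k => qpow z k ** circle_coef k) n) (F z)) =
                opp (qpow z (S n) ** J (S n))).
{ intros n; rewrite <- geometric_sum by auto; clear H0; induction n as [|n IH].
  - rewrite !sum_O, circle_coefE; simpl qpow; rewrite !qmul_one_l.
    generalize (circle_coef 0) (F z); clear; qring.
  - rewrite !sum_Sn, <- IH, circle_coefE, qminus_zero_r, qmul_scal_r.
    match goal with |- scal _ (minus (plus ?x ?y) ?w) = _ =>
      generalize (x : quat) (y : quat) (w : quat) end.
    clear; qring. }
pose proof (qnorm_ge_0 z) as Hz0.
apply is_series_geom_bound with (C := L * / (2 * PI) * (norm z * / rho)) (q := norm z * / rho).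
- assert (0 < / rho) by (apply Rinv_0_lt_compat; lra); split; [nra|].
  apply Rmult_lt_reg_r with rho; [lra|]; rewrite Rmult_assoc, Rinv_l; lra.
- intros n; apply Rmult_le_reg_l with (2 * PI); [lra|].
  match goal with |- _ * norm ?x <= _ =>
    assert (N : norm (scal (2 * PI) (x : quat) : quat) = 2 * PI * norm x)
      by (rewrite norm_qscal, Rabs_pos_eq; lra) end.
  rewrite <- N, Hs, qnorm_opp, norm_qmul, norm_qpow.
  eapply Rle_trans; [apply Rmult_le_compat_l; [now apply pow_le | apply HL]|].
  right; rewrite Rpow_mult_distr; simpl; field; lra.
Qed.
End Point.

Lemma circle_expansion z : in_slice I z -> norm z < rho ->
  is_series (V := HN) (fun n => qpow z n ** circle_coef n) (F z).
Proof.
intros Hz Hzr.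
destruct (cauchy_kernel_integral I F r HI HF rho z) as [theta Htheta]; try tauto.
apply is_series_circle_coef with theta; auto.
refine (eq_trans _ Htheta); apply (RInt_ext (V := HC)); intros v _; apply qmul_one_l.
Qed.
End CircleExpansion.


(** * Uniqueness of coefficients *)

(** Linear functionals reduce uniqueness statements to the real case. *)
Lemma quat_ext_linear (p q : quat) :
  (forall L : quat -> R, is_linear (U := HN) (V := R_NormedModule) L -> L p = L q) -> p = q.
Proof.
intros H.
assert (Hf : forall (U : NormedModule R_AbsRing) (L : quat -> U * R),
  is_linear (U := HN) (V := prod_NormedModule R_AbsRing U R_NormedModule) L ->
  is_linear (U := HN) (V := U) (fun q => fst (L q)) /\
  is_linear (U := HN) (V := R_NormedModule) (fun q => snd (L q))).
{ intros U L HL; split.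
  - apply (is_linear_comp (U := HN) (V := prod_NormedModule R_AbsRing U R_NormedModule) L fst); auto.
    apply (is_linear_fst (U := U) (V := R_NormedModule)).
  - apply (is_linear_comp (U := HN) (V := prod_NormedModule R_AbsRing U R_NormedModule) L snd); auto.
    apply (is_linear_snd (U := U) (V := R_NormedModule)). }
destruct (Hf _ (fun q => q) (is_linear_id (V := HN))) as [L3 L4].
destruct (Hf _ _ L3) as [L2 L3'].
destruct (Hf R_NormedModule _ L2) as [L1 L2'].
apply H in L1; apply H in L2'; apply H in L3'; apply H in L4.
destruct p as [[[? ?] ?] ?], q as [[[? ?] ?] ?]; simpl in *; congruence.
Qed.

Lemma sum_n_linear {U V : NormedModule R_AbsRing} (L : U -> V) (u : nat -> U) n :
  is_linear L -> sum_n (fun k => L (u k)) n = L (sum_n u n).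
Proof.
intros HL; induction n as [|n IH]; [now rewrite !sum_O|].
rewrite !sum_Sn, IH; symmetry; apply (linear_plus L HL).
Qed.

Lemma is_series_linear {U V : NormedModule R_AbsRing} (L : U -> V) (u : nat -> U) (l : U) :
  is_linear L -> is_series u l -> is_series (fun n => L (u n)) (L l).
Proof.
intros HL Hu; apply filterlim_ext with (fun n => L (sum_n u n)).
- intros n; symmetry; now apply sum_n_linear.
- eapply filterlim_comp; [exact Hu | apply (linear_cont L l HL)].
Qed.

Lemma is_series_uniq {V : NormedModule R_AbsRing} (u : nat -> V) (l l' : V) :
  is_series u l -> is_series u l' -> l = l'.
Proof. apply filterlim_locally_unique. Qed.

Lemma power_series_ext_real (a b : nat -> R) (delta : R) : 0 < delta ->
  (forall t, Rabs t < delta -> exists l,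
     is_series (V := R_NormedModule) (fun n => t ^ n * a n) l /\
     is_series (V := R_NormedModule) (fun n => t ^ n * b n) l) ->
  forall n, a n = b n.
Proof.
intros Hd H.
assert (HCV : forall c : nat -> R, (forall t, Rabs t < delta ->
  ex_series (V := R_NormedModule) (fun n => t ^ n * c n)) -> Rbar_lt 0 (CV_radius c)).
{ intros c Hc; destruct (Rbar_lt_le_dec 0 (CV_radius c)) as [|L]; auto; exfalso.
  apply (CV_disk_outside c (delta / 2)).
  - eapply Rbar_le_lt_trans; [exact L|]; simpl; rewrite Rabs_pos_eq; lra.
  - apply ex_series_lim_0; eapply ex_series_ext; [|apply (Hc (delta / 2)); rewrite Rabs_pos_eq; lra].
    intros n; apply Rmult_comm. }
assert (HP : forall (c : nat -> R) t l, is_series (V := R_NormedModule) (fun n => t ^ n * c n) l ->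
  PSeries c t = l).
{ intros c t l Hl; apply is_series_unique; eapply is_series_ext; [|exact Hl].
  intros n; apply Rmult_comm. }
intros n; apply PSeries_ext_recip.
- apply HCV; intros t Ht; destruct (H t Ht) as (l & Hl & _); now exists l.
- apply HCV; intros t Ht; destruct (H t Ht) as (l & _ & Hl); now exists l.
- exists (mkposreal _ Hd); intros t Ht.
  change (Rabs (t - 0) < delta) in Ht; rewrite Rminus_0_r in Ht.
  destruct (H t Ht) as (l & Ha & Hb); now rewrite (HP _ _ _ Ha), (HP _ _ _ Hb).
Qed.

(** Restricted to the real axis a quaternionic power series is a vector-valued real one. *)
Lemma power_series_ext (a b : nat -> quat) (delta : R) : 0 < delta ->
  (forall t : R, Rabs t < delta -> exists l : quat,
     is_series (V := HN) (fun n => qpow (RtoH t) n ** a n) l /\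
     is_series (V := HN) (fun n => qpow (RtoH t) n ** b n) l) ->
  a = b.
Proof.
intros Hd H; apply functional_extensionality; intros n; apply quat_ext_linear; intros L HL.
apply (power_series_ext_real (fun n => L (a n)) (fun n => L (b n)) delta Hd).
assert (E : forall t (c : nat -> quat) l, is_series (V := HN) (fun n => qpow (RtoH t) n ** c n) l ->
  is_series (V := R_NormedModule) (fun n => t ^ n * L (c n)) (L l)).
{ intros t c l Hl; eapply is_series_ext; [|apply (is_series_linear (U := HN) L _ _ HL Hl)].
  intros k; cbv beta; rewrite qpow_RtoH, RtoH_qmul; apply (linear_scal L HL). }
intros t Ht; destruct (H t Ht) as (l & Ha & Hb); exists (L l); split; now apply E.
Qed.

Lemma is_derive_uniq (f : R -> quat) (x : R) (l l' : quat) :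
  is_derive (K := R_AbsRing) (V := HN) f x l -> is_derive (K := R_AbsRing) (V := HN) f x l' -> l = l'.
Proof.
intros H H'; apply quat_ext_linear; intros L HL.
assert (E : forall l, is_derive (K := R_AbsRing) (V := HN) f x l ->
  is_derive (K := R_AbsRing) (V := R_NormedModule) (fun t => L (f t)) x (L l)).
{ intros k Hk; unfold is_derive.
  apply (filterdiff_ext_lin (K := R_AbsRing) (U := R_NormedModule) (V := R_NormedModule)) with
    (l1 := fun y => L (scal y k)).
  - apply (filterdiff_comp' (U := R_NormedModule) (V := HN) (W := R_NormedModule) f L x
      (fun y => scal y k) L); auto; now apply filterdiff_linear.
  - intros y; apply (linear_scal L HL). }
rewrite <- (is_derive_unique _ _ _ (E l H)); apply (is_derive_unique _ _ _ (E l' H')).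
Qed.

(** * Expansion of regular functions *)

Lemma in_slice_RtoH I t : in_slice I (RtoH t).
Proof.
exists t, 0; rewrite slice_ptE, RtoH_scal, (scal_zero_l (V := HN)).
symmetry; apply (plus_zero_r (G := HN)).
Qed.

(** Every point lies in a circle of radius less than [r]; the coefficients computed on two
    circles agree, since both expansions represent [F] on a real interval. *)
Lemma slice_expansion_zero I F r : imag_unit I -> 0 < r ->
  (forall q, in_slice I q -> norm q < r -> hol (U := HN) I qone I F q) ->
  exists a, forall z, in_slice I z -> norm z < r ->
    is_series (V := HN) (fun n => qpow z n ** a n) (F z).
Proof.
intros HI Hr HF; exists (circle_coef I F (r / 2)); intros z Hz Hzr.
set (s := (norm z + r) / 2); pose proof (qnorm_ge_0 z) as Hz0.
assert (Hs : 0 < s < r) by (unfold s; lra).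
replace (circle_coef I F (r / 2)) with (circle_coef I F s).
- apply circle_expansion with r; auto; unfold s; lra.
- apply power_series_ext with (Rmin s (r / 2)); [apply Rmin_glb_lt; lra|].
  intros t Ht; exists (F (RtoH t)); split; apply circle_expansion with r; auto;
    try apply in_slice_RtoH; try lra; rewrite norm_RtoH; eapply Rlt_le_trans;
    try exact Ht; [apply Rmin_l | apply Rmin_r].
Qed.

Lemma hol_translate I e e' F (c q : quat) :
  hol (U := HN) I e e' F (plus q c) -> hol (U := HN) I e e' (fun x => F (plus x c)) q.
Proof.
intros (D & HD & HI); exists D; split; auto.
apply (filterdiff_comp' (U := HN) (V := HN) (W := HN) (fun x => plus x c) F q (fun h => h) D); auto.
apply (filterdiff_ext_lin (U := HN) (V := HN)) with (l1 := fun h => plus h zero).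
- apply (filterdiff_plus_fct (U := HN) (V := HN)); [apply filterdiff_id | apply filterdiff_const].
- intros h; apply (plus_zero_r (G := HN)).
Qed.

Lemma slice_plus I p q : in_slice I p -> in_slice I q -> in_slice I (plus p q).
Proof.
intros (x & y & ->) (x' & y' & ->); exists (x + x'), (y + y'); unfold slice_pt; clear; qring.
Qed.

Lemma slice_minus I p q : in_slice I p -> in_slice I q -> in_slice I (minus p q).
Proof.
intros (x & y & ->) (x' & y' & ->); exists (x - x'), (y - y'); apply slice_pt_minus.
Qed.

Lemma slice_expansion I F c r : imag_unit I -> 0 < r -> in_slice I c ->
  (forall q, in_slice I q -> norm (minus q c) < r -> hol (U := HN) I qone I F q) ->
  exists a, forall z, in_slice I z -> norm (minus z c) < r ->
    is_series (V := HN) (fun n => qpow (minus z c) n ** a n) (F z).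
Proof.
intros HI Hr Hc HF.
destruct (slice_expansion_zero I (fun q => F (plus q c)) r HI Hr) as [a Ha].
- intros q Hq Hqr; apply hol_translate, HF; [now apply slice_plus|].
  replace (minus (plus q c) c) with q; auto; clear; qring.
- exists a; intros z Hz Hzr; generalize (Ha (minus z c) (slice_minus I z c Hz Hc) Hzr).
  now rewrite qplus_minus_cancel.
Qed.

Lemma is_derive_slice_x I f D x y :
  filterdiff (U := HN) (V := HN) f (locally (slice_pt I x y)) D ->
  is_derive (K := R_AbsRing) (V := HN) (fun t => f (slice_pt I t y)) x (D qone).
Proof.
intros HD; pose proof HD as [LD _].
apply (filterdiff_ext_lin (K := R_AbsRing) (U := R_NormedModule) (V := HN)) with
  (l1 := fun h => D (scal h qone)).
2: intros h; apply (linear_scal D LD).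
apply (filterdiff_comp' (U := R_NormedModule) (V := HN) (W := HN) (fun t => slice_pt I t y) f x
  (fun h => scal h qone) D); auto.
apply (filterdiff_ext_lin (U := R_NormedModule) (V := HN)) with
  (l1 := fun h => plus (scal h qone) zero).
2: intros h; apply (plus_zero_r (G := HN)).
apply (filterdiff_ext (U := R_NormedModule) (V := HN)) with
  (fun t => plus (scal t qone) (scal y I)); [intros t; symmetry; apply slice_ptE|].
apply (filterdiff_plus_fct (U := R_NormedModule) (V := HN)); [|apply (filterdiff_const (V := HN))].
apply filterdiff_linear, (is_linear_scal_l (V := HN)).
Qed.

Lemma is_derive_slice_y I f D x y :
  filterdiff (U := HN) (V := HN) f (locally (slice_pt I x y)) D ->
  is_derive (K := R_AbsRing) (V := HN) (fun t => f (slice_pt I x t)) y (D I).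
Proof.
intros HD; pose proof HD as [LD _].
apply (filterdiff_ext_lin (K := R_AbsRing) (U := R_NormedModule) (V := HN)) with
  (l1 := fun h => D (scal h I)).
2: intros h; apply (linear_scal D LD).
apply (filterdiff_comp' (U := R_NormedModule) (V := HN) (W := HN) (fun t => slice_pt I x t) f y
  (fun h => scal h I) D); auto.
apply (filterdiff_ext_lin (U := R_NormedModule) (V := HN)) with
  (l1 := fun h => plus zero (scal h I)).
2: intros h; apply (plus_zero_l (G := HN)).
apply (filterdiff_ext (U := R_NormedModule) (V := HN)) with
  (fun t => plus (scal x qone) (scal t I)); [intros t; symmetry; apply slice_ptE|].
apply (filterdiff_plus_fct (U := R_NormedModule) (V := HN)); [apply (filterdiff_const (V := HN))|].
apply filterdiff_linear, (is_linear_scal_l (V := HN)).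
Qed.

(** The partial derivatives in the definition of regularity are the values at [1] and [I] of
    the differential, by uniqueness of derivatives. *)
Lemma regular_hol Omega f I q : regular_on Omega f -> Omega q -> imag_unit I -> in_slice I q ->
  hol (U := HN) I qone I f q.
Proof.
intros (_ & Hd & Hs) Hq HI (x & y & ->); destruct (Hd _ Hq) as [D HD].
exists D; split; auto.
destruct (Hs I HI x y Hq) as (fx & fy & Hfx & Hfy & E).
rewrite <- (is_derive_uniq _ _ _ _ Hfx (is_derive_slice_x _ _ _ _ _ HD)).
rewrite <- (is_derive_uniq _ _ _ _ Hfy (is_derive_slice_y _ _ _ _ _ HD)).
assert (E2 : plus fx (I ** fy) = (zero : quat)).
{ transitivity (scal 2 (scal (1 / 2) (plus fx (I ** fy))) : quat).
  - rewrite (scal_assoc (V := HN)); unfold mult; simpl.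
    replace (2 * (1 / 2)) with 1 by field; symmetry; apply (scal_one (V := HN)).
  - rewrite E; apply (scal_zero_r (V := HN)). }
replace fx with (opp (I ** fy)).
- rewrite qmul_opp_r, qmul_assoc, HI, qmul_opp_l, qmul_one_l; symmetry; apply (opp_opp (G := HN)).
- replace fx with (minus (plus fx (I ** fy)) (I ** fy)).
  + rewrite E2; generalize (I ** fy); clear; qring.
  + generalize (I ** fy); clear; qring.
Qed.

(** The partial derivatives of [f] along a slice are the values of its differential at [1]
    and [I]. *)
Lemma regular_of_cauchy_riemann Omega f : open Omega ->
  (forall q, Omega q -> exists D, filterdiff (U := HN) (V := HN) f (locally q) D /\
     forall I, imag_unit I -> in_slice I q -> D I = I ** D qone) ->
  regular_on Omega f.
Proof.
intros HO H; split; [exact HO | split].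
- intros q Hq; destruct (H q Hq) as (D & HD & _); now exists D.
- intros I HI x y Hq; destruct (H _ Hq) as (D & HD & HDI).
  exists (D qone), (D I); split; [|split].
  + now apply is_derive_slice_x.
  + now apply is_derive_slice_y.
  + rewrite (HDI I HI (ex_intro _ x (ex_intro _ y eq_refl))).
    rewrite qmul_assoc, HI, qmul_opp_l, qmul_one_l.
    generalize (D qone); clear; qring.
Qed.

Lemma imag_unit_i : imag_unit (0, 1, 0, 0).
Proof. unfold imag_unit; clear; qring. Qed.

Lemma in_some_slice q : exists I, imag_unit I /\ in_slice I q.
Proof.
destruct q as [[[x b] c] d].
destruct (Req_dec (b ^ 2 + c ^ 2 + d ^ 2) 0) as [E|E].
- exists (0, 1, 0, 0); split; [apply imag_unit_i|].
  exists x, 0; rewrite slice_pt_coord.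
  repeat apply (f_equal2 pair); nra.
- set (s := sqrt (b ^ 2 + c ^ 2 + d ^ 2)).
  assert (P : 0 < b ^ 2 + c ^ 2 + d ^ 2) by nra.
  assert (Hs : 0 < s) by now apply sqrt_lt_R0.
  assert (Ess : s * s = b ^ 2 + c ^ 2 + d ^ 2) by (apply sqrt_sqrt; lra).
  clearbody s; exists (0, b / s, c / s, d / s); split.
  + unfold imag_unit.
    transitivity ((- ((b ^ 2 + c ^ 2 + d ^ 2) / (s * s)), 0, 0, 0) : quat).
    * cbv [qmul]; repeat apply (f_equal2 pair); try (field; lra); try reflexivity; try ring.
    * rewrite <- Ess; cbv -[Rplus Rmult Ropp Rminus Rinv Rdiv IZR].
      repeat apply (f_equal2 pair); try (field; lra); try reflexivity; try ring.
  + exists x, s; rewrite slice_pt_coord.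
    repeat apply (f_equal2 pair); [reflexivity | field; lra ..].
Qed.

(** The slices share the real axis, which determines the coefficients. *)
Lemma regular_expansion rho f : 0 < rho -> regular_on (Hball rho) f ->
  exists a, is_expansion rho f a.
Proof.
intros Hrho Hf.
assert (Hex : forall I, imag_unit I -> exists a, forall z, in_slice I z -> norm z < rho ->
    is_series (V := HN) (fun n => qpow z n ** a n) (f z)).
{ intros I HI; apply slice_expansion_zero; auto.
  intros q Hq Hqr; now apply (regular_hol (Hball rho)). }
destruct (Hex _ imag_unit_i) as [a Ha]; exists a; intros q Hq.
destruct (in_some_slice q) as (I & HI & HIq); destruct (Hex I HI) as [b Hb].
replace a with b; [now apply Hb|].
apply power_series_ext with rho; auto; intros t Ht; exists (f (RtoH t)).
split; [apply Hb | apply Ha]; try apply in_slice_RtoH; now rewrite norm_RtoH.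
Qed.


(** * Quaternionic power series *)

Lemma is_series_bounded (u : nat -> quat) (l : quat) :
  is_series (V := HN) u l -> exists M, forall n, norm (u n) <= M.
Proof.
intros Hu.
destruct (filterlim_bounded (V := HN) (sum_n u)) as [M HM]; [now exists l|].
exists (M + M); intros [|n].
- specialize (HM 0%nat); rewrite sum_O in HM; generalize (qnorm_ge_0 (u 0%nat)); qfold; lra.
- replace (u (S n)) with (minus (sum_n u (S n)) (sum_n u n)).
  + eapply Rle_trans; [apply qnorm_minus | apply Rplus_le_compat; apply HM].
  + rewrite sum_Sn; generalize (sum_n u n : quat) (u (S n)); clear; qring.
Qed.

Lemma ex_series_qSeries (u : nat -> quat) : ex_series (V := HN) u -> is_series (V := HN) u (qSeries u).
Proof.
intros [l Hl]; replace (qSeries u) with l; auto.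
destruct l as [[[l1 l2] l3] l4]; unfold qSeries.
pose proof (is_series_linear (U := HN) _ _ _ (is_linear_fst) Hl) as H123.
pose proof (is_series_linear (U := HN) _ _ _ (is_linear_snd) Hl) as H4.
pose proof (is_series_linear _ _ _ (is_linear_fst) H123) as H12.
pose proof (is_series_linear _ _ _ (is_linear_snd) H123) as H3.
pose proof (is_series_linear _ _ _ (is_linear_fst) H12) as H1.
pose proof (is_series_linear _ _ _ (is_linear_snd) H12) as H2.
simpl in *.
repeat apply (f_equal2 pair); symmetry; now apply is_series_unique.
Qed.

Lemma norm_is_series_le (u : nat -> quat) (b : nat -> R) (l : quat) (B : R) :
  (forall n, norm (u n) <= b n) -> is_series (V := HN) u l ->
  is_series (V := R_NormedModule) b B -> norm l <= B.
Proof.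
intros Hub Hu Hb.
assert (Hl : is_lim_seq (fun n => norm (sum_n u n)) (norm l)).
{ eapply filterlim_comp; [exact Hu | apply (filterlim_norm (V := HN))]. }
assert (HB : is_lim_seq (sum_n b) B) by exact Hb.
refine (is_lim_seq_le _ _ _ _ _ Hl HB); intros n.
induction n as [|n IH].
- rewrite !sum_O; apply Hub.
- rewrite !sum_Sn; eapply Rle_trans; [apply qnorm_triangle|].
  apply Rplus_le_compat; [exact IH | apply Hub].
Qed.

Lemma is_series_geom_scal (C q : R) : 0 <= q < 1 ->
  is_series (V := R_NormedModule) (fun n => C * q ^ n) (C * / (1 - q)).
Proof.
intros Hq; apply (is_series_scal (V := R_NormedModule) C (fun n => q ^ n)).
apply is_series_geom; rewrite Rabs_pos_eq; lra.
Qed.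

Lemma is_series_dominated (u : nat -> quat) (C q : R) : 0 <= q < 1 ->
  (forall n, norm (u n) <= C * q ^ n) ->
  is_series (V := HN) u (qSeries u) /\ norm (qSeries u) <= C * / (1 - q).
Proof.
intros Hq Hu.
assert (H : is_series (V := HN) u (qSeries u)).
{ apply ex_series_qSeries, (ex_series_le (V := HC)) with (fun n => C * q ^ n); auto.
  eexists; now apply is_series_geom_scal. }
split; auto.
apply (norm_is_series_le u (fun n => C * q ^ n)); auto; now apply is_series_geom_scal.
Qed.

(** Cauchy's estimates: the growth condition that characterizes the coefficients of the
    power series converging in the ball of radius [rho]. *)
Definition coef_bounded (rho : R) (a : nat -> quat) : Prop :=
  forall s, 0 < s < rho -> exists M, 0 <= M /\ forall n, norm (a n) <= M * (/ s) ^ n.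

Lemma pow_inv_cancel s n : 0 < s -> (/ s) ^ n * s ^ n = 1.
Proof. intros Hs; rewrite <- Rpow_mult_distr, Rinv_l, pow1; lra. Qed.

Lemma expansion_coef_bounded rho f a : is_expansion rho f a -> coef_bounded rho a.
Proof.
intros Ha s Hs.
assert (Hball : Hball rho (RtoH s)).
{ unfold Hball; rewrite norm_RtoH, Rabs_pos_eq; lra. }
destruct (is_series_bounded _ _ (Ha _ Hball)) as [M HM]; exists M; split.
- eapply Rle_trans; [apply qnorm_ge_0 | apply (HM 0%nat)].
- intros n; specialize (HM n).
  rewrite norm_qmul, norm_qpow, norm_RtoH, Rabs_pos_eq in HM by lra.
  assert (P : 0 < s ^ n) by (apply pow_lt; lra).
  apply Rmult_le_reg_r with (s ^ n); auto.
  rewrite Rmult_assoc, pow_inv_cancel by lra; lra.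
Qed.

(** A radius strictly between [s] and [rho] leaves room for a ratio [q < 1]. *)
Lemma coef_bounded_ratio rho a s : coef_bounded rho a -> 0 <= s < rho ->
  exists M q, 0 <= M /\ 0 <= q < 1 /\ forall n, s ^ n * norm (a n) <= M * q ^ n.
Proof.
intros Ha Hs; destruct (Ha ((s + rho) / 2)) as (M & HM & H); [lra|].
assert (Hinv : 0 < / ((s + rho) / 2)) by (apply Rinv_0_lt_compat; lra).
exists M, (s * / ((s + rho) / 2)); repeat split; auto.
- apply Rmult_le_pos; lra.
- apply Rmult_lt_reg_r with ((s + rho) / 2); [lra|]; rewrite Rmult_assoc, Rinv_l; lra.
- intros n; rewrite Rpow_mult_distr; rewrite Rmult_comm.
  eapply Rle_trans; [apply Rmult_le_compat_r; [apply pow_le; lra | apply H]|]; right; ring.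
Qed.

Lemma coef_bounded_is_series rho a q : coef_bounded rho a -> norm q < rho ->
  is_series (V := HN) (fun n => qpow q n ** a n) (qPSeries a q).
Proof.
intros Ha Hq; pose proof (qnorm_ge_0 q).
destruct (coef_bounded_ratio rho a (norm q) Ha) as (M & x & HM & Hx & H1); [lra|].
apply (is_series_dominated _ M x); auto.
intros n; rewrite norm_qmul, norm_qpow; apply H1.
Qed.

Lemma qPSeries_expansion rho a : coef_bounded rho a -> is_expansion rho (qPSeries a) a.
Proof. intros Ha q Hq; now apply coef_bounded_is_series with rho. Qed.

Lemma expansion_unique rho f a b : 0 < rho ->
  is_expansion rho f a -> is_expansion rho f b -> a = b.
Proof.
intros Hrho Ha Hb; apply power_series_ext with rho; auto; intros t Ht.
exists (f (RtoH t)); split; [apply Ha | apply Hb]; unfold Hball; now rewrite norm_RtoH.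
Qed.

(** By uniqueness the chosen coefficients are the actual ones. *)
Lemma qcoef_expansion rho f a : 0 < rho -> is_expansion rho f a -> qcoef rho f = a.
Proof.
intros Hrho Ha; apply (expansion_unique rho f); auto.
apply (epsilon_spec (inhabits (fun _ : nat => (zero : quat))) (is_expansion rho f)); now exists a.
Qed.

(** ** Differentiability of power series *)

(** The differential [sum_j q^j h q^(n-1-j)] of the [n]-th power at [q], in the direction
    [h]. *)
Fixpoint dpow (q h : quat) (n : nat) : quat :=
  match n with
  | O => zero
  | S m => plus (h ** qpow q m) (q ** dpow q h m)
  end.

Lemma pow_diff_step (q h u v : quat) :
  plus (q ** minus u v) (h ** u) = minus (plus q h ** u) (q ** v).
Proof. qring. Qed.

Lemma pow_taylor_step (q h u v w : quat) :
  plus (q ** minus (minus u v) w) (h ** minus u v) =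
  minus (minus (plus q h ** u) (q ** v)) (plus (h ** v) (q ** w)).
Proof. qring. Qed.

(** For [|h| <= delta] the factor [|h| / delta] can be extracted from each [h] in a
    binomial expansion, whose remaining terms sum to at most [(|q| + delta)^n].  No polynomial
    factor in [n] appears, and only a geometric series has to be summed. *)
Section PowEstimates.
Variables (q h : quat) (delta : R).
Hypothesis Hdelta : 0 < delta.
Let s := norm q + delta.

Lemma pow_step_le (x y : R) n : 0 <= x -> y <= x * s ^ n -> norm h <= delta * x ->
  norm q * y + norm h * s ^ n <= x * s ^ S n.
Proof.
intros Hx Hy Hh; pose proof (qnorm_ge_0 q) as Hq.
assert (Hs : 0 <= s ^ n) by (apply pow_le; unfold s; lra).
apply (Rmult_le_compat_l (norm q)) in Hy; auto; apply (Rmult_le_compat_r (s ^ n)) in Hh; auto.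
replace (x * s ^ S n) with (norm q * (x * s ^ n) + delta * x * s ^ n) by (simpl; unfold s; ring).
lra.
Qed.

Lemma norm_dpow n : norm (dpow q h n) <= norm h / delta * s ^ n.
Proof.
pose proof (qnorm_ge_0 q) as Hq; pose proof (qnorm_ge_0 h) as Hh.
assert (Hx : 0 <= norm h / delta) by (apply Rdiv_le_0_compat; lra).
induction n as [|n IH]; [simpl; rewrite qnorm_zero; lra|].
simpl dpow; eapply Rle_trans; [apply qnorm_triangle|].
rewrite !norm_qmul, norm_qpow, Rplus_comm.
eapply Rle_trans; [|apply (pow_step_le _ _ n Hx IH); right; field; lra].
apply Rplus_le_compat_l, Rmult_le_compat_l; auto.
apply pow_incr; unfold s; lra.
Qed.

Hypothesis Hh : norm h <= delta.

Lemma norm_plus_le : norm (plus q h) <= s.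
Proof. eapply Rle_trans; [apply qnorm_triangle|]; unfold s; lra. Qed.

Lemma norm_pow_diff n :
  norm (minus (qpow (plus q h) n) (qpow q n)) <= norm h / delta * s ^ n.
Proof.
pose proof (qnorm_ge_0 q) as Hq; pose proof (qnorm_ge_0 h) as Hh0.
assert (Hx : 0 <= norm h / delta) by (apply Rdiv_le_0_compat; lra).
induction n as [|n IH].
- simpl; replace (minus qone qone) with (zero : quat) by (clear; qring); rewrite qnorm_zero; lra.
- match goal with |- norm ?X <= _ => replace X with
    (plus (q ** minus (qpow (plus q h) n) (qpow q n)) (h ** qpow (plus q h) n)) end.
  + eapply Rle_trans; [apply qnorm_triangle|]; rewrite !norm_qmul, norm_qpow.
    eapply Rle_trans; [|apply (pow_step_le _ _ n Hx IH); right; field; lra].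
    apply Rplus_le_compat_l, Rmult_le_compat_l; auto.
    apply pow_incr; split; [apply qnorm_ge_0 | apply norm_plus_le].
  + apply pow_diff_step.
Qed.

Lemma norm_pow_taylor n :
  norm (minus (minus (qpow (plus q h) n) (qpow q n)) (dpow q h n)) <= (norm h / delta) ^ 2 * s ^ n.
Proof.
pose proof (qnorm_ge_0 q) as Hq; pose proof (qnorm_ge_0 h) as Hh0.
assert (Hx : 0 <= norm h / delta) by (apply Rdiv_le_0_compat; lra).
induction n as [|n IH].
- simpl; rewrite qminus_zero_r.
  replace (minus qone qone) with (zero : quat) by (clear; qring).
  rewrite qnorm_zero; nra.
- match goal with |- norm ?X <= _ => replace X with
    (plus (q ** minus (minus (qpow (plus q h) n) (qpow q n)) (dpow q h n))
          (h ** minus (qpow (plus q h) n) (qpow q n))) end.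
  + eapply Rle_trans; [apply qnorm_triangle|]; rewrite !norm_qmul.
    pose proof (norm_pow_diff n) as T.
    apply (Rmult_le_compat_l (norm h)) in T; auto.
    apply (Rmult_le_compat_l (norm q)) in IH; auto.
    eapply Rle_trans; [apply Rplus_le_compat; [exact IH | exact T]|].
    right; simpl; unfold s; field; lra.
  + apply pow_taylor_step.
Qed.
End PowEstimates.

Lemma dpow_plus q h k n : dpow q (plus h k) n = plus (dpow q h n) (dpow q k n).
Proof.
induction n as [|n IH]; simpl; [clear; qring|].
rewrite IH; generalize (dpow q h n) (dpow q k n) (qpow q n); clear; qring.
Qed.

Lemma dpow_scal q (c : R) h n : dpow q (scal c h) n = scal c (dpow q h n).
Proof.
induction n as [|n IH]; simpl; [clear; qring|].
rewrite IH; generalize (dpow q h n) (qpow q n); clear; qring.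
Qed.

Lemma dpow_comm q J n : qcomm J q -> dpow q J n = J ** dpow q qone n.
Proof.
intros C; induction n as [|n IH]; simpl; [now rewrite qmul_zero_r|].
rewrite IH, qmul_plus_r, qmul_one_l; f_equal.
now rewrite !qmul_assoc, C.
Qed.

(** Termwise differentiation; [dpow_comm] gives the Cauchy-Riemann equations for the slices
    through [q], because there the factor [I] can be moved to the front of each term. *)
Lemma qPSeries_differentiable rho a q : coef_bounded rho a -> Hball rho q ->
  exists D, filterdiff (U := HN) (V := HN) (qPSeries a) (locally q) D /\
    forall I, qcomm I q -> D I = I ** D qone.
Proof.
intros Ha Hq; unfold Hball in Hq; pose proof (qnorm_ge_0 q) as Hq0.
set (delta := (rho - norm q) / 2).
assert (Hdelta : 0 < delta) by (unfold delta; lra).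
destruct (coef_bounded_ratio rho a (norm q + delta) Ha) as (M & x & HM & Hx & HMx);
  [unfold delta in *; lra|].
set (D := fun h => qSeries (fun n => dpow q h n ** a n)).
assert (HD : forall h, is_series (V := HN) (fun n => dpow q h n ** a n) (D h) /\
    norm (D h) <= norm h / delta * M * / (1 - x)).
{ intros h; apply is_series_dominated; auto; intros n; rewrite norm_qmul.
  eapply Rle_trans; [apply Rmult_le_compat_r; [apply qnorm_ge_0 | apply (norm_dpow q h delta Hdelta)]|].
  rewrite !Rmult_assoc; apply Rmult_le_compat_l; auto.
  apply Rdiv_le_0_compat; [apply qnorm_ge_0 | auto]. }
assert (Hx1 : 0 < / (1 - x)) by (apply Rinv_0_lt_compat; lra).
assert (Hd1 : 0 < / delta) by now apply Rinv_0_lt_compat.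
exists D; split.
- apply (filterdiff_quadratic (U := HN) (V := HN) _ _ _ ((/ delta) ^ 2 * M * / (1 - x)) delta); auto.
  + split.
    * intros h k; apply (is_series_uniq (V := HN) _ _ _ (proj1 (HD (plus h k)))).
      eapply is_series_ext; [|apply (is_series_plus (V := HN) _ _ _ _ (proj1 (HD h)) (proj1 (HD k)))].
      intros n; simpl; rewrite dpow_plus; symmetry; apply qmul_plus_l.
    * intros c h; apply (is_series_uniq (V := HN) _ _ _ (proj1 (HD (scal c h)))).
      eapply is_series_ext; [|apply (is_series_scal (V := HN) c _ _ (proj1 (HD h)))].
      intros n; simpl; rewrite dpow_scal; symmetry; apply qmul_scal_l.
    * exists (/ delta * M * / (1 - x) + 1); split.
      { assert (0 <= / delta * M * / (1 - x)) by (repeat apply Rmult_le_pos; lra); lra. }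
      intros h; eapply Rle_trans; [apply (HD h)|].
      pose proof (qnorm_ge_0 h); unfold Rdiv; qfold; nra.
  + intros y Hy; qfold; set (h := minus y q) in *.
    assert (Ey : y = plus q h) by (unfold h; clear; qring).
    assert (Hyr : norm y < rho).
    { rewrite Ey; eapply Rle_lt_trans; [apply qnorm_triangle|]; unfold delta in Hy; lra. }
    assert (S1 := is_series_minus (V := HN) _ _ _ _ (is_series_minus (V := HN) _ _ _ _
      (coef_bounded_is_series rho a y Ha Hyr) (coef_bounded_is_series rho a q Ha Hq)) (proj1 (HD h))).
    replace ((/ delta) ^ 2 * M * / (1 - x) * norm h ^ 2) with ((norm h / delta) ^ 2 * M * / (1 - x))
      by (unfold Rdiv; ring).
    apply (norm_is_series_le _ (fun n => (norm h / delta) ^ 2 * M * x ^ n) _ _) with (2 := S1);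
      [|now apply is_series_geom_scal].
    intros n.
    match goal with |- norm ?X <= _ => replace X with
      (minus (minus (qpow y n) (qpow q n)) (dpow q h n) ** a n) end.
    2: { rewrite !qmul_minus_l; reflexivity. }
    rewrite norm_qmul, Ey; fold h.
    eapply Rle_trans; [apply Rmult_le_compat_r; [apply qnorm_ge_0 |
      apply (norm_pow_taylor q h delta Hdelta (Rlt_le _ _ Hy))]|].
    rewrite !Rmult_assoc; apply Rmult_le_compat_l; auto; apply pow2_ge_0.
- intros J HJ; apply (is_series_uniq (V := HN) _ _ _ (proj1 (HD J))).
  eapply is_series_ext; [|apply (is_series_linear (U := HN) (V := HN) (fun q => J ** q)
    _ _ (is_linear_qmul_l J) (proj1 (HD qone)))].
  intros n; simpl; rewrite (dpow_comm q J n HJ); apply qmul_assoc.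
Qed.

Lemma qPSeries_hol rho a I q : coef_bounded rho a -> Hball rho q -> qcomm I q ->
  hol (U := HN) I qone I (qPSeries a) q.
Proof.
intros Ha Hq HI; destruct (qPSeries_differentiable rho a q Ha Hq) as (D & HD & HDI).
exists D; auto.
Qed.

Lemma open_Hball rho : open (Hball rho).
Proof.
intros q Hq; apply (locally_le_locally_norm (V := HN)); unfold Hball in *.
assert (Hp : 0 < rho - norm q) by lra.
exists (mkposreal _ Hp); intros y Hy; unfold ball_norm in Hy; simpl in Hy; qfold.
pose proof (qnorm_le_minus y q); lra.
Qed.

Lemma qPSeries_regular rho a : coef_bounded rho a -> regular_on (Hball rho) (qPSeries a).
Proof.
intros Ha; apply regular_of_cauchy_riemann; [apply open_Hball|].
intros q Hq; destruct (qPSeries_differentiable rho a q Ha Hq) as (D & HD & HDI).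
exists D; split; auto; intros I HI HIq; apply HDI; now apply in_slice_comm.
Qed.


(** * Regular multiplication on coefficients *)

Definition conv (a b : nat -> quat) (n : nat) : quat :=
  sum_n (fun k => a k ** b (n - k)%nat) n.

Lemma norm_sum_n_le (u : nat -> quat) (B : R) n :
  (forall k, (k <= n)%nat -> norm (u k) <= B) -> norm (sum_n u n) <= (INR n + 1) * B.
Proof.
induction n as [|n IH]; intros H.
- rewrite sum_O; simpl; rewrite Rplus_0_l, Rmult_1_l; now apply H.
- rewrite sum_Sn, S_INR; eapply Rle_trans; [apply qnorm_triangle|].
  replace ((INR n + 1 + 1) * B) with ((INR n + 1) * B + B) by ring.
  apply Rplus_le_compat; [apply IH; intros; apply H; lia | apply H; lia].
Qed.

(** Absorbs the number [n + 1] of terms of a Cauchy product into a larger radius. *)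
Lemma succ_pow_bound x n : 0 <= x < 1 -> (INR n + 1) * x ^ n <= / (1 - x).
Proof.
intros Hx.
assert (K : (INR n + 1) * x ^ n * (1 - x) <= 1 - x ^ S n).
{ induction n as [|n IH]; [simpl; lra|].
  assert (P0 : 0 <= x ^ S n) by (apply pow_le; lra).
  assert (P1 : x ^ S n <= 1) by (rewrite <- (pow1 (S n)); apply pow_incr; lra).
  rewrite S_INR; change (x ^ S (S n)) with (x * x ^ S n).
  apply (Rmult_le_compat_l x) in IH; [|lra].
  replace ((INR n + 1 + 1) * x ^ S n * (1 - x))
    with (x * ((INR n + 1) * x ^ n * (1 - x)) + x ^ S n * (1 - x)) by (simpl; ring).
  nra. }
assert (P0 : 0 <= x ^ S n) by (apply pow_le; lra).
apply Rmult_le_reg_r with (1 - x); [lra|]; rewrite Rinv_l; lra.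
Qed.

Lemma coef_bounded_conv rho a b :
  coef_bounded rho a -> coef_bounded rho b -> coef_bounded rho (conv a b).
Proof.
intros Ha Hb s Hs; set (t := (s + rho) / 2); assert (Ht : s < t < rho) by (unfold t; lra).
destruct (Ha t) as (M & HM & HaM); [lra|]; destruct (Hb t) as (N & HN' & HbN); [lra|].
assert (Hx : 0 <= s * / t < 1).
{ assert (0 < / t) by (apply Rinv_0_lt_compat; lra); split; [nra|].
  apply Rmult_lt_reg_r with t; [lra|]; rewrite Rmult_assoc, Rinv_l; lra. }
assert (Hx1 : 0 < / (1 - s * / t)) by (apply Rinv_0_lt_compat; lra).
assert (HMN : 0 <= M * N) by now apply Rmult_le_pos.
assert (Hs' : 0 < / s) by (apply Rinv_0_lt_compat; lra).
exists (M * N * / (1 - s * / t)); split; [apply Rmult_le_pos; lra|]; intros n.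
apply Rle_trans with ((INR n + 1) * (M * N * (/ t) ^ n)).
- apply norm_sum_n_le; intros k Hk; rewrite norm_qmul.
  replace (M * N * (/ t) ^ n) with (M * (/ t) ^ k * (N * (/ t) ^ (n - k))).
  + apply Rmult_le_compat; auto; apply qnorm_ge_0.
  + replace n with (k + (n - k))%nat at 2 by lia; rewrite pow_add; ring.
- replace ((INR n + 1) * (M * N * (/ t) ^ n))
    with (M * N * ((INR n + 1) * (s * / t) ^ n) * (/ s) ^ n).
  + apply Rmult_le_compat_r; [apply pow_le; lra|].
    apply Rmult_le_compat_l; auto; now apply succ_pow_bound.
  + rewrite (Rpow_mult_distr s).
    transitivity (M * N * (INR n + 1) * (/ t) ^ n * ((/ s) ^ n * s ^ n)); [ring|].
    rewrite pow_inv_cancel by lra; ring.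
Qed.

Lemma coef_bounded_conj rho a : coef_bounded rho a -> coef_bounded rho (fun n => qconj (a n)).
Proof.
intros Ha s Hs; destruct (Ha s Hs) as (M & HM & H); exists M; split; auto.
intros n; rewrite norm_qconj; apply H.
Qed.

Lemma sum_n_first (u : nat -> quat) n :
  sum_n u (S n) = plus (u 0%nat) (sum_n (fun k => u (S k)) n).
Proof.
unfold sum_n; rewrite (sum_Sn_m u) by lia; f_equal; now rewrite sum_n_m_S.
Qed.

Lemma sum_n_rev (u : nat -> quat) n : sum_n (fun k => u (n - k)%nat) n = sum_n u n.
Proof.
revert u; induction n as [|n IH]; intros u; [now rewrite !sum_O|].
rewrite sum_n_first, sum_Sn, (plus_comm (sum_n u n) (u (S n))); f_equal.
exact (IH u).
Qed.

Lemma sum_n_zero (u : nat -> quat) n : (forall k, (k <= n)%nat -> u k = zero) -> sum_n u n = zero.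
Proof.
induction n as [|n IH]; intros H; [rewrite sum_O; now apply H|].
rewrite sum_Sn, IH, H by (intros; try apply H; lia); apply (plus_zero_l (G := HN)).
Qed.

Lemma sum_n_single (u : nat -> quat) k n : (k <= n)%nat ->
  (forall j, (j <= n)%nat -> j <> k -> u j = zero) -> sum_n u n = u k.
Proof.
induction n as [|n IH]; intros Hk H.
- rewrite sum_O; f_equal; lia.
- rewrite sum_Sn; destruct (Nat.eq_dec k (S n)) as [->|Hne].
  + rewrite sum_n_zero by (intros; apply H; lia); apply (plus_zero_l (G := HN)).
  + rewrite IH, (H (S n)) by (intros; try apply H; lia); apply (plus_zero_r (G := HN)).
Qed.

Lemma is_linear_qconj : is_linear (U := HN) (V := HN) qconj.
Proof.
split; [intros; clear; qring | intros; clear; qring |].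
exists 1; split; [lra|]; intros q; rewrite Rmult_1_l; right; apply norm_qconj.
Qed.

Lemma qconj_fixed_central c q : qconj c = c -> qcomm q c.
Proof.
destruct c as [[[a b] c] d]; intros H; simpl in H; injection H as Hb Hc Hd.
replace b with 0 by lra; replace c with 0 by lra; replace d with 0 by lra; apply qcomm_RtoH.
Qed.

(** The coefficients of [f * f^c] are real, since the [n]-th one is self-conjugate. *)
Lemma conv_conj_central a n q : qcomm q (conv a (fun k => qconj (a k)) n).
Proof.
apply qconj_fixed_central; unfold conv.
rewrite <- (sum_n_linear (U := HN) (V := HN) qconj _ n is_linear_qconj).
rewrite <- sum_n_rev; apply sum_n_ext_loc; intros k Hk; cbv beta.
rewrite qconj_qmul; replace (n - (n - k))%nat with k by lia.
now destruct (a k) as [[[? ?] ?] ?]; simpl; rewrite !Ropp_involutive.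
Qed.

(** The first non-zero coefficient [a k] contributes [|a k|^2 <> 0] to [f * f^c] in degree
    [2 k]. *)
Lemma conv_conj_nonzero a : (exists n, a n <> zero) -> exists n, conv a (fun k => qconj (a k)) n <> zero.
Proof.
intros [n0 Hn0].
destruct (dec_inh_nat_subset_has_unique_least_element (fun n => a n <> zero)) as (k & [Hk Hmin] & _).
- intros n; apply classic.
- now exists n0.
- exists (k + k)%nat; unfold conv; rewrite (sum_n_single _ k); try lia.
  + replace (k + k - k)%nat with k by lia; intros E.
    apply qmul_eq_zero in E; destruct E as [E|E]; [now apply Hk|].
    apply Hk, qnorm_eq_zero; rewrite <- norm_qconj, E; apply qnorm_zero.
  + intros j Hj Hne.
    assert (Hz : forall i, (i < k)%nat -> a i = zero).
    { intros i Hi; apply NNPP; intros Hn; apply Hmin in Hn; lia. }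
    destruct (Nat.lt_ge_cases j k).
    * rewrite Hz by auto; apply qmul_zero_l.
    * rewrite (Hz (k + k - j)%nat) by lia.
      replace (qconj zero) with (zero : quat) by (clear; qring); apply qmul_zero_r.
Qed.

(** ** Linear factors *)

(** Coefficients of [(q - p) * k]. *)
Definition lin_mul (p : quat) (k : nat -> quat) (n : nat) : quat :=
  match n with
  | O => opp (p ** k O)
  | S m => minus (k m) (p ** k (S m))
  end.

(** Coefficients of [q - p] and of [1]. *)
Definition lin_coef (p : quat) (n : nat) : quat :=
  match n with O => opp p | 1%nat => qone | _ => zero end.

Definition one_coef (n : nat) : quat := match n with O => qone | _ => zero end.

Lemma conv_one_l k : conv one_coef k = k.
Proof.
apply functional_extensionality; intros n; unfold conv; rewrite (sum_n_single _ 0); try lia.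
- rewrite Nat.sub_0_r; apply qmul_one_l.
- intros [|j] _ Hj; [easy | apply qmul_zero_l].
Qed.

Lemma conv_lin_coef p k : conv (lin_coef p) k = lin_mul p k.
Proof.
apply functional_extensionality; intros [|n]; unfold conv.
- rewrite sum_O; apply qmul_opp_l.
- rewrite sum_n_first, (sum_n_single _ 0); try lia.
  + simpl; rewrite Nat.sub_0_r, qmul_one_l, qmul_opp_l; apply (plus_comm (G := HN)).
  + intros [|j] _ Hj; [easy | apply qmul_zero_l].
Qed.

Lemma sum_n_minus_qmul (p : quat) (u v : nat -> quat) n :
  sum_n (fun i => minus (v i) (p ** u i)) n = minus (sum_n v n) (p ** sum_n u n).
Proof.
induction n as [|n IH]; [now rewrite !sum_O|].
rewrite !sum_Sn, IH, qmul_plus_r.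
generalize (sum_n v n : quat) (p ** sum_n u n) (p ** u (S n)) (v (S n)); clear; qring.
Qed.

(** Associativity of the regular product in the one case where the first factor is
    linear. *)
Lemma conv_lin_mul p u k : conv (lin_mul p u) k = lin_mul p (conv u k).
Proof.
apply functional_extensionality; intros [|n]; unfold conv.
- simpl; rewrite !sum_O; simpl; rewrite qmul_opp_l; now rewrite qmul_assoc.
- simpl; rewrite sum_n_first; simpl lin_mul.
  rewrite (sum_n_first (fun i => u i ** k (S n - i)%nat)); simpl Nat.sub.
  rewrite (sum_n_ext _ (fun i => minus (u i ** k (n - i)%nat) (p ** (u (S i) ** k (n - i)%nat)))).
  2: { intros i; now rewrite qmul_minus_l, qmul_assoc. }
  rewrite sum_n_minus_qmul, qmul_opp_l, <- qmul_assoc, qmul_plus_r.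
  match goal with |- plus (opp ?x) (minus ?y ?z) = _ => generalize (x : quat) (y : quat) (z : quat) end.
  clear; qring.
Qed.

Lemma coef_bounded_lin_mul rho p k : coef_bounded rho k -> coef_bounded rho (lin_mul p k).
Proof.
intros Hk s Hs; destruct (Hk s Hs) as (M & HM & H).
assert (Hs' : 0 < / s) by (apply Rinv_0_lt_compat; lra).
pose proof (qnorm_ge_0 p) as Hp.
exists (M * s + norm p * M); split; [nra|]; intros [|n]; simpl lin_mul.
- rewrite qnorm_opp, norm_qmul; specialize (H 0%nat); simpl in *; nra.
- eapply Rle_trans; [apply qnorm_minus|]; rewrite norm_qmul, Rmult_plus_distr_r.
  apply Rplus_le_compat.
  + eapply Rle_trans; [apply H|]; right; simpl; field; lra.
  + rewrite Rmult_assoc; apply Rmult_le_compat_l; auto.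
Qed.

Lemma is_series_zero : is_series (V := HN) (fun _ => zero) zero.
Proof.
apply filterlim_ext with (fun _ => zero); [|apply filterlim_const].
intros n; symmetry; now apply sum_n_zero.
Qed.

Lemma is_series_single (u : nat -> quat) k : (forall n, n <> k -> u n = zero) ->
  is_series (V := HN) u (u k).
Proof.
intros H; apply filterlim_ext_loc with (fun _ => u k); [|exact (filterlim_const (U := HN) (u k))].
exists k; intros n Hn; symmetry; apply sum_n_single; auto.
Qed.

Lemma one_expansion rho : is_expansion rho (fun _ => qone) one_coef.
Proof.
intros q _.
assert (E := is_series_single (fun n => qpow q n ** one_coef n) 0).
simpl in E; rewrite qmul_one_r in E; apply E.
intros [|n] Hn; [easy | apply qmul_zero_r].
Qed.

(** At the points commuting with [p] the regular product with [q - p] is the pointwise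
    one. *)
Lemma is_series_lin_mul p k q l : qcomm q p ->
  is_series (V := HN) (fun n => qpow q n ** k n) l ->
  is_series (V := HN) (fun n => qpow q n ** lin_mul p k n) (minus q p ** l).
Proof.
intros C Hl.
set (v := fun n => match n with O => zero | S m => q ** (qpow q m ** k m) end).
assert (Hv : is_series (V := HN) v (q ** l)).
{ apply is_series_decr_1.
  match goal with |- is_series _ ?L => replace L with (q ** l : quat) end.
  - exact (is_series_linear (U := HN) (V := HN) (fun x => q ** x) _ _ (is_linear_qmul_l q) Hl).
  - simpl; symmetry; generalize (q ** l); clear; qring. }
assert (Hw := is_series_linear (U := HN) (V := HN) (fun x => p ** x) _ _ (is_linear_qmul_l p) Hl).
rewrite qmul_minus_l.
eapply is_series_ext; [|apply (is_series_minus (V := HN) _ _ _ _ Hv Hw)].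
assert (Cn : forall n, qpow q n ** p = p ** qpow q n).
{ intros n; symmetry; apply qcomm_pow, qcomm_sym, C. }
intros [|n]; simpl.
- rewrite !qmul_one_l; generalize (p ** k O); clear; qring.
- rewrite qmul_minus_r, !qmul_assoc; f_equal.
  now rewrite (Cn (S n) : q ** qpow q n ** p = p ** (q ** qpow q n)), qmul_assoc.
Qed.

Lemma lin_expansion rho p : is_expansion rho (fun x => minus x p) (lin_coef p).
Proof.
intros q _.
apply is_series_decr_1, is_series_decr_1.
match goal with |- is_series _ ?l => replace l with (zero : quat) end.
- eapply is_series_ext; [|exact is_series_zero]; intros n; symmetry; apply qmul_zero_r.
- simpl; clear; qring.
Qed.

Lemma lin_mul_expansion rho p k : coef_bounded rho k ->
  forall q, Hball rho q -> qcomm q p -> qPSeries (lin_mul p k) q = minus q p ** qPSeries k q.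
Proof.
intros Hk q Hq C; apply (is_series_uniq (V := HN) (fun n => qpow q n ** lin_mul p k n)).
- apply coef_bounded_is_series with rho; auto; now apply coef_bounded_lin_mul.
- apply is_series_lin_mul; auto; now apply coef_bounded_is_series with rho.
Qed.

Fixpoint lin_pow_mul (p : quat) (n : nat) (k : nat -> quat) : nat -> quat :=
  match n with O => k | S m => lin_mul p (lin_pow_mul p m k) end.

Lemma lin_pow_mul_S p n k : lin_pow_mul p n (lin_mul p k) = lin_pow_mul p (S n) k.
Proof. induction n as [|n IH]; simpl in *; [reflexivity | now rewrite IH]. Qed.

Lemma coef_bounded_lin_pow_mul rho p n k : coef_bounded rho k -> coef_bounded rho (lin_pow_mul p n k).
Proof. intros Hk; induction n; simpl; auto; now apply coef_bounded_lin_mul. Qed.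

Lemma lin_pow_mul_expansion rho p n k q : coef_bounded rho k -> Hball rho q -> qcomm q p ->
  qPSeries (lin_pow_mul p n k) q = qpow (minus q p) n ** qPSeries k q.
Proof.
intros Hk Hq C; induction n as [|n IH]; simpl; [now rewrite qmul_one_l|].
rewrite (lin_mul_expansion rho) by (auto using coef_bounded_lin_pow_mul).
now rewrite IH, qmul_assoc.
Qed.

Lemma conv_lin_pow_mul p n u k : conv (lin_pow_mul p n u) k = lin_pow_mul p n (conv u k).
Proof. induction n as [|n IH]; simpl; [reflexivity | now rewrite conv_lin_mul, IH]. Qed.

Lemma one_coef_bounded rho : coef_bounded rho one_coef.
Proof. exact (expansion_coef_bounded rho _ _ (one_expansion rho)). Qed.

Lemma reg_pow_expansion rho p n : 0 < rho ->
  is_expansion rho (reg_pow rho (fun x => minus x p) n) (lin_pow_mul p n one_coef).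
Proof.
intros Hrho; induction n as [|n IH]; [apply one_expansion|].
simpl; unfold reg_mul.
rewrite (qcoef_expansion rho _ _ Hrho (lin_expansion rho p)), (qcoef_expansion rho _ _ Hrho IH).
change (is_expansion rho (qPSeries (conv (lin_coef p) (lin_pow_mul p n one_coef)))
  (lin_mul p (lin_pow_mul p n one_coef))).
rewrite conv_lin_coef; apply qPSeries_expansion.
apply coef_bounded_lin_mul, coef_bounded_lin_pow_mul, one_coef_bounded.
Qed.

Lemma reg_pow_mul_expansion rho p n k b : 0 < rho -> is_expansion rho k b ->
  reg_mul rho (reg_pow rho (fun x => minus x p) n) k = qPSeries (lin_pow_mul p n b).
Proof.
intros Hrho Hk; unfold reg_mul.
rewrite (qcoef_expansion rho _ _ Hrho (reg_pow_expansion rho p n Hrho)), (qcoef_expansion rho _ _ Hrho Hk).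
change (qPSeries (conv (lin_pow_mul p n one_coef) b) = qPSeries (lin_pow_mul p n b)).
now rewrite conv_lin_pow_mul, conv_one_l.
Qed.

(** Uniqueness of coefficients turns divisibility of functions into an equation between
    sequences. *)
Lemma divisible_at_coef rho c p n : 0 < rho -> coef_bounded rho c ->
  divisible_at rho (qPSeries c) p n <-> exists k, coef_bounded rho k /\ c = lin_pow_mul p n k.
Proof.
intros Hrho Hc; split.
- intros (k & Hk & E); destruct (regular_expansion rho k Hrho Hk) as [b Hb].
  assert (Hbb := expansion_coef_bounded _ _ _ Hb).
  rewrite (reg_pow_mul_expansion rho p n k b Hrho Hb) in E.
  exists b; split; auto.
  apply (expansion_unique rho (qPSeries c)); auto; [now apply qPSeries_expansion|].
  intros q Hq; rewrite (E q Hq); apply coef_bounded_is_series with rho; auto.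
  now apply coef_bounded_lin_pow_mul.
- intros (k & Hk & ->); exists (qPSeries k); split; [now apply qPSeries_regular|].
  intros q Hq; now rewrite (reg_pow_mul_expansion rho p n _ k Hrho (qPSeries_expansion rho k Hk)).
Qed.

(** A zero at [p] splits off a factor: the quotient has the coefficients
    [sum_j p^j k_(n+1+j)], the tails of the series of value [0] at [p]. *)
Lemma factor_zero rho p k : coef_bounded rho k -> Hball rho p -> qPSeries k p = zero ->
  exists k', coef_bounded rho k' /\ k = lin_mul p k'.
Proof.
intros Hk Hp H0; unfold Hball in Hp; pose proof (qnorm_ge_0 p) as Hp0.
set (T := fun n => qSeries (fun j => qpow p j ** k (n + j)%nat)).
assert (HT : forall s, 0 < s < rho -> exists C, 0 <= C /\ forall n,
  is_series (V := HN) (fun j => qpow p j ** k (n + j)%nat) (T n) /\ norm (T n) <= C * (/ s) ^ n).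
{ intros s Hs; set (m := Rmax s (norm p)); set (t := (m + rho) / 2).
  assert (Hm : s <= m /\ norm p <= m /\ m < rho).
  { repeat split; [apply Rmax_l | apply Rmax_r | apply Rmax_lub_lt; lra]. }
  assert (Ht : m < t < rho) by (unfold t; lra).
  destruct (Hk t) as (M & HM & H); [lra|].
  assert (Hti : 0 < / t) by (apply Rinv_0_lt_compat; lra).
  assert (Hx : 0 <= norm p * / t < 1).
  { split; [nra|]; apply Rmult_lt_reg_r with t; [lra|]; rewrite Rmult_assoc, Rinv_l; lra. }
  assert (Hx1 : 0 < / (1 - norm p * / t)) by (apply Rinv_0_lt_compat; lra).
  exists (M * / (1 - norm p * / t)); split; [apply Rmult_le_pos; lra|]; intros n.
  destruct (is_series_dominated (fun j => qpow p j ** k (n + j)%nat) (M * (/ t) ^ n) (norm p * / t) Hx)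
    as [S1 S2].
  - intros j; rewrite norm_qmul, norm_qpow, Rpow_mult_distr.
    replace (M * (/ t) ^ n * (norm p ^ j * (/ t) ^ j)) with (norm p ^ j * (M * (/ t) ^ (n + j)))
      by (rewrite pow_add; ring).
    apply Rmult_le_compat_l; auto; now apply pow_le.
  - split; auto; eapply Rle_trans; [exact S2|].
    replace (M * (/ t) ^ n * / (1 - norm p * / t)) with (M * / (1 - norm p * / t) * (/ t) ^ n) by ring.
    apply Rmult_le_compat_l; [apply Rmult_le_pos; lra|].
    apply pow_incr; split; [lra | apply Rinv_le_contravar; lra]. }
assert (HT1 : forall n, is_series (V := HN) (fun j => qpow p j ** k (n + j)%nat) (T n)).
{ intros n; destruct (HT (rho / 2)) as (C & _ & H); [lra|]; apply H. }
assert (Hrec : forall n, T n = plus (k n) (p ** T (S n))).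
{ intros n; apply (is_series_uniq (V := HN) _ _ _ (HT1 n)), is_series_decr_1.
  match goal with |- is_series _ ?L => replace L with (p ** T (S n) : quat) end.
  - eapply is_series_ext; [|exact (is_series_linear (U := HN) (V := HN) (fun x => p ** x) _ _
      (is_linear_qmul_l p) (HT1 (S n)))].
    intros j; simpl; rewrite qmul_assoc; do 2 f_equal; lia.
  - simpl; rewrite Nat.add_0_r, qmul_one_l; symmetry; generalize (p ** T (S n)) (k n); clear; qring. }
exists (fun n => T (S n)); split.
- intros s Hs; destruct (HT s Hs) as (C & HC & H).
  assert (0 < / s) by (apply Rinv_0_lt_compat; lra).
  exists (C * / s); split; [apply Rmult_le_pos; lra|]; intros n.
  eapply Rle_trans; [apply H|]; right; simpl; ring.
- apply functional_extensionality; intros [|n]; simpl lin_mul.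
  + assert (E : T O = zero) by exact H0.
    rewrite Hrec in E; revert E; generalize (k O) (p ** T 1%nat); intros u v E.
    replace u with (minus (plus u v) v) by (clear; qring); rewrite E; clear; qring.
  + rewrite (Hrec (S n)); generalize (k (S n)) (p ** T (S (S n))); clear; qring.
Qed.


(** * Zeros on a slice *)

Lemma norm_scal_pos (x : R) (q : quat) : 0 <= x -> norm (scal x q : quat) = x * norm q.
Proof. intros Hx; now rewrite norm_qscal, Rabs_pos_eq. Qed.

Lemma in_slice_scal I (x : R) p : imag_unit I -> in_slice I p -> in_slice I (scal x p).
Proof. intros HI Hp; apply in_slice_comm in Hp; auto; apply in_slice_comm; auto; now apply qcomm_scal. Qed.

Definition vanishes_near (I : quat) (F : quat -> quat) (c : quat) : Prop :=
  exists eps, 0 < eps /\ forall z, in_slice I z -> norm (minus z c) < eps -> F z = zero.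

Lemma is_series_zero_coef (u : nat -> quat) : 
  is_series (V := HN) (fun n => u n ** zero) zero.
Proof.
eapply is_series_ext; [|exact is_series_zero]; intros n; symmetry; apply qmul_zero_r.
Qed.

(** The expansion at [c] converges on the whole disc and has zero coefficients. *)
Lemma vanishing_propagates I F c r : imag_unit I -> 0 < r -> in_slice I c ->
  (forall q, in_slice I q -> norm (minus q c) < r -> hol (U := HN) I qone I F q) ->
  vanishes_near I F c -> forall z, in_slice I z -> norm (minus z c) < r -> F z = zero.
Proof.
intros HI Hr Hc HF (eps & He & Hv) z Hz Hzr.
destruct (slice_expansion I F c r HI Hr Hc HF) as [a Ha].
assert (Ea : a = fun _ => zero).
{ apply power_series_ext with (Rmin eps r); [now apply Rmin_glb_lt|].
  intros t Ht; exists zero; split; [|apply is_series_zero_coef].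
  assert (Hs : in_slice I (plus (RtoH t) c)) by (apply slice_plus; auto; apply in_slice_RtoH).
  assert (Em : minus (plus (RtoH t) c) c = RtoH t) by apply qminus_plus_cancel.
  assert (H := Ha (plus (RtoH t) c) Hs); rewrite Em, norm_RtoH in H.
  rewrite Hv in H; auto.
  - apply H; eapply Rlt_le_trans; [exact Ht | apply Rmin_r].
  - rewrite Em, norm_RtoH; eapply Rlt_le_trans; [exact Ht | apply Rmin_l]. }
apply (is_series_uniq (V := HN) _ _ _ (Ha z Hz Hzr)); rewrite Ea; apply is_series_zero_coef.
Qed.

(** Vanishing is carried from [p] to the centre along the radius, by steps shorter than the
    distance from [p] to the boundary. *)
Lemma slice_identity rho c I p : 0 < rho -> coef_bounded rho c -> imag_unit I ->
  in_slice I p -> Hball rho p -> vanishes_near I (qPSeries c) p -> c = fun _ => zero.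
Proof.
intros Hrho Hc HI Hp Hpr Hv; unfold Hball in Hpr; pose proof (qnorm_ge_0 p) as Hp0.
set (delta := rho - norm p); assert (Hd : 0 < delta) by (unfold delta; lra).
assert (Hhol : forall q, in_slice I q -> norm q < rho -> hol (U := HN) I qone I (qPSeries c) q).
{ intros q Hq Hqr; apply (qPSeries_hol rho); auto; now apply in_slice_comm. }
assert (Hstep : forall n x, 0 <= x <= 1 -> (1 - x) * norm p <= INR n * (delta / 2) ->
  vanishes_near I (qPSeries c) (scal x p)).
{ induction n as [|n IH]; intros x Hx Hxn.
  - simpl in Hxn.
    assert (E : scal x p = p).
    { destruct (Req_dec (norm p) 0) as [E|E].
      - rewrite (qnorm_eq_zero p E); apply (scal_zero_r (V := HN)).
      - assert (x = 1) as ->; [|apply (scal_one (V := HN))].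
        assert (0 <= (1 - x) * norm p) by (apply Rmult_le_pos; lra).
        assert (E' : (1 - x) * norm p = 0) by lra.
        apply Rmult_integral in E'; lra. }
    now rewrite E.
  - rewrite S_INR in Hxn.
    (* [y p] is the preceding point of the chain from [p] to [0] *)
    assert (Hy : exists y, 0 <= y <= 1 /\ (1 - y) * norm p <= INR n * (delta / 2) /\
                           x <= y /\ (y - x) * norm p <= delta / 2).
    { destruct (Rle_or_lt ((1 - x) * norm p) (delta / 2)) as [L|L].
      - exists 1; repeat split; try lra.
        replace ((1 - 1) * norm p) with 0 by ring; apply Rmult_le_pos; [apply pos_INR | lra].
      - assert (Pp : 0 < norm p) by nra.
        exists (x + delta / 2 / norm p).
        assert (E : delta / 2 / norm p * norm p = delta / 2) by (field; lra).
        assert (0 <= delta / 2 / norm p) by (apply Rdiv_le_0_compat; lra).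
        repeat split; try lra; try nra. }
    destruct Hy as (y & Hy & Hyn & Hxy & Hdist).
    assert (Hny : norm (scal y p : quat) <= norm p).
    { rewrite norm_scal_pos by lra; nra. }
    exists (delta / 2); split; [lra|]; intros z Hz Hzr.
    apply (vanishing_propagates I (qPSeries c) (scal y p) delta); auto.
    + now apply in_slice_scal.
    + intros q Hq Hqr; apply Hhol; auto.
      pose proof (qnorm_le_minus q (scal y p)); unfold delta in Hqr; lra.
    + replace (minus z (scal y p)) with (minus (minus z (scal x p)) (scal (y - x) p)).
      * eapply Rle_lt_trans; [apply qnorm_minus|]; rewrite (norm_scal_pos (y - x)) by lra; lra.
      * clear; qring. }
destruct (nfloor_ex (norm p / (delta / 2))) as [n Hn]; [apply Rdiv_le_0_compat; lra|].
destruct (Hstep (S n) 0) as (eps & He & Hz); [lra | |].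
- rewrite S_INR; assert (E : norm p / (delta / 2) * (delta / 2) = norm p) by (field; lra).
  rewrite Rminus_0_r, Rmult_1_l, <- E; apply Rmult_le_compat_r; lra.
- apply power_series_ext with (Rmin eps rho); [now apply Rmin_glb_lt|].
  intros t Ht; exists zero; split; [|apply is_series_zero_coef].
  rewrite <- (Hz (RtoH t)).
  + apply coef_bounded_is_series with rho; auto; rewrite norm_RtoH.
    eapply Rlt_le_trans; [exact Ht | apply Rmin_r].
  + apply in_slice_RtoH.
  + rewrite (scal_zero_l (V := HN)).
    match goal with |- norm ?X < _ => replace X with (RtoH t) by (symmetry; apply qminus_zero_r) end.
    rewrite norm_RtoH; eapply Rlt_le_trans; [exact Ht | apply Rmin_l].
Qed.

(** ** Multiplicity *)

(** Multiplication by [q^n] moves the coefficients up by [n]. *)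
Lemma lin_pow_mul_zero_low n k j : (j < n)%nat -> lin_pow_mul zero n k j = zero.
Proof.
revert j; induction n as [|n IH]; intros [|j] Hj; try lia; simpl.
- rewrite qmul_zero_l; clear; qring.
- rewrite qmul_zero_l, IH by lia; clear; qring.
Qed.

Lemma is_series_lin_pow_mul p n k q l : qcomm q p ->
  is_series (V := HN) (fun i => qpow q i ** k i) l ->
  is_series (V := HN) (fun i => qpow q i ** lin_pow_mul p n k i) (qpow (minus q p) n ** l).
Proof.
intros C Hl; induction n as [|n IH]; simpl; [now rewrite qmul_one_l|].
rewrite <- qmul_assoc; now apply is_series_lin_mul.
Qed.

(** The coefficients of degree below [n] of the expansion at [p] vanish if [(q - p)^n]
    divides: so divisibility by all powers forces the expansion to be zero. *)
Lemma divisible_bounded rho c p : 0 < rho -> coef_bounded rho c -> (exists n, c n <> zero) ->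
  Hball rho p -> exists N, forall n, divisible_at rho (qPSeries c) p n -> (n <= N)%nat.
Proof.
intros Hrho Hc [i0 Hi0] Hp.
destruct (in_some_slice p) as (I & HI & HIp).
apply NNPP; intros Hno.
assert (Hbig : forall N, exists n k, (N < n)%nat /\ coef_bounded rho k /\ c = lin_pow_mul p n k).
{ intros N; apply NNPP; intros H; apply Hno; exists N; intros n Hn.
  apply Nat.nlt_ge; intros Hlt; apply H.
  apply divisible_at_coef in Hn; auto; destruct Hn as (k & Hk & E); now exists n, k. }
assert (Hhol : forall k, coef_bounded rho k -> forall q, in_slice I q ->
  norm (minus q p) < rho - norm p -> hol (U := HN) I qone I (qPSeries k) q).
{ intros k Hk q Hq Hqp; apply (qPSeries_hol rho); auto; [|now apply in_slice_comm].
  unfold Hball; pose proof (qnorm_le_minus q p); lra. }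
unfold Hball in Hp.
destruct (slice_expansion I (qPSeries c) p (rho - norm p) HI ltac:(lra) HIp (Hhol c Hc)) as [b Hb].
assert (Eb : b = fun _ => zero).
{ apply functional_extensionality; intros j.
  destruct (Hbig j) as (n & k & Hn & Hk & E).
  destruct (slice_expansion I (qPSeries k) p (rho - norm p) HI ltac:(lra) HIp (Hhol k Hk)) as [e He].
  replace b with (lin_pow_mul zero n e); [now apply lin_pow_mul_zero_low|].
  apply power_series_ext with (rho - norm p); [lra|].
  intros t Ht; exists (qPSeries c (plus (RtoH t) p)).
  assert (Hs : in_slice I (plus (RtoH t) p)) by (apply slice_plus; auto; apply in_slice_RtoH).
  assert (Em : minus (plus (RtoH t) p) p = RtoH t) by apply qminus_plus_cancel.
  assert (Hn' : norm (minus (plus (RtoH t) p) p) < rho - norm p) by (rewrite Em, norm_RtoH; auto).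
  split.
  - rewrite E, (lin_pow_mul_expansion rho); auto.
    + rewrite Em; replace (qpow (RtoH t) n) with (qpow (minus (RtoH t) zero) n)
        by (f_equal; apply qminus_zero_r).
      apply is_series_lin_pow_mul; [apply qcomm_zero|].
      generalize (He _ Hs Hn'); now rewrite Em.
    + unfold Hball; eapply Rle_lt_trans; [apply qnorm_triangle|]; rewrite norm_RtoH; lra.
    + now apply (in_slice_qcomm I).
  - generalize (Hb _ Hs Hn'); now rewrite Em. }
apply Hi0; rewrite (slice_identity rho c I p); auto.
exists (rho - norm p); split; [lra|]; intros z Hz Hzr.
apply (is_series_uniq (V := HN) _ _ _ (Hb z Hz Hzr)); rewrite Eb; apply is_series_zero_coef.
Qed.

Lemma max_exists (P : nat -> Prop) N : P 0%nat -> (forall n, P n -> (n <= N)%nat) ->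
  exists m, P m /\ forall n, P n -> (n <= m)%nat.
Proof.
induction N as [|N IH]; intros H0 HN'.
- exists 0%nat; split; auto.
- destruct (classic (P (S N))) as [H|H]; [now exists (S N)|].
  apply IH; auto; intros n Hn; specialize (HN' n Hn).
  destruct (Nat.eq_dec n (S N)) as [->|]; [easy | lia].
Qed.

Lemma min_exists (P : nat -> Prop) N : P N -> exists m, P m /\ (forall n, P n -> (m <= n)%nat).
Proof.
intros H; destruct (dec_inh_nat_subset_has_unique_least_element P) as (m & Hm & _).
- intros n; apply classic.
- now exists N.
- now exists m.
Qed.

(** If the cofactor of a maximal power vanished at [p], one more factor would split off. *)
Lemma multiplicity_exists rho c p : 0 < rho -> coef_bounded rho c -> (exists n, c n <> zero) ->
  Hball rho p -> exists m k, is_multiplicity rho (qPSeries c) p m /\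
    coef_bounded rho k /\ c = lin_pow_mul p m k /\ qPSeries k p <> zero.
Proof.
intros Hrho Hc Hnz Hp; destruct (divisible_bounded rho c p Hrho Hc Hnz Hp) as [N HNN].
destruct (max_exists (divisible_at rho (qPSeries c) p) N) as (m & Hm & Hmax); auto.
{ apply divisible_at_coef; auto; now exists c. }
pose proof Hm as Hm'; apply divisible_at_coef in Hm'; auto; destruct Hm' as (k & Hk & E).
exists m, k; repeat split; auto; intros Hz.
destruct (factor_zero rho p k Hk Hp Hz) as (k' & Hk' & ->).
assert (Hd : divisible_at rho (qPSeries c) p (S m)).
{ apply divisible_at_coef; auto; exists k'; split; auto; now rewrite E, lin_pow_mul_S. }
apply Hmax in Hd; lia.
Qed.


(** * Laurent expansion of a quotient *)

(** The term of index [0] passes from one half of the series to the other. *)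
Lemma is_bi_series_shift (u : Z -> quat) l :
  is_bi_series u l -> is_bi_series (fun n => u (n + 1)%Z) l.
Proof.
intros (l1 & l2 & H1 & H2 & ->).
exists (minus l1 (u 0%Z)), (plus (u 0%Z) l2); split; [|split].
- assert (T : is_series (V := HN) (fun n => u (Z.of_nat (S n))) (minus l1 (u 0%Z))).
  { apply (is_series_incr_1 (V := HN) (fun n => u (Z.of_nat n))).
    match goal with |- is_series _ ?L => replace L with (l1 : quat) end; auto.
    simpl; generalize (u 0%Z); clear; qring. }
  eapply is_series_ext; [|exact T]; intros n; cbv beta; f_equal; lia.
- apply is_series_decr_1.
  match goal with |- is_series _ ?L => replace L with (l2 : quat) end.
  + eapply is_series_ext; [|exact H2]; intros n; cbv beta; f_equal; lia.
  + simpl; generalize (u 0%Z); clear; qring.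
- generalize (u 0%Z); clear; qring.
Qed.

Lemma is_bi_series_qmul (p : quat) (u : Z -> quat) l :
  is_bi_series u l -> is_bi_series (fun n => p ** u n) (p ** l).
Proof.
intros (l1 & l2 & H1 & H2 & ->); exists (p ** l1), (p ** l2); repeat split.
- exact (is_series_linear (U := HN) (V := HN) (fun x => p ** x) _ _ (is_linear_qmul_l p) H1).
- exact (is_series_linear (U := HN) (V := HN) (fun x => p ** x) _ _ (is_linear_qmul_l p) H2).
- apply qmul_plus_r.
Qed.

Lemma is_bi_series_ext (u v : Z -> quat) l :
  (forall n, u n = v n) -> is_bi_series u l -> is_bi_series v l.
Proof.
intros H (l1 & l2 & H1 & H2 & E); exists l1, l2; repeat split; auto;
  eapply is_series_ext; [|exact H1| |exact H2]; intros n; apply H.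
Qed.

Lemma qpowZ_nat x n : qpowZ x (Z.of_nat n) = qpow x n.
Proof. destruct n as [|n]; [reflexivity|]; simpl; now rewrite SuccNat2Pos.id_succ. Qed.

Lemma qpowZ_opp x n : qpowZ x (- Z.of_nat n) = qpow (qinv x) n.
Proof. destruct n as [|n]; [reflexivity|]; simpl; now rewrite SuccNat2Pos.id_succ. Qed.

Lemma qpowZ_succ x n : x <> zero -> qpowZ x (n + 1) = x ** qpowZ x n.
Proof.
intros Hx; destruct (Z_lt_le_dec n 0) as [Hn|Hn].
- replace n with (- Z.of_nat (S (Z.to_nat (- n - 1))))%Z by lia.
  set (k := Z.to_nat (- n - 1)).
  replace (- Z.of_nat (S k) + 1)%Z with (- Z.of_nat k)%Z by lia.
  rewrite !qpowZ_opp; simpl qpow; now rewrite qmul_assoc, (qinv_r x Hx), qmul_one_l.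
- replace n with (Z.of_nat (Z.to_nat n)) by lia.
  replace (Z.of_nat (Z.to_nat n) + 1)%Z with (Z.of_nat (S (Z.to_nat n))) by lia.
  now rewrite !qpowZ_nat.
Qed.

Definition laurent_of (e : nat -> quat) (n : Z) : quat :=
  if (n <? 0)%Z then zero else e (Z.to_nat n).

(** Each division by [x] moves the index by one. *)
Lemma laurent_shift x e w m : x <> zero ->
  is_series (V := HN) (fun n => qpow x n ** e n) w ->
  is_bi_series (fun n => qpowZ x n ** laurent_of e (n + Z.of_nat m)) (qpow (qinv x) m ** w).
Proof.
intros Hx Hw; induction m as [|m IH].
- simpl qpow; rewrite qmul_one_l; exists w, zero; repeat split.
  + eapply is_series_ext; [|exact Hw]; intros n; rewrite qpowZ_nat; unfold laurent_of.
    destruct (Z.ltb_spec (Z.of_nat n + Z.of_nat 0) 0); [lia|]; do 2 f_equal; lia.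
  + eapply is_series_ext; [|exact is_series_zero]; intros n; unfold laurent_of.
    destruct (Z.ltb_spec (- Z.of_nat (S n) + Z.of_nat 0) 0); [|lia].
    symmetry; apply qmul_zero_r.
  + symmetry; apply (plus_zero_r (G := HN)).
- apply is_bi_series_shift, (is_bi_series_qmul (qinv x)) in IH.
  simpl qpow; rewrite <- qmul_assoc; revert IH; apply is_bi_series_ext; intros n.
  rewrite (qpowZ_succ x n Hx), !qmul_assoc, (qinv_l x Hx), qmul_one_l.
  do 2 f_equal; lia.
Qed.

Lemma qinv_qmul p q : p <> zero -> q <> zero -> qinv (p ** q) = qinv q ** qinv p.
Proof.
intros Hp Hq.
assert (Hpq : p ** q <> zero) by (intros E; apply qmul_eq_zero in E; tauto).
rewrite <- (qmul_one_r (qinv (p ** q))).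
replace qone with (p ** q ** (qinv q ** qinv p)).
- now rewrite qmul_assoc, (qinv_l _ Hpq), qmul_one_l.
- now rewrite <- qmul_assoc, (qmul_assoc q), (qinv_r q Hq), qmul_one_l, (qinv_r p Hp).
Qed.

Lemma qinv_qpow q n : q <> zero -> qinv (qpow q n) = qpow (qinv q) n.
Proof.
intros Hq; induction n as [|n IH].
- simpl; rewrite <- (qmul_one_r (qinv qone)); apply qinv_l, qone_neq_zero.
- rewrite (qpow_S_r (qinv q)); simpl qpow.
  rewrite qinv_qmul, IH by (auto using qpow_neq_zero); reflexivity.
Qed.

Section Quotient.
Variables (rho : R) (c d : nat -> quat).
Hypothesis Hrho : 0 < rho.
Hypothesis Hc : coef_bounded rho c.
Hypothesis Hd : coef_bounded rho d.
Hypothesis c_central : forall n q, qcomm q (c n).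
Hypothesis c_nonzero : exists n, c n <> zero.

Let s := qPSeries c.
Let quot (q : quat) := qinv (s q) ** qPSeries d q.
Let dom (q : quat) := Hball rho q /\ ~ zeros rho s q.

(** Central coefficients: [s q] lies in every slice that contains [q]. *)
Lemma central_series_comm J q : Hball rho q -> qcomm J q -> qcomm J (s q).
Proof.
intros Hq HJ; unfold qcomm.
assert (Hs := coef_bounded_is_series rho c q Hc Hq).
apply (is_series_uniq (V := HN) (fun n => J ** (qpow q n ** c n))).
- exact (is_series_linear (U := HN) (V := HN) (fun x => J ** x) _ _ (is_linear_qmul_l J) Hs).
- eapply is_series_ext; [|exact (is_series_linear (U := HN) (V := HN) (fun x => x ** J) _ _
    (is_linear_qmul_r J) Hs)].
  intros n; symmetry; apply qcomm_mul; [now apply qcomm_pow | apply c_central].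
Qed.

Lemma continuous_qPSeries a q : coef_bounded rho a -> Hball rho q -> continuous (qPSeries a) q.
Proof.
intros Ha Hq; destruct (qPSeries_differentiable rho a q Ha Hq) as (D & HD & _).
apply (filterdiff_continuous (U := HN) (V := HN)); now exists D.
Qed.

Lemma locally_nonzero (F : quat -> quat) q : continuous F q -> F q <> zero ->
  exists delta, 0 < delta /\ forall y : quat, norm (minus y q) < delta -> F y <> zero.
Proof.
intros HF HN0.
destruct (locally_norm_le_locally (V := HN) _ _ (qnorm_continuous_bound F q _ (qnorm_gt_0 _ HN0) HF))
  as [delta H].
exists delta; split; [apply cond_pos|]; intros y Hy E.
specialize (H y Hy); cbv beta in H; rewrite E, qnorm_minus_sym, qminus_zero_r in H; lra.
Qed.

Lemma open_dom : open dom.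
Proof.
intros q [Hq Hn].
assert (Hsq : s q <> zero) by (intros E; apply Hn; now split).
destruct (locally_nonzero s q (continuous_qPSeries c q Hc Hq) Hsq) as (delta & Hdelta & H).
apply (locally_le_locally_norm (V := HN)).
assert (Hp : 0 < Rmin delta (rho - norm q)) by (unfold Hball in Hq; apply Rmin_glb_lt; lra).
exists (mkposreal _ Hp); intros y Hy; unfold ball_norm in Hy; simpl in Hy; qfold.
split.
- unfold Hball; pose proof (qnorm_le_minus y q).
  pose proof (Rmin_r delta (rho - norm q)); lra.
- intros [_ E]; revert E; apply H; pose proof (Rmin_l delta (rho - norm q)); lra.
Qed.

Lemma quotient_regular : regular_on dom quot.
Proof.
apply regular_of_cauchy_riemann; [exact open_dom|].
intros q [Hq Hn].
assert (Hsq : s q <> zero) by (intros E; apply Hn; now split).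
destruct (qPSeries_differentiable rho c q Hc Hq) as (D & HD & HDI).
destruct (qPSeries_differentiable rho d q Hd Hq) as (D' & HD' & HDI').
exists (fun h => plus (opp (qinv (s q) ** D h ** qinv (s q)) ** qPSeries d q) (qinv (s q) ** D' h)).
split.
- apply (filterdiff_qmul (U := HN) (fun q => qinv (s q)) (qPSeries d) q
    (fun h => opp (qinv (s q) ** D h ** qinv (s q))) D'); [|exact HD'].
  apply (filterdiff_comp' (U := HN) (V := HN) (W := HN) s qinv q D
    (fun h => opp (qinv (s q) ** h ** qinv (s q)))); auto.
  now apply filterdiff_qinv.
- intros I HI HIq; apply in_slice_comm in HIq; auto.
  assert (Ci : qcomm I (qinv (s q))) by (apply qcomm_inv; auto; now apply central_series_comm).
  rewrite (HDI I HIq), (HDI' I HIq).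
  rewrite qmul_plus_r, !qmul_opp_l, qmul_opp_r, !qmul_assoc, <- Ci; reflexivity.
Qed.

Section Pole.
Variables (p : quat) (m : nat) (k : nat -> quat).
Hypothesis Hp : Hball rho p.
Hypothesis Hk : coef_bounded rho k.
Hypothesis Ek : c = lin_pow_mul p m k.
Hypothesis Hkp : qPSeries k p <> zero.

(** On a slice through [p] all factors commute with [p]. *)
Lemma series_factor I z : imag_unit I -> in_slice I p -> in_slice I z -> Hball rho z ->
  s z = qpow (minus z p) m ** qPSeries k z.
Proof.
intros HI HIp Hz Hzr; unfold s; rewrite Ek; apply (lin_pow_mul_expansion rho); auto.
now apply (in_slice_qcomm I).
Qed.

Lemma series_zero_isolated : exists delta, 0 < delta /\ delta <= rho - norm p /\
  (forall y : quat, norm (minus y p) < delta -> Hball rho y /\ qPSeries k y <> zero) /\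
  forall I z, imag_unit I -> in_slice I p -> in_slice I z -> norm (minus z p) < delta ->
    z <> p -> s z <> zero.
Proof.
destruct (locally_nonzero _ p (continuous_qPSeries k p Hk Hp) Hkp) as (delta & Hdelta & H).
assert (Hpr := Hp); unfold Hball in Hpr.
assert (A : forall y : quat, norm (minus y p) < Rmin delta (rho - norm p) ->
  Hball rho y /\ qPSeries k y <> zero).
{ intros y Hy; pose proof (Rmin_l delta (rho - norm p)); pose proof (Rmin_r delta (rho - norm p)).
  split; [unfold Hball; pose proof (qnorm_le_minus y p); lra | apply H; lra]. }
exists (Rmin delta (rho - norm p)); split; [apply Rmin_glb_lt; lra|].
split; [apply Rmin_r|]; split; auto.
intros I z HI HIp Hz Hn Hne E; destruct (A z Hn) as [Hzr Hkz].
rewrite (series_factor I z) in E by auto.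
apply qmul_eq_zero in E; destruct E as [E|E]; [|auto].
revert E; apply qpow_neq_zero; intros E; now apply Hne, qminus_eq_zero.
Qed.

(** Off [p], [k = (z - p)^(-m) s] has values in the slice; by continuity so has it at [p]. *)
Lemma cofactor_comm I z : imag_unit I -> in_slice I p -> in_slice I z -> Hball rho z ->
  qcomm I (qPSeries k z).
Proof.
intros HI HIp.
assert (Off : forall z, in_slice I z -> Hball rho z -> z <> p -> qcomm I (qPSeries k z)).
{ clear z; intros z Hz Hzr Hne.
  assert (N : minus z p <> zero) by (intros E; now apply Hne, qminus_eq_zero).
  assert (N' := qpow_neq_zero _ m N).
  replace (qPSeries k z) with (qinv (qpow (minus z p) m) ** s z).
  - apply qcomm_mul; [|apply central_series_comm; auto; now apply in_slice_comm].
    apply qcomm_inv, qcomm_pow, qcomm_minus; auto; now apply in_slice_comm.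
  - now rewrite (series_factor I z HI HIp Hz Hzr), qmul_assoc, (qinv_l _ N'), qmul_one_l. }
intros Hz Hzr; destruct (classic (z = p)) as [->|Hne]; [|now apply Off].
apply NNPP; intros Hno.
set (phi := fun y => minus (I ** qPSeries k y) (qPSeries k y ** I)).
assert (Hphi : phi p <> zero) by (intros E; now apply Hno, qminus_eq_zero).
assert (Cphi : continuous phi p).
{ pose proof (continuous_qPSeries k p Hk Hp) as Ck.
  apply (continuous_minus (V := HN)); apply continuous_qmul; auto; apply continuous_const. }
destruct (locally_nonzero phi p Cphi Hphi) as (delta & Hdelta & H).
set (t := Rmin delta (rho - norm p) / 2).
assert (Hpr := Hp); unfold Hball in Hpr.
assert (Ht : 0 < t /\ t < delta /\ t < rho - norm p).
{ unfold t, Rmin; destruct Rle_dec; lra. }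
assert (Em : minus (plus (RtoH t) p) p = RtoH t) by apply qminus_plus_cancel.
assert (Hnt : norm (RtoH t) = t) by (rewrite norm_RtoH; apply Rabs_pos_eq; lra).
apply (H (plus (RtoH t) p)); [rewrite Em; lra|].
unfold phi; rewrite (Off (plus (RtoH t) p)).
- apply qminus_diag.
- apply slice_plus; auto; apply in_slice_RtoH.
- unfold Hball; eapply Rle_lt_trans; [apply qnorm_triangle|]; lra.
- intros E; rewrite E in Em.
  assert (Z : norm (RtoH t) = 0).
  { rewrite <- Em; rewrite qminus_diag; apply qnorm_zero. }
  lra.
Qed.

(** [w = k^(-1) h] satisfies the Cauchy-Riemann equations because the values of [k] lie in
    the slice; its expansion at [p] is that of the quotient up to the factor
    [(z - p)^(-m)]. *)
Lemma quotient_laurent I : imag_unit I -> in_slice I p ->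
  exists e, is_laurent dom quot I p (fun n => laurent_of e (n + Z.of_nat m)).
Proof.
intros HI HIp.
destruct series_zero_isolated as (delta & Hdelta & Hdr & Hk0 & Hs0).
set (w := fun z => qinv (qPSeries k z) ** qPSeries d z).
destruct (slice_expansion I w p delta HI Hdelta HIp) as [e He].
{ intros z Hz Hzr; destruct (Hk0 z Hzr) as [Hzb Hkz].
  assert (Cz : qcomm I z) by now apply in_slice_comm.
  assert (Ck := cofactor_comm I z HI HIp Hz Hzb).
  apply hol_mul.
  - now apply qcomm_inv.
  - apply (hol_inv (U := HN) I qone I (qPSeries k)); auto; now apply (qPSeries_hol rho).
  - now apply (qPSeries_hol rho). }
exists e, delta; split; auto; intros z Hz [Hz0 Hzr].
assert (Hne : z <> p).
{ intros ->; rewrite qminus_diag, qnorm_zero in Hz0; lra. }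
assert (N : minus z p <> zero) by (intros E; now apply Hne, qminus_eq_zero).
destruct (Hk0 z Hzr) as [Hzb Hkz].
split.
- split; auto; intros [_ E]; revert E; now apply (Hs0 I).
- replace (quot z) with (qpow (qinv (minus z p)) m ** w z).
  + apply laurent_shift; auto; now apply He.
  + unfold quot, w; rewrite (series_factor I z HI HIp Hz Hzb).
    rewrite qinv_qmul, (qinv_qpow _ _ N) by (auto using qpow_neq_zero).
    rewrite !qmul_assoc; f_equal.
    assert (Ck := cofactor_comm I z HI HIp Hz Hzb).
    apply (in_slice_qcomm I); auto; apply in_slice_comm; auto.
    * apply qcomm_pow, qcomm_inv, qcomm_minus; auto; now apply in_slice_comm.
    * now apply qcomm_inv.
Qed.

Lemma quotient_pole_bound : pole_bound dom quot p m.
Proof.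
intros I HI HIp; destruct (quotient_laurent I HI HIp) as [e He].
eexists; split; [exact He|].
intros n Hn; unfold laurent_of; destruct (Z.ltb_spec (- Z.of_nat n + Z.of_nat m) 0); [auto | lia].
Qed.
End Pole.

Lemma quotient_pole_order p : zeros rho s p ->
  exists n m, is_pole_order dom quot p n /\ is_multiplicity rho s p m /\ (n <= m)%nat.
Proof.
intros [Hp _].
destruct (multiplicity_exists rho c p Hrho Hc c_nonzero Hp) as (m & k & Hm & Hk & Ek & Hkp).
assert (Hb := quotient_pole_bound p m k Hp Hk Ek Hkp).
destruct (min_exists (pole_bound dom quot p) m Hb) as (n & Hn & Hmin).
exists n, m; split; [split; auto | split; auto].
Qed.

(** The factorization of [s] is available at every point of the ball, with [m = 0] where [s]
    does not vanish, so discreteness needs no case distinction. *)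
Lemma quotient_semiregular : semiregular_on (Hball rho) (zeros rho s) quot.
Proof.
split; [intros q [Hq _]; exact Hq | split; [|split]].
- intros I HI p Hp HIp.
  destruct (multiplicity_exists rho c p Hrho Hc c_nonzero Hp) as (m & k & Hm & Hk & Ek & Hkp).
  destruct (series_zero_isolated p m k Hp Hk Ek Hkp) as (delta & Hdelta & _ & _ & H).
  exists delta; split; auto; intros z Hz [_ Ez] Hne.
  apply Rnot_lt_le; intros Hlt; revert Ez; now apply (H I).
- exact quotient_regular.
- intros p Hp He; destruct (quotient_pole_order p Hp) as (n & m & [Hn _] & _).
  apply He; now exists n.
Qed.
End Quotient.

Lemma regular_coef rho f : 0 < rho -> regular_on (Hball rho) f ->
  is_expansion rho f (qcoef rho f) /\ coef_bounded rho (qcoef rho f).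
Proof.
intros Hrho Hf; destruct (regular_expansion rho f Hrho Hf) as [a Ha].
rewrite (qcoef_expansion rho f a Hrho Ha); split; auto; now apply expansion_coef_bounded with f.
Qed.

Theorem theorem5p3 :
  forall (rho : R) (f g : quat -> quat),
    0 < rho ->
    regular_on (Hball rho) f ->
    regular_on (Hball rho) g ->
    (exists q : quat, Hball rho q /\ f q <> zero) ->
    (forall p : quat, zeros rho (reg_symm rho f) p ->
       exists n m : nat,
         is_pole_order (quot_dom rho f) (left_quot rho f g) p n /\
         is_multiplicity rho (reg_symm rho f) p m /\
         (n <= m)%nat) /\
    (forall p : quat, zeros rho (reg_symm rho f) p ->
       exists n m : nat,
         is_pole_order (quot_dom rho f) (right_quot rho g f) p n /\
         is_multiplicity rho (reg_symm rho f) p m /\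
         (n <= m)%nat) /\
    semiregular_on (Hball rho) (zeros rho (reg_symm rho f)) (left_quot rho f g) /\
    semiregular_on (Hball rho) (zeros rho (reg_symm rho f)) (right_quot rho g f).
Proof.
intros rho f g Hrho Hf Hg (q0 & Hq0 & Hfq0).
destruct (regular_coef rho f Hrho Hf) as [Ef Bf].
destruct (regular_coef rho g Hrho Hg) as [Eg Bg].
set (a := qcoef rho f) in *; set (b := qcoef rho g) in *.
set (ac := fun n => qconj (a n)).
assert (Bac : coef_bounded rho ac) by now apply coef_bounded_conj.
assert (Eac : qcoef rho (reg_conj rho f) = ac).
{ apply qcoef_expansion; auto; exact (qPSeries_expansion rho ac Bac). }
assert (Es : reg_symm rho f = qPSeries (conv a ac)).
{ unfold reg_symm, reg_mul; now rewrite Eac. }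
assert (El : left_quot rho f g = fun q => qinv (qPSeries (conv a ac) q) ** qPSeries (conv ac b) q).
{ unfold left_quot; rewrite Es; unfold reg_mul; now rewrite Eac. }
assert (Er : right_quot rho g f = fun q => qinv (qPSeries (conv a ac) q) ** qPSeries (conv b ac) q).
{ unfold right_quot; rewrite Es; unfold reg_mul; now rewrite Eac. }
assert (Hnz : exists n, conv a ac n <> zero).
{ apply conv_conj_nonzero, NNPP; intros Hno; apply Hfq0.
  apply (is_series_uniq (V := HN) _ _ _ (Ef q0 Hq0)).
  eapply is_series_ext; [|exact is_series_zero]; intros n; symmetry.
  replace (a n) with (zero : quat); [apply qmul_zero_r|].
  apply NNPP; intros Hn; apply Hno; exists n; intros E; apply Hn; now rewrite E. }
assert (Hcen : forall n q, qcomm q (conv a ac n)) by (intros; apply conv_conj_central).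
assert (Bs : coef_bounded rho (conv a ac)) by now apply coef_bounded_conv.
assert (Bl : coef_bounded rho (conv ac b)) by now apply coef_bounded_conv.
assert (Br : coef_bounded rho (conv b ac)) by now apply coef_bounded_conv.
unfold quot_dom; rewrite Es, El, Er; split; [|split; [|split]].
- now apply quotient_pole_order.
- now apply quotient_pole_order.
- now apply quotient_semiregular.
- now apply quotient_semiregular.
Qed.
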